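(* Let $p_0,p_1$ be probability densities on $\mathbb{R}^d$ with potentials $U_0=-\log p_0$ and $U_1=-\log p_1$ that are differentiable with Lipschitz-continuous and dissipative gradients. Then the geometric-tempering path $(p_\tau)_{\tau\in[0,1]}$, where $p_\tau$ is the probability density proportional to $p_1^{\tau}p_0^{1-\tau}$, satisfies the Path Assumption stated in the context on the index set $I=[0,1]$.
   Context: A vector field $v:\mathbb{R}^d\to\mathbb{R}^d$ is dissipative with constants $a,b,R>0$ if $\langle x,v(x)\rangle\ge a|x|^2-b\,\mathbf{1}_{B_R(0)}(x)$ for all $x\in\mathbb{R}^d$, where $B_R(0)$ is the open ball of radius $R$ around $0$; it is dissipative if such constants exist. A probability measure $\nu$ satisfies the log-Sobolev inequality (LSI) if there is $C>0$ such that $\int f^2\log\big(f^2/\overline{f^2}\big)\,\mathrm{d}\nu\le C\int|\nabla f|^2\,\mathrm{d}\nu$ for all $f\in C_c^\infty(\mathbb{R}^d)$, where $\overline{f^2}=\int f^2\,\mathrm{d}\nu$; the smallest such $C$ is the log-Sobolev constant of $\nu$. Path Assumption on an interval $I\subset[0,\infty)$ containing $0$, for probability densities $(p_\tau)_{\tau\in I}$ with $U_\tau:=-\log p_\tau$ and $\pi_\tau(\mathrm{d}x)=p_\tau(x)\,\mathrm{d}x$: (1) $\tau\mapsto U_\tau(x)$ is differentiable and there is $c>0$ with $|\partial_\tau U_\tau(x)|\le c(|x|^2+1)$ for all $x\in\mathbb{R}^d$, $\tau\in I$. (2) $U_\tau$ is differentiable and $\nabla U_\tau$ is $L_\tau$-Lipschitz.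 (3) For every $\tau\in I$, $\tau>0$, $\nabla U_\tau$ is dissipative with constants $a_\tau,b_\tau,R_\tau>0$. (4) Over $\tau\in I$, $\tau>0$: $\sup L_\tau<\infty$, $\inf a_\tau>0$, $\sup b_\tau<\infty$, $\sup R_\tau<\infty$. (5) Each $\pi_\tau$ satisfies the LSI with constant $C_{\mathrm{LSI}}(\tau)$, and $\sup_{\tau\in I}C_{\mathrm{LSI}}(\tau)<\infty$. *)

(* Defs.v *)
From HB Require Import structures.
From mathcomp Require Import all_boot all_order all_algebra.
From mathcomp Require Import all_classical all_reals all_analysis.
From mathcomp Require Import measurable_realfun.

Set Implicit Arguments.
Unset Strict Implicit.
Unset Printing Implicit Defensive.

Import Order.TTheory GRing.Theory Num.Theory numFieldNormedType.Exports.
Local Open Scope classical_set_scope.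
Local Open Scope ring_scope.

(* R^d is 'rV[R]_d.  Its sigma-algebra is generated by the coordinate maps,
   exactly as for n.-tuple in the library; it is the Borel sigma-algebra. *)

Section measurable_rV.
Context {R : realType} (d : nat).

Let coords (i : 'I_d) (x : 'rV[R]_d) : measurableTypeR R := x ord0 i.

Let rV_set0 : g_sigma_preimage coords set0.
Proof. exact: sigma_algebra0. Qed.

Let rV_setC A : g_sigma_preimage coords A -> g_sigma_preimage coords (~` A).
Proof. exact: sigma_algebraC. Qed.

Let rV_bigcup (F : (set 'rV[R]_d)^nat) :
  (forall i, g_sigma_preimage coords (F i)) ->
  g_sigma_preimage coords (\bigcup_i (F i)).
Proof. exact: sigma_algebra_bigcup. Qed.

HB.instance Definition _ := @isMeasurable.Build default_measure_display
  'rV[R]_d (g_sigma_preimage coords) rV_set0 rV_setC rV_bigcup.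

Lemma measurable_coord (i : 'I_d) :
  measurable_fun [set: 'rV[R]_d] (fun x => x ord0 i : measurableTypeR R).
Proof.
move=> _ Y mY; rewrite setTI; apply: sub_sigma_algebra => /=.
rewrite -bigcup_seq/=; exists i => /=; first by rewrite mem_index_enum.
by exists Y => //; rewrite setTI.
Qed.

Lemma measurable_fun_rVP d' (T : measurableType d') (f : T -> 'rV[R]_d) :
  (forall i, measurable_fun [set: T] (fun t => f t ord0 i : measurableTypeR R)) ->
  measurable_fun [set: T] f.
Proof.
move=> mf.
suff H : g_sigma_preimage (fun i => coords i \o f) `<=` measurable.
  move: H; rewrite g_sigma_preimage_comp => H _ A mA.
  by apply: H; exists A.
apply: smallest_sub; first exact: sigma_algebra_measurable.
move=> A; rewrite -bigcup_seq/= => -[i _] [B mB <-]; exact: mf.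
Qed.

End measurable_rV.

(* Lebesgue measure on R^d, by slicing along the first coordinate: in
   dimension d.+1 this is the product of the one-dimensional Lebesgue measure
   and the measure in dimension d, and on R^0 it is the unit point mass. *)

Section lebesgue_rV.
Context {R : realType}.

Definition rV_cons d (z : measurableTypeR R * 'rV[R]_d) : 'rV[R]_d.+1 :=
  \row_i (if unlift ord0 i is Some j then z.2 ord0 j else z.1).

Fixpoint lebesgue_rV (d : nat) : set 'rV[R]_d -> \bar R :=
  if d is d'.+1 then
    fun A => (\int[lebesgue_measure]_t
                lebesgue_rV [set x : 'rV[R]_d' | A (rV_cons (t, x))])%E
  else fun A => \d_(0 : 'rV[R]_0) A.

Lemma rV_cons0 d z : @rV_cons d z ord0 ord0 = z.1.
Proof. by rewrite mxE unlift_none. Qed.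

Lemma rV_consS d z (i : 'I_d) : rV_cons z ord0 (lift ord0 i) = z.2 ord0 i.
Proof. by rewrite mxE liftK. Qed.

Lemma measurable_rV_cons d : measurable_fun [set: _] (@rV_cons d).
Proof.
apply: measurable_fun_rVP => i.
case: (unliftP ord0 i) => [j ->|->].
- under eq_fun do rewrite rV_consS.
  exact: (measurableT_comp (measurable_coord j) measurable_snd).
- under eq_fun do rewrite rV_cons0.
  exact: measurable_fst.
Qed.

Section step.
Variables (d : nat) (m : {sigma_finite_measure set 'rV[R]_d -> \bar R}).

Let M := pushforward (@lebesgue_measure R \x m)%E (@rV_cons d).

Let mcons := @measurable_rV_cons d.

Let M0 : M set0 = 0%E. Proof. exact: measure0. Qed.

Let M_ge0 A : (0 <= M A)%E. Proof. exact: measure_ge0. Qed.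

Let M_sigma_additive : semi_sigma_additive M.
Proof. exact: measure_semi_sigma_additive. Qed.

HB.instance Definition _ := isMeasure.Build _ _ _ M M0 M_ge0 M_sigma_additive.

Let M_sigma_finite : sigma_finite setT M.
Proof.
have /sigma_finiteP[F [TF ndF Foo]] := sigma_finiteT (@lebesgue_measure R).
have /sigma_finiteP[G [TG ndG Goo]] := sigma_finiteT m.
pose uncons (x : 'rV[R]_d.+1) : measurableTypeR R * 'rV[R]_d :=
  (x ord0 ord0, \row_j x ord0 (lift ord0 j)).
have consK : cancel (@rV_cons d) uncons.
  move=> [t x]; congr pair; first by rewrite rV_cons0.
  by apply/rowP => j; rewrite mxE rV_consS.
have muncons : measurable_fun [set: _] uncons.
  apply/measurable_fun_pair; first exact: measurable_coord.
  apply: measurable_fun_rVP => j; under eq_fun do rewrite mxE.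
  exact: measurable_coord.
exists (fun n => uncons @^-1` (F n `*` G n)).
  rewrite -preimage_bigcup (_ : \bigcup_n (F n `*` G n) = setT) ?preimage_setT//.
  rewrite -subTset => -[t x] _.
  have [n _ Fnt] : (\bigcup_n F n) t by rewrite -TF.
  have [k _ Gkx] : (\bigcup_n G n) x by rewrite -TG.
  exists (maxn n k) => //; split.
  - by move: t Fnt; exact/subsetPset/ndF/leq_maxl.
  - by move: x Gkx; exact/subsetPset/ndG/leq_maxr.
move=> n; have [mF Fn] := Foo n; have [mG Gn] := Goo n; split.
  by rewrite -[X in measurable X]setTI; apply: muncons => //; exact: measurableX.
rewrite /M /pushforward -comp_preimage.
rewrite (_ : uncons \o _ = id); last by apply/funext => z /=; rewrite consK.
by rewrite preimage_id product_measure1E// lte_mul_pinfty// ge0_fin_numE.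
Qed.

HB.instance Definition _ := Measure_isSigmaFinite.Build _ _ _ M M_sigma_finite.

Definition lebesgue_rV_step : {sigma_finite_measure set 'rV[R]_d.+1 -> \bar R} :=
  M.

End step.

Lemma lebesgue_rV_measure d :
  exists m : {sigma_finite_measure set 'rV[R]_d -> \bar R}, @lebesgue_rV d = m.
Proof.
elim: d => [|d [m IH]]; first by exists (\d_(0 : 'rV[R]_0)).
exists (lebesgue_rV_step m); apply/funext => A /=.
rewrite IH; apply: eq_integral => t _ /=; congr (m _).
by apply/seteqP; split => x; rewrite /xsection/= inE.
Qed.

Section instances.
Variable d : nat.

Let L0 : lebesgue_rV (set0 : set 'rV[R]_d) = 0%E.
Proof. by have [m ->] := lebesgue_rV_measure d; exact: measure0. Qed.

Let L_ge0 (A : set 'rV[R]_d) : (0 <= lebesgue_rV A)%E.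
Proof. by have [m ->] := lebesgue_rV_measure d; exact: measure_ge0. Qed.

Let L_sigma_additive : semi_sigma_additive (@lebesgue_rV d).
Proof.
by have [m ->] := lebesgue_rV_measure d; exact: measure_semi_sigma_additive.
Qed.

HB.instance Definition _ :=
  isMeasure.Build _ _ _ (@lebesgue_rV d) L0 L_ge0 L_sigma_additive.

Let L_sigma_finite : sigma_finite setT (@lebesgue_rV d).
Proof. by have [m ->] := lebesgue_rV_measure d; exact: sigma_finiteT. Qed.

HB.instance Definition _ :=
  Measure_isSigmaFinite.Build _ _ _ (@lebesgue_rV d) L_sigma_finite.

End instances.

Lemma lebesgue_rV_box d (a b : 'rV[R]_d) : (forall i, a ord0 i <= b ord0 i) ->
  lebesgue_rV [set x | forall i, x ord0 i \in `[a ord0 i, b ord0 i]] =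
  (\prod_(i < d) (b ord0 i - a ord0 i))%:E.
Proof.
elim: d a b => [|d IH] a b ab.
  by rewrite big_ord0 /= diracE mem_set// => -[].
rewrite big_ord_recl /=.
pose a' := \row_j a ord0 (lift ord0 j); pose b' := \row_j b ord0 (lift ord0 j).
pose c := \prod_(i < d) (b' ord0 i - a' ord0 i).
have ab' i : a' ord0 i <= b' ord0 i by rewrite !mxE.
pose J : set (measurableTypeR R) := `[a ord0 ord0, b ord0 ord0]%classic.
have mJ : measurable J by exact: measurable_itv.
have muJ : lebesgue_measure J = (b ord0 ord0 - a ord0 ord0)%:E.
  rewrite /J lebesgue_measure_itv/= lte_fin; case: ltP => [_|ba].
    by rewrite -EFinB.
  by rewrite (_ : a ord0 ord0 = b ord0 ord0) ?subrr//; apply/eqP;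
     rewrite eq_le ab ba.
rewrite (eq_integral (fun t => (c * \1_J t)%:E)).
  under eq_integral do rewrite EFinM.
  rewrite ge0_integralZl//=.
  - rewrite integral_indic// setIT [X in (_ * X)%E]muJ -EFinM mulrC.
    by congr (_ * _)%:E; apply: eq_bigr => i _; rewrite !mxE.
  - by apply/measurable_EFinP; exact: measurable_indic.
  - by rewrite lee_fin prodr_ge0// => i _; rewrite subr_ge0.
move=> t _ /=; rewrite indicE.
have [/set_mem tab|/negP tab] := boolP (t \in _).
  rewrite mulr1 -(IH a' b' ab'); congr lebesgue_rV; apply/seteqP; split => x H i.
    by have := H (lift ord0 i); rewrite rV_consS !mxE.
  case: (unliftP ord0 i) => [j ->|->]; last by rewrite rV_cons0.
  by have := H j; rewrite rV_consS !mxE.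
rewrite mulr0 -[RHS](measure0 (@lebesgue_rV d)); congr lebesgue_rV.
apply/seteqP; split => // x /(_ ord0); rewrite rV_cons0 => H.
by apply: tab; apply/mem_set.
Qed.

End lebesgue_rV.

Section euclidean.
Context {R : realType} {d : nat}.
Implicit Types (x y : 'rV[R]_d) (v : 'rV[R]_d -> 'rV[R]_d) (f : 'rV[R]_d -> R).

Definition dotp x y : R := \sum_(i < d) x ord0 i * y ord0 i.

(* The library norm on 'rV[R]_d is the sup norm; it is only used here through
   the topology and the notion of differentiability, which it shares with the
   Euclidean norm. *)
Definition enorm x : R := Num.sqrt (dotp x x).

Definition eball (r : R) : set 'rV[R]_d := [set x | enorm x < r].

Definition partial (i : 'I_d) f : 'rV[R]_d -> R :=
  fun x => 'D_(delta_mx ord0 i) f x.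

Definition grad f : 'rV[R]_d -> 'rV[R]_d := fun x => \row_i partial i f x.

Definition lipschitz_with v (L : R) : Prop :=
  0 <= L /\ forall x y, enorm (v x - v y) <= L * enorm (x - y).

Definition dissipative_with v (a b r : R) : Prop :=
  [/\ 0 < a, 0 < b, 0 < r &
      forall x, a * enorm x ^+ 2 - b * \1_(eball r) x <= dotp x (v x)].

Definition dissipative v : Prop := exists a b r : R, dissipative_with v a b r.

Fixpoint Ck (k : nat) f : Prop :=
  if k is k'.+1 then
    (forall x, differentiable f x) /\ forall i, Ck k' (partial i f)
  else continuous f.

Definition Cc_infty f : Prop :=
  (forall k, Ck k f) /\ compact (closure [set x | f x != 0]).

End euclidean.

Section log_sobolev.
Context {R : realType} {d : nat}.
Implicit Type nu : probability 'rV[R]_d R.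

(* The convention 0 * log 0 = 0 holds because ln 0 = 0.  If the mean of f ^+ 2
   is 0, the left-hand side is the integral of the zero function. *)
Definition lsi_with nu (C : R) : Prop :=
  0 < C /\
  forall f : 'rV[R]_d -> R, Cc_infty f ->
    (\int[nu]_x (f x ^+ 2 * ln (f x ^+ 2 / (\int[nu]_y (f y ^+ 2))%R))%:E
     <= C%:E * \int[nu]_x (enorm (grad f x) ^+ 2)%:E)%E.

Definition lsi nu : Prop := exists C : R, lsi_with nu C.

Definition lsi_constant nu : \bar R :=
  ereal_inf [set C%:E | C in [set C | lsi_with nu C]].

End log_sobolev.

Section path_assumption.
Context {R : realType} {d : nat}.
Implicit Types (p : 'rV[R]_d -> R) (I : set R) (g : R -> R).

(* Probability densities whose potential - log p is everywhere finite. *)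
Definition pos_density p : Prop :=
  [/\ measurable_fun [set: 'rV[R]_d] p, forall x, 0 < p x
    & (\int[@lebesgue_rV R d]_x (p x)%:E = 1)%E].

Definition potential p : 'rV[R]_d -> R := fun x => - ln (p x).

Definition has_density (nu : probability 'rV[R]_d R) p : Prop :=
  forall A, measurable A -> nu A = (\int[@lebesgue_rV R d]_(x in A) (p x)%:E)%E.

(* Differentiability relative to I, hence one-sided at the end points of I. *)
Definition diff_quotient g (t : R) : R -> R := fun s => (g s - g t) / (s - t).

Definition derivable_within I g (t : R) : Prop :=
  cvg (diff_quotient g t @ within I t^').

Definition derive_within I g (t : R) : R :=
  lim (diff_quotient g t @ within I t^').

Record path_assumption I (p : R -> 'rV[R]_d -> R) : Prop := {
  path_index : [/\ is_interval I, I 0 & I `<=` `[0, +oo[%classic];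
  path_density : forall t, I t -> pos_density (p t);
  path_time_derivable : forall t x, I t ->
    derivable_within I (fun s => potential (p s) x) t;
  path_time_growth : exists2 c : R, 0 < c &
    forall x t, I t ->
      `|derive_within I (fun s => potential (p s) x) t|
        <= c * (enorm x ^+ 2 + 1);
  path_space : exists L a b r : R -> R,
    let I_pos := I `&` `]0, +oo[%classic in
    [/\ forall t, I t ->
          (forall x, differentiable (potential (p t)) x) /\
          lipschitz_with (grad (potential (p t))) (L t),
        forall t, I_pos t ->
          dissipative_with (grad (potential (p t))) (a t) (b t) (r t)
      & [/\ (ereal_sup [set (L t)%:E | t in I_pos] < +oo)%E,
            (0 < ereal_inf [set (a t)%:E | t in I_pos])%E,
            (ereal_sup [set (b t)%:E | t in I_pos] < +oo)%E
          & (ereal_sup [set (r t)%:E | t in I_pos] < +oo)%E]];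
  path_lsi : exists pi : R -> probability 'rV[R]_d R,
    [/\ forall t, I t -> has_density (pi t) (p t),
        forall t, I t -> lsi (pi t)
      & (ereal_sup [set lsi_constant (pi t) | t in I] < +oo)%E]
}.

Definition geometric_path (p0 p1 : 'rV[R]_d -> R) (t : R) : 'rV[R]_d -> R :=
  let w x := p1 x `^ t * p0 x `^ (1 - t) in
  fun x => w x / \int[@lebesgue_rV R d]_y w y.

End path_assumption.

(* Main.v *)
(** The log-Sobolev constant of a density [exp (- U)] is bounded in terms of the
    constants in [<x, grad U x> >= a |x|^2 - b] and
    [|U x| + |grad U x|^2 <= K (1 + |x|^2)] and a bound on [U], up to an additive
    constant, on one cube.  All of these are uniform along the path, since
    [U_t = t U_1 + (1 - t) U_0] up to the constant [ln Z_t].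

    - Slicing along the coordinates and [g t ^ 2 <= \int (g^2 + g'^2)] on the line
      give an inequality of log-Sobolev type for Lebesgue measure.  Applied to
      [f exp (- U / 2)] it yields a log-Sobolev inequality with the extra term
      [\int |x|^2 f^2 exp (- U)], which integration by parts against [x] controls
      by the energy and [\int f^2 exp (- U)]: a defective inequality.
    - The Poincare inequality on a cube, together with the same integration by
      parts outside the cube, gives a Poincare inequality: some [m] has
      [\int (f - m)^2 exp (- U) <= c_P \int |grad f|^2 exp (- U)].
    - The defect is removed by applying the defective inequality to
      [k = f (f - m)^2 / (f^2 + m^2)], whose square is comparable to [f^2] for
      large [f], while [|k| <= 3/2 |f - m|]: the entropy of [f] is then bounded by
      that of [k] and the variance.

    The derivative of [ln Z_t] is the mean of [U_0 - U_1] under the density at time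
    [t]; it exists by dominated convergence and is bounded because the second
    moments are bounded uniformly in [t]. *)

From HB Require Import structures.
Require Import Defs.
From mathcomp Require Import all_boot all_order all_algebra.
From mathcomp Require Import all_classical all_reals all_analysis.
From mathcomp Require Import measurable_realfun ring lra.

Set Implicit Arguments.
Unset Strict Implicit.
Unset Printing Implicit Defensive.

Import Order.TTheory GRing.Theory Num.Theory numFieldNormedType.Exports.
Local Open Scope classical_set_scope.
Local Open Scope ring_scope.

(** * Topology and measurability of R^d *)

(** The gradients are only Lipschitz and [U_1 - U_0] may grow quadratically, so neither a convexity
    criterion nor a bounded-perturbation argument is at hand. Dissipativity is linear in the
    gradient and therefore passes to the mixtures [U_t] with fixed constants. Sharp constants are
    irrelevant; what counts is that they do not depend on [t]. The normalisation [ln Z_t] is dealt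
    with twice: [Z_t <= 1] preserves the upper bound on the potential, and the comparison on the
    cube sees only the oscillation of the potential. Test functions have compact support, but
    [f - m] has not. This rules out working with the entropy of [f - m] directly; [k] replaces it
    because it is a C^1 function of [f] that vanishes where [f] does. Integrals of functions without
    compact support are reached through cutoffs and monotone convergence. *)

Section rV_topology.
Context {R : realType}.

Lemma rV_coord_le_norm d (x : 'rV[R]_d) i : `|x ord0 i| <= `|x|.
Proof.
rewrite [leRHS]/Num.norm /= mx_normrE; apply/bigmax_geP; right.
by exists (ord0, i).
Qed.

Lemma rV_norm_leP d (x : 'rV[R]_d) N : 0 <= N ->
  reflect (forall i, `|x ord0 i| <= N) (`|x| <= N).
Proof.
move=> N0; apply: (iffP idP) => [xN i|xN].
  exact: le_trans (rV_coord_le_norm x i) xN.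
rewrite [leLHS]/Num.norm /= mx_normrE; apply/bigmax_leP; split => // -[i j] _ /=.
by rewrite ord1.
Qed.

Lemma rV_norm_ltP d (x : 'rV[R]_d) N : 0 < N ->
  reflect (forall i, `|x ord0 i| < N) (`|x| < N).
Proof.
move=> N0; apply: (iffP idP) => [xN i|xN].
  exact: le_lt_trans (rV_coord_le_norm x i) xN.
rewrite [ltLHS]/Num.norm /= mx_normrE; apply/bigmax_ltP; split => // -[i j] _ /=.
by rewrite ord1.
Qed.

(** The sigma-algebra is generated by the coordinates, so an open set is written as the countable
    union of the boxes inside it that have a rational centre and half-width [1 / (n + 1)]. *)
Lemma open_measurable_rV d (A : set 'rV[R]_d) : open A -> measurable A.
Proof.
move=> oA.
pose box (q : 'rV[rat]_d * nat) : set 'rV[R]_d :=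
  [set x | forall i, `|x ord0 i - ratr (q.1 ord0 i)| < q.2.+1%:R^-1].
have mbox q : measurable (box q).
  have -> : box q = \bigcap_(i in [set: 'I_d])
      ((fun x : 'rV[R]_d => x ord0 i : measurableTypeR R) @^-1`
       [set t : R | `|t - ratr (q.1 ord0 i)| < q.2.+1%:R^-1]).
    by apply/seteqP; split => [x bx i _|x bx i]; apply: bx.
  apply: fin_bigcap_measurable => // i _; rewrite -[X in measurable X]setTI.
  apply: measurable_coord => //.
  have -> : [set t : R | `|t - ratr (q.1 ord0 i)| < q.2.+1%:R^-1] =
            ball (ratr (q.1 ord0 i) : R) q.2.+1%:R^-1.
    by apply/seteqP; split => t; rewrite /ball/= distrC.
  exact: measurable_ball.
have -> : A = \bigcup_q (if `[< box q `<=` A >] then box q else set0).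
  apply/seteqP; split => [x Ax|x [q _]]; last first.
    by case: ifPn => // /asboolP; apply.
  have /nbhs_ballP[e /= e0 xeA] : nbhs x A by exact: open_nbhs_nbhs.
  (* Half of [e], because a point of the box and [x] are compared through the rational centre. *)
  have [n ne] : exists n : nat, n.+1%:R^-1 < e / 2.
    have /ltr_add_invr[n] : 0 < e / 2 by rewrite divr_gt0.
    by rewrite add0r => ?; exists n.
  have ex i : exists q : rat, `|x ord0 i - ratr q| < n.+1%:R^-1.
    have /rat_in_itvoo[q] : x ord0 i - n.+1%:R^-1 < x ord0 i + n.+1%:R^-1.
      by rewrite ltrD2l (@lt_trans _ _ 0)// ?oppr_lt0 invr_gt0.
    rewrite in_itv/= => /andP[h1 h2]; exists q.
    by rewrite distrC ltr_distl h1 h2.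
  have [q xq] := choice ex.
  exists (\row_i q i, n) => //=.
  case: ifPn => [_ i|/asboolPn []]; first by rewrite /= mxE.
  move=> y by_; apply: xeA; rewrite -ball_normE /ball_/=.
  apply/rV_norm_ltP => // i; rewrite !mxE.
  have := by_ i; have := xq i; rewrite /= mxE.
  move: (ratr _) => r h1 h2.
  have -> : x ord0 i - y ord0 i = (x ord0 i - r) - (y ord0 i - r) by ring.
  rewrite (le_lt_trans (ler_normB _ _))// [e]splitr ltrD//.
    exact: lt_trans h1 ne.
  exact: lt_trans h2 ne.
apply: countable_bigcupT_measurable => //= q.
by case: ifP => // _; exact: measurable0.
Qed.

Lemma continuous_measurable_rV d (f : 'rV[R]_d -> R) :
  continuous f -> measurable_fun setT f.
Proof.
move=> /continuousP cf; apply: (measurability _ (RGenOpens.measurableE R)).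
move=> _ [_ [a [b ->] <-]]; rewrite setTI.
by apply: open_measurable_rV; exact/cf/interval_open.
Qed.

Lemma rV_consB d t s (x y : 'rV[R]_d) :
  rV_cons (t, x) - rV_cons (s, y) = rV_cons (t - s, x - y).
Proof. by apply/rowP => i; rewrite !mxE; case: unlift => [j|//]/=; rewrite !mxE. Qed.

Lemma rV_cons_norm_leP d t (x : 'rV[R]_d) N : 0 <= N ->
  (`|rV_cons (t, x)| <= N) = (`|t| <= N) && (`|x| <= N).
Proof.
move=> N0; apply/rV_norm_leP/andP => // [H|[tN /rV_norm_leP xN] i].
  split; first by have := H ord0; rewrite rV_cons0.
  by apply/rV_norm_leP => // i; have := H (lift ord0 i); rewrite rV_consS.
case: (unliftP ord0 i) => [j ->|->]; first by rewrite rV_consS xN.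
by rewrite rV_cons0.
Qed.

Lemma continuous_rV_cons_l d (x : 'rV[R]_d) : continuous (fun t => rV_cons (t, x)).
Proof.
move=> t; apply/cvgrPdist_le => e e0; near=> s.
have e0' := ltW e0; rewrite rV_consB rV_cons_norm_leP// subrr normr0 e0' andbT.
near: s; apply: cvgr_dist_le => //.
Unshelve. all: by end_near. Qed.

Lemma continuous_rV_cons_r d t : continuous (fun x : 'rV[R]_d => rV_cons (t, x)).
Proof.
move=> x.
apply: (proj2 (@cvgrPdist_le _ _ _ (nbhs x) (nbhs_filter x) _ _)) => e e0.
apply/nbhs_ballP; exists e => //= y.
rewrite -ball_normE => /ltW xy; have e0' := ltW e0.
by rewrite rV_consB rV_cons_norm_leP// subrr normr0 e0'.
Qed.

(** With the next lemma: moving along a basis vector commutes with slicing, so a partial derivative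
    becomes the derivative along a line or a partial derivative of a slice. *)
Lemma rV_cons_shift0 d t h (x : 'rV[R]_d) :
  rV_cons (h + t, x) = h *: delta_mx ord0 ord0 + rV_cons (t, x).
Proof.
apply/rowP => i; rewrite !mxE; case: unliftP => [j ->|->]/=.
  by rewrite mulr0 add0r.
by rewrite mulr1.
Qed.

Lemma rV_cons_shiftS d t h (x : 'rV[R]_d) i :
  rV_cons (t, h *: delta_mx ord0 i + x) =
  h *: delta_mx ord0 (lift ord0 i) + rV_cons (t, x).
Proof.
apply/rowP => k; rewrite !mxE; case: unliftP => [j ->|->]/=.
  by rewrite !mxE (inj_eq lift_inj).
by rewrite mulr0 add0r.
Qed.

End rV_topology.

(** * Bounded functions with bounded support, and slicing *)

Section bounded_support.
Context {R : realType} {dd : measure_display} {T : measurableType dd}.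
Variable nrm : T -> R.
Implicit Types F G : T -> R.

(** The multipliers of [bdd_supp]. Unbounded weights, such as [|x|^2] and the derivatives of the
    potential, enter the integrals in this way. The size [nrm] is abstract so as to cover the line,
    R^d and the product space that [rV_cons] maps to R^d. *)
Definition loc_bounded G :=
  measurable_fun setT G /\ forall N : R, exists B : R, forall x, nrm x <= N -> `|G x| <= B.

(* One constant bounds both the function and the size of its support. *)
Definition bdd_supp F :=
  measurable_fun setT F /\
  exists K : R, forall x, `|F x| <= K /\ (K < nrm x -> F x = 0).

Lemma bdd_supp_loc_bounded F : bdd_supp F -> loc_bounded F.
Proof. by move=> [mF [K FK]]; split => // N; exists K => x _; have [] := FK x. Qed.

Lemma loc_boundedD F G : loc_bounded F -> loc_bounded G ->
  loc_bounded (fun x => F x + G x).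
Proof.
move=> [mF bF] [mG bG]; split; first exact: measurable_funD.
move=> N; have [B FB] := bF N; have [C GC] := bG N; exists (B + C) => x xN.
by rewrite (le_trans (ler_normD _ _))// lerD// (FB, GC).
Qed.

Lemma loc_boundedM F G : loc_bounded F -> loc_bounded G ->
  loc_bounded (fun x => F x * G x).
Proof.
move=> [mF bF] [mG bG]; split; first exact: measurable_funM.
move=> N; have [B FB] := bF N; have [C GC] := bG N; exists (B * C) => x xN.
by rewrite normrM ler_pM// (FB, GC).
Qed.

Lemma loc_bounded_cst c : loc_bounded (cst c).
Proof. by split; [exact: measurable_cst|move=> N; exists `|c|]. Qed.

Lemma loc_boundedB F G : loc_bounded F -> loc_bounded G ->
  loc_bounded (fun x => F x - G x).
Proof.
move=> bF bG; under eq_fun do rewrite -mulN1r.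
by apply: loc_boundedD => //; apply: loc_boundedM => //; exact: loc_bounded_cst.
Qed.

Lemma loc_boundedX F n : loc_bounded F -> loc_bounded (fun x => F x ^+ n).
Proof.
move=> bF; elim: n => [|n IH]; first exact: loc_bounded_cst.
by under eq_fun do rewrite exprS; exact: loc_boundedM.
Qed.

Lemma loc_bounded_sum (I : Type) (s : seq I) (F : I -> T -> R) :
  (forall i, loc_bounded (F i)) -> loc_bounded (fun x => \sum_(i <- s) F i x).
Proof.
move=> bF; elim: s => [|i s IH].
  by under eq_fun do rewrite big_nil; exact: loc_bounded_cst.
by under eq_fun do rewrite big_cons; exact: loc_boundedD.
Qed.

Lemma bdd_suppMr F G : loc_bounded G -> bdd_supp F -> bdd_supp (fun x => F x * G x).
Proof.
move=> [mG bG] [mF [K FK]]; split; first exact: measurable_funM.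
have [B GB] := bG K; exists (Num.max K (K * B)) => x; have [Fx Fx0] := FK x.
split; last by rewrite gt_max => /andP[/Fx0 -> _]; rewrite mul0r.
rewrite le_max; have [xK|/Fx0 F0] := leP (nrm x) K.
  by rewrite normrM (ler_pM _ _ Fx)// ?GB// orbT.
by rewrite F0 mul0r normr0 (le_trans (normr_ge0 _) Fx).
Qed.

Lemma bdd_suppMl F G : loc_bounded G -> bdd_supp F -> bdd_supp (fun x => G x * F x).
Proof. by move=> bG bF; under eq_fun do rewrite mulrC; exact: bdd_suppMr. Qed.

Lemma bdd_suppZ c F : bdd_supp F -> bdd_supp (fun x => c * F x).
Proof. exact/bdd_suppMl/loc_bounded_cst. Qed.

Lemma bdd_supp0 : bdd_supp (cst 0).
Proof. by split; [exact: measurable_cst|exists 0 => x; rewrite normr0]. Qed.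

Lemma bdd_suppD F G : bdd_supp F -> bdd_supp G -> bdd_supp (fun x => F x + G x).
Proof.
move=> [mF [K FK]] [mG [L GL]]; split; first exact: measurable_funD.
(* A point of [T] is what shows that [K] and [L] are nonnegative. *)
have [x0|x0] := pselect (exists x : T, True); last first.
  by exists 0 => x; case: x0; exists x.
have K0 : 0 <= K by case: x0 => x _; have [+ _] := FK x; exact: le_trans.
have L0 : 0 <= L by case: x0 => x _; have [+ _] := GL x; exact: le_trans.
exists (K + L) => x; have [Fx F0] := FK x; have [Gx G0] := GL x.
split; first by rewrite (le_trans (ler_normD _ _))// lerD.
by move=> h; rewrite F0 ?G0 ?addr0//; lra.
Qed.

Lemma bdd_suppB F G : bdd_supp F -> bdd_supp G -> bdd_supp (fun x => F x - G x).
Proof.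
move=> bF bG; under eq_fun do rewrite -mulN1r.
by apply: bdd_suppD => //; exact: bdd_suppZ.
Qed.

Lemma bdd_supp_sum (I : Type) (s : seq I) (F : I -> T -> R) :
  (forall i, bdd_supp (F i)) -> bdd_supp (fun x => \sum_(i <- s) F i x).
Proof.
move=> bF; elim: s => [|i s IH].
  by under eq_fun do rewrite big_nil; exact: bdd_supp0.
by under eq_fun do rewrite big_cons; exact: bdd_suppD.
Qed.

Lemma bdd_suppX F n : bdd_supp F -> bdd_supp (fun x => F x ^+ n.+1).
Proof.
move=> bF; under eq_fun do rewrite exprS.
by apply: bdd_suppMr => //; exact/loc_boundedX/bdd_supp_loc_bounded.
Qed.

Variable mu : {measure set T -> \bar R}.
Hypothesis mnrm : measurable_fun setT nrm.
Hypothesis mu_ball : forall N, (mu [set x | (nrm x <= N)%R] < +oo)%E.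

Lemma bdd_supp_integrable F : bdd_supp F -> mu.-integrable setT (EFin \o F).
Proof.
move=> [mF [K FK]].
have mB : measurable [set x | nrm x <= K].
  rewrite [X in measurable X](_ : _ = nrm @^-1` `]-oo, K]%classic); last first.
    by apply/seteqP; split => x /=; rewrite in_itv/=.
  by rewrite -[X in measurable X]setTI; apply: mnrm => //; exact: measurable_itv.
rewrite -(setUv [set x | nrm x <= K]); apply/integrableP; split.
  by apply/measurable_EFinP; rewrite setUv.
rewrite ge0_integral_setU//=; last 3 first.
  - exact: measurableC.
  - by apply/measurable_EFinP/measurableT_comp => //; rewrite setUv.
  - exact/disj_setPCl.
rewrite [X in (_ + X)%E](_ : _ = 0%E) ?adde0; last first.
  apply: integral0_eq => x /= /negP; rewrite -ltNge => h.
  by have [_ ->] := FK x; rewrite ?normr0.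
apply: (@le_lt_trans _ _ (\int[mu]_(x in [set x | (nrm x <= K)%R]) (cst K%:E x))%E).
  apply: ge0_le_integral => //.
  - exact/measurable_EFinP/measurable_funTS/measurableT_comp.
  - by move=> x _; have [+ _] := FK x; rewrite lee_fin.
rewrite integral_cst//; have [x0|x0] := pselect (exists x : T, True).
  have K0 : 0 <= K by case: x0 => x _; have [+ _] := FK x; exact: le_trans.
  by rewrite lte_mul_pinfty.
rewrite [X in mu X](_ : _ = set0) ?measure0 ?mule0 ?ltry//.
by apply/seteqP; split => // x; case: x0; exists x.
Qed.

(** All slices of a function share one constant [K], so this bounds their integrals uniformly. *)
Lemma bdd_supp_int_le F (K : R) : bdd_supp F ->
  (forall x, `|F x| <= K /\ (K < nrm x -> F x = 0)) ->
  `|\int[mu]_x F x| <= K * fine (mu [set x | nrm x <= K]).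
Proof.
move=> bF FK; have iF := bdd_supp_integrable bF.
rewrite (le_trans (le_normr_Rintegral measurableT iF))//.
have mB : measurable [set x | nrm x <= K].
  rewrite [X in measurable X](_ : _ = nrm @^-1` `]-oo, K]%classic); last first.
    by apply/seteqP; split => x /=; rewrite in_itv/=.
  by rewrite -[X in measurable X]setTI; apply: mnrm => //; exact: measurable_itv.
rewrite -Rintegral_cst// (Rintegral_mkcond _ [set x | nrm x <= K]).
have bK : bdd_supp ((fun=> K) \_ [set x | nrm x <= K]).
  rewrite (_ : _ \_ _ = fun x => K * \1_[set x | nrm x <= K] x); last first.
    by apply/funext => x; rewrite patchE indicE; case: ifP => _; rewrite ?mulr1 ?mulr0.
  split; first by apply: measurable_funM => //; exact: measurable_indic.
  exists (Num.max K `|K|) => x; rewrite indicE; split.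
    by rewrite le_max; case: (_ \in _); rewrite ?mulr1 ?mulr0 ?normr0 ?normr_ge0 ?lexx orbT.
  rewrite gt_max => /andP[Kx _]; rewrite memNset ?mulr0//=.
  by apply/negP; rewrite -ltNge.
apply: le_Rintegral => //; first by have [] := integrable_norm iF.
  exact: bdd_supp_integrable.
move=> x _; have [Fx F0] := FK x; rewrite patchE; case: ifPn => // /negP; rewrite inE/=.
by move=> /negP; rewrite -ltNge => /F0 ->; rewrite normr0.
Qed.

End bounded_support.

(** * Lebesgue integrals on R^d and Fubini along the first coordinate *)

Section lebesgue_rV_integral.
Context {R : realType}.

(** The size is the sup norm: its balls are boxes, whose measure is known and whose slices are again
    balls. *)
Definition mbs d (F : 'rV[R]_d -> R) := bdd_supp (fun x : 'rV[R]_d => `|x|) F.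
Definition mlb d (F : 'rV[R]_d -> R) := loc_bounded (fun x : 'rV[R]_d => `|x|) F.
Definition mbs1 (F : measurableTypeR R -> R) := bdd_supp (fun x : R => `|x|) F.

Lemma measurable_norm_rV d : measurable_fun setT (fun x : 'rV[R]_d => `|x|).
Proof. by apply: continuous_measurable_rV; exact: norm_continuous. Qed.

Lemma lebesgue_rV_ballE d (N : R) : 0 <= N ->
  @lebesgue_rV R d [set x | (`|x| <= N)%R] = (\prod_(i < d) (2 * N))%:E.
Proof.
move=> N0; pose a : 'rV[R]_d := \row__ (- N); pose b : 'rV[R]_d := \row__ N.
have E : [set x : 'rV[R]_d | `|x| <= N] =
    [set x : 'rV[R]_d | forall i, x ord0 i \in `[a ord0 i, b ord0 i]].
  apply/seteqP; split => x /=.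
    by move=> /rV_norm_leP h i; rewrite !mxE in_itv/= -ler_norml h.
  by move=> h; apply/rV_norm_leP => // i; have := h i; rewrite !mxE in_itv/= ler_norml.
rewrite E lebesgue_rV_box => [|i]; last by rewrite !mxE; lra.
by congr (_%:E); apply: eq_bigr => i _; rewrite !mxE; ring.
Qed.

Lemma lebesgue_rV_ball d (N : R) :
  (@lebesgue_rV R d [set x | (`|x| <= N)%R] < +oo)%E.
Proof.
have [N0|N0] := ltP N 0; last by rewrite lebesgue_rV_ballE// ltry.
rewrite [X in lebesgue_rV X](_ : _ = set0) ?measure0 ?ltry//.
by apply/seteqP; split => // x /= xN; have := normr_ge0 x; rewrite leNgt (le_lt_trans xN N0).
Qed.

Lemma mbs_integrable d (F : 'rV[R]_d -> R) :
  mbs F -> (@lebesgue_rV R d).-integrable setT (EFin \o F).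
Proof.
apply: bdd_supp_integrable; first exact: measurable_norm_rV.
exact: lebesgue_rV_ball.
Qed.

Lemma lebesgue_ball (N : R) :
  (@lebesgue_measure R [set x : R | (`|x| <= N)%R] < +oo)%E.
Proof.
rewrite (_ : [set x | _] = `[- N, N]%classic).
  by rewrite lebesgue_measure_itv/=; case: ifP; rewrite ?ltry// -EFinB ltry.
by apply/seteqP; split => x /=; rewrite in_itv/= ler_norml.
Qed.

Lemma mbs1_integrable (F : measurableTypeR R -> R) :
  mbs1 F -> (@lebesgue_measure R).-integrable setT (EFin \o F).
Proof.
apply: (@bdd_supp_integrable _ _ (measurableTypeR R) (fun x : R => `|x|)).
  exact: normr_measurable.
exact: lebesgue_ball.
Qed.

Variable d : nat.
Local Notation mu1 := (@lebesgue_measure R).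
Local Notation Ld := (@lebesgue_rV R d).

Lemma lebesgue_rVSE :
  @lebesgue_rV R d.+1 = pushforward (mu1 \x Ld)%E (@rV_cons R d).
Proof.
apply/funext => A /=; apply: eq_integral => t _ /=; congr (lebesgue_rV _).
by apply/seteqP; split => x; rewrite /xsection/= inE.
Qed.

Variable F : 'rV[R]_d.+1 -> R.
Hypothesis bF : mbs F.

Let Fc : measurableTypeR R * 'rV[R]_d -> R := F \o @rV_cons R d.

Let integrable_Fc : (mu1 \x Ld)%E.-integrable setT (EFin \o Fc).
Proof.
apply: (@bdd_supp_integrable _ _ _ (fun z => `|rV_cons z|)).
- exact: (measurableT_comp (@measurable_norm_rV _) (@measurable_rV_cons _ _)).
- by move=> N; have := lebesgue_rV_ball d.+1 N; rewrite lebesgue_rVSE; exact.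
- case: bF => mF [K FK]; split; last by exists K => z; exact: FK.
  exact: (measurableT_comp mF (@measurable_rV_cons _ _)).
Qed.

Let integralE :
  (\int[@lebesgue_rV R d.+1]_x (F x)%:E = \int[(mu1 \x Ld)]_z (Fc z)%:E)%E.
Proof.
transitivity (\int[pushforward (mu1 \x Ld) (@rV_cons R d)]_x (F x)%:E)%E.
  apply: eq_measure_integral => A mA _.
  exact: (congr1 (fun m => m A) lebesgue_rVSE).
rewrite integral_pushforward//.
- exact: measurable_rV_cons.
- by apply/measurable_EFinP; case: bF.
Qed.

Lemma mbs_slice_l t : mbs (fun x => F (rV_cons (t, x))).
Proof.
case: bF => mF [K FK]; split.
  have : measurable_fun setT (F \o @rV_cons R d).
    exact: (measurableT_comp mF (@measurable_rV_cons _ _)).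
  by move=> mFc; exact: (measurableT_comp mFc (pair1_measurable t)).
have K0 : 0 <= K by have [+ _] := FK 0; exact: le_trans.
exists K => x; have [h h0] := FK (rV_cons (t, x)); split => // Kx.
by apply: h0; rewrite ltNge rV_cons_norm_leP// negb_and -!ltNge Kx orbT.
Qed.

Lemma mbs_slice_r x : mbs1 (fun t => F (rV_cons (t, x))).
Proof.
case: bF => mF [K FK]; split.
  have : measurable_fun setT (F \o @rV_cons R d).
    exact: (measurableT_comp mF (@measurable_rV_cons _ _)).
  by move=> mFc; exact: (measurableT_comp mFc (pair2_measurable x)).
have K0 : 0 <= K by have [+ _] := FK 0; exact: le_trans.
exists K => t; have [h h0] := FK (rV_cons (t, x)); split => // Kx.
by apply: h0; rewrite ltNge rV_cons_norm_leP// negb_and -!ltNge Kx.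
Qed.

Lemma mbs1_integral_slice : mbs1 (fun t => \int[Ld]_x F (rV_cons (t, x))).
Proof.
split.
  have := measurable_fubini_F integrable_Fc.
  by move=> /(measurableT_comp (fine_measurable measurableT)); exact.
case: (bF) => mF [K FK].
have K0 : 0 <= K by have [+ _] := FK 0; exact: le_trans.
exists (Num.max K (K * fine (Ld [set x | `|x| <= K]))) => t; split.
  rewrite le_max; apply/orP; right; apply: bdd_supp_int_le => [| |//|x].
  - exact: measurable_norm_rV.
  - exact: lebesgue_rV_ball.
  - exact: mbs_slice_l.
  have [h h0] := FK (rV_cons (t, x)); split => // Kx.
  by apply: h0; rewrite ltNge rV_cons_norm_leP// negb_and -!ltNge Kx orbT.
rewrite gt_max => /andP[Kt _]; under eq_Rintegral => x _.
  have [_ ->] := FK (rV_cons (t, x)); first over.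
  by rewrite ltNge rV_cons_norm_leP// negb_and -!ltNge Kt.
by rewrite Rintegral_cst// mul0r.
Qed.

Lemma mbs_integral_slice : mbs (fun x => \int[mu1]_t F (rV_cons (t, x))).
Proof.
split.
  have := measurable_fubini_G integrable_Fc.
  by move=> /(measurableT_comp (fine_measurable measurableT)); exact.
case: (bF) => mF [K FK].
have K0 : 0 <= K by have [+ _] := FK 0; exact: le_trans.
exists (Num.max K (K * fine (mu1 [set x : R | `|x| <= K]))) => x; split.
  rewrite le_max; apply/orP; right.
  apply: (@bdd_supp_int_le _ _ (measurableTypeR R) (fun x : R => `|x|) mu1) => [| |//|t].
  - exact: normr_measurable.
  - exact: lebesgue_ball.
  - exact: mbs_slice_r.
  have [h h0] := FK (rV_cons (t, x)); split => // Kx.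
  by apply: h0; rewrite ltNge rV_cons_norm_leP// negb_and -!ltNge Kx.
rewrite gt_max => /andP[Kx _]; under eq_Rintegral => t _.
  have [_ ->] := FK (rV_cons (t, x)); first over.
  by rewrite ltNge rV_cons_norm_leP// negb_and -!ltNge Kx orbT.
by rewrite Rintegral_cst// mul0r.
Qed.

(** Both orders of integration are used: this one for inductions on the dimension, the next one to
    apply a one-dimensional fact on each line parallel to the first axis. *)
Lemma Rintegral_rV_cons_l :
  \int[@lebesgue_rV R d.+1]_x F x = \int[mu1]_t \int[Ld]_x F (rV_cons (t, x)).
Proof.
rewrite /Rintegral integralE -integral12_prod_meas1//; congr fine.
apply: eq_integral => t _; rewrite /fubini_F fineK//.
apply: integrable_fin_num => //; exact/mbs_integrable/mbs_slice_l.
Qed.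

Lemma Rintegral_rV_cons_r :
  \int[@lebesgue_rV R d.+1]_x F x = \int[Ld]_x \int[mu1]_t F (rV_cons (t, x)).
Proof.
rewrite /Rintegral integralE -integral21_prod_meas1//; congr fine.
apply: eq_integral => t _; rewrite /fubini_G fineK//.
apply: integrable_fin_num => //; exact/mbs1_integrable/mbs_slice_r.
Qed.

End lebesgue_rV_integral.

Lemma continuous_sqr (R : realType) (T : topologicalType) (f : T -> R) :
  continuous f -> continuous (fun x => f x ^+ 2).
Proof. by move=> cf x; apply: cvgM; exact: cf. Qed.

Lemma continuous_add (R : realType) (T : topologicalType) (f g : T -> R) :
  continuous f -> continuous g -> continuous (fun x => f x + g x).
Proof. by move=> cf cg x; apply: cvgD; [exact: cf|exact: cg]. Qed.

Lemma continuous_mul (R : realType) (T : topologicalType) (f g : T -> R) :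
  continuous f -> continuous g -> continuous (fun x => f x * g x).
Proof. by move=> cf cg x; apply: cvgM; [exact: cf|exact: cg]. Qed.

Lemma continuous_compr (R : realType) (T : topologicalType) (f : T -> R) (h : R -> R) :
  continuous f -> continuous h -> continuous (fun x => h (f x)).
Proof. by move=> cf ch x; exact: (continuous_comp (cf x) (ch _)). Qed.

(** * Functions of class C^1 *)

Section partial_derivatives.
Context {R : realType}.

(** Reduces directional derivatives to one variable, where the chain rule and the slicing identities
    apply. *)
Lemma is_derive_lineP (V : normedModType R) (f : V -> R) x v l :
  is_derive x v f l <-> is_derive (0 : R) 1 (fun h => f (h *: v + x)) l.
Proof.
have E : (fun h : R => h^-1 *: ((f \o shift x) (h *: v) - f x)) =
    (fun h : R => h^-1 *: (((fun h => f (h *: v + x)) \o shift 0) (h *: (1 : R)) -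
       (fun h => f (h *: v + x)) 0)).
  apply/funext => h /=; rewrite addr0 scale0r add0r.
  by rewrite [h *: (1 : R)]mulr1.
split=> -[d dE]; split.
- by rewrite /derivable -E.
- by rewrite -dE /derive -E.
- by rewrite /derivable E.
- by rewrite -dE /derive E.
Qed.

Lemma is_derive_compl (V : normedModType R) (f : V -> R) (g : R -> R) x v a b :
  is_derive (f x) 1 g a -> is_derive x v f b -> is_derive x v (fun y => g (f y)) (a * b).
Proof.
move=> dg /is_derive_lineP df; apply/is_derive_lineP.
have -> : (fun h : R => g (f (h *: v + x))) = g \o (fun h => f (h *: v + x)) by [].
by apply: is_derive1_comp; rewrite /= ?scale0r ?add0r.
Qed.

(* Continuously differentiable functions, carried along with their partial
   derivatives [D]; [C1c] adds compact support. *)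
Record C1f d (f : 'rV[R]_d -> R) (D : 'I_d -> 'rV[R]_d -> R) : Prop := {
  C1f_cont : continuous f;
  C1f_contD : forall i, continuous (D i);
  C1f_derive : forall i x, is_derive x (delta_mx ord0 i) f (D i x) }.

Definition supp_in d (N : R) (f : 'rV[R]_d -> R) := forall x, N < `|x| -> f x = 0.

Definition C1c d (f : 'rV[R]_d -> R) D :=
  C1f f D /\ exists N, supp_in N f /\ forall i, supp_in N (D i).

Lemma continuous_mlb d (f : 'rV[R]_d -> R) : continuous f -> mlb f.
Proof.
move=> cf; split; first exact: continuous_measurable_rV.
move=> N; have [N0|N0] := ltP N 0.
  by exists 0 => x xN; have := le_lt_trans xN N0; rewrite normr_lt0.
have cB : compact [set x : 'rV[R]_d | `|x| <= N].
  apply: bounded_closed_compact.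
    exists N; split; first exact: num_real.
    by move=> M NM x /= xN; rewrite (le_trans xN)// ltW.
  rewrite (_ : [set x | _] = (fun x : 'rV[R]_d => `|x|) @^-1` [set t | t <= N]) //.
  by apply: closed_comp => [x _|]; [exact: norm_continuous|exact: closed_le].
have := continuous_compact (continuous_subspaceT cf) cB.
move=> /compact_bounded[M [_ HM]]; exists (M + 1) => x xN.
by apply: (HM (M + 1)); [lra|exists x].
Qed.

Lemma continuous_mbs d (f : 'rV[R]_d -> R) N : continuous f -> supp_in N f -> mbs f.
Proof.
move=> cf sf; have [mf /(_ N)[B fB]] := continuous_mlb cf; split => //.
exists (Num.max N (Num.max B 0)) => x; split.
  rewrite !le_max; have [xN|/sf ->] := leP `|x| N; first by rewrite fB ?orbT.
  by rewrite normr0 lexx !orbT.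
by rewrite gt_max => /andP[/sf].
Qed.

Lemma C1c_mbs d (f : 'rV[R]_d -> R) D : C1c f D -> mbs f.
Proof. by move=> [[cf _ _] [N [sf _]]]; exact: continuous_mbs sf. Qed.

Lemma C1c_mbsD d (f : 'rV[R]_d -> R) D i : C1c f D -> mbs (D i).
Proof. by move=> [[_ cD _] [N [_ sD]]]; exact: continuous_mbs (sD i). Qed.

Lemma C1f_mlb d (f : 'rV[R]_d -> R) D : C1f f D -> mlb f.
Proof. by move=> [cf _ _]; exact: continuous_mlb. Qed.

Lemma C1f_mlbD d (f : 'rV[R]_d -> R) D i : C1f f D -> mlb (D i).
Proof. by move=> [_ cD _]; exact: continuous_mlb. Qed.

Lemma C1f_slice_l d (f : 'rV[R]_d.+1 -> R) D t : C1f f D ->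
  C1f (fun x => f (rV_cons (t, x))) (fun i x => D (lift ord0 i) (rV_cons (t, x))).
Proof.
move=> [cf cD df]; split.
- move=> x; exact: (continuous_comp (@continuous_rV_cons_r _ _ t x) (cf _)).
- by move=> i x; exact: (continuous_comp (@continuous_rV_cons_r _ _ t x) (cD _ _)).
- move=> i x; apply/is_derive_lineP; have /is_derive_lineP := df (lift ord0 i) (rV_cons (t, x)).
  by under eq_fun do rewrite -rV_cons_shiftS.
Qed.

Lemma C1f_slice_r d (f : 'rV[R]_d.+1 -> R) D x : C1f f D ->
  [/\ continuous (fun t : R => f (rV_cons (t, x))),
      continuous (fun t : R => D ord0 (rV_cons (t, x))) &
      forall t : R, is_derive t (1 : R) (fun t => f (rV_cons (t, x)))
        (D ord0 (rV_cons (t, x)))].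
Proof.
move=> [cf cD df]; split.
- by move=> t; exact: (continuous_comp (@continuous_rV_cons_l _ _ x t) (cf _)).
- by move=> t; exact: (continuous_comp (@continuous_rV_cons_l _ _ x t) (cD _ _)).
- move=> t; apply/is_derive_lineP; have /is_derive_lineP := df ord0 (rV_cons (t, x)).
  under eq_fun do rewrite -rV_cons_shift0.
  by under [in X in _ -> X]eq_fun do rewrite [_ *: (1 : R)]mulr1.
Qed.

Lemma supp_in_slice_l d (f : 'rV[R]_d.+1 -> R) N t : supp_in N f ->
  supp_in N (fun x => f (rV_cons (t, x))).
Proof.
move=> sf x Nx; apply: sf; have [N0|N0] := ltP N 0; first exact: lt_le_trans N0 _.
by rewrite ltNge rV_cons_norm_leP// negb_and -!ltNge Nx orbT.
Qed.

Lemma C1c_slice_l d (f : 'rV[R]_d.+1 -> R) D t : C1c f D ->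
  C1c (fun x => f (rV_cons (t, x))) (fun i x => D (lift ord0 i) (rV_cons (t, x))).
Proof.
move=> [/C1f_slice_l cf [N [sf sD]]]; split => //.
by exists N; split=> [|i]; exact: supp_in_slice_l.
Qed.

Lemma supp_in_slice_r d (f : 'rV[R]_d.+1 -> R) N x t : supp_in N f ->
  N < `|t| -> f (rV_cons (t, x)) = 0.
Proof.
move=> sf Nx; apply: sf; have [N0|N0] := ltP N 0; first exact: lt_le_trans N0 _.
by rewrite ltNge rV_cons_norm_leP// negb_and -!ltNge Nx.
Qed.

End partial_derivatives.

(** * Calculus on the line *)

Section one_dim.
Context {R : realType}.
Local Notation mu := (@lebesgue_measure R).
Variables (f f' : R -> R).
Hypothesis cf' : continuous f'.
Hypothesis df : forall t : R, is_derive t (1 : R) f (f' t).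

Lemma derivative_continuous : continuous f.
Proof.
move=> t; apply: differentiable_continuous; apply/derivable1_diffP.
by have [] := df t.
Qed.

Lemma Rintegral_FTC a b : a <= b -> \int[mu]_(t in `[a, b]) f' t = f b - f a.
Proof.
rewrite le_eqVlt => /predU1P[->|ab].
  by rewrite set_itv1 Rintegral_set1 subrr.
rewrite /Rintegral (@continuous_FTC2 _ f' f)//.
- exact/continuous_subspaceT.
- split; first by move=> t _; have [] := df t.
  - apply: cvg_at_right_filter; exact: derivative_continuous.
  - apply: cvg_at_left_filter; exact: derivative_continuous.
- by move=> t _; rewrite derive1E; have [] := df t.
Qed.

Lemma continuous_itv_integrable (g : R -> R) (a b : R) : continuous g ->
  mu.-integrable `[a, b] (EFin \o g).
Proof.
move=> cg; apply: continuous_compact_integrable; first exact: segment_compact.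
exact: continuous_subspaceT.
Qed.

Lemma Rintegral_supp (g : R -> R) N M : (forall t, N < `|t| -> g t = 0) -> N <= M ->
  \int[mu]_t g t = \int[mu]_(t in `[- M, M]) g t.
Proof.
move=> sg NM; rewrite [RHS]Rintegral_mkcond; apply: eq_Rintegral => t _.
rewrite patchE; case: ifPn => // /negP; rewrite inE/= in_itv/= -ler_norml => /negP.
by rewrite -ltNge => /(le_lt_trans NM) /sg.
Qed.

Lemma Rintegral_derivative0 N : (forall t, N < `|t| -> f t = 0 /\ f' t = 0) ->
  \int[mu]_t f' t = 0.
Proof.
(* Whatever the sign of [N], the number [|N| + 1] is nonnegative and exceeds it, so [f] vanishes at
   both end points. *)
move=> sf; rewrite (@Rintegral_supp _ N (`|N| + 1)); last 2 first.
- by move=> t /sf[].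
- by rewrite (le_trans (ler_norm N))// lerDl.
rewrite Rintegral_FTC; last by rewrite ge0_cp// addr_ge0.
have N1 : N < `| `|N| + 1|.
  by rewrite (ger0_norm (addr_ge0 _ _))// (le_lt_trans (ler_norm N))// ltrDl.
have N1' : N < `|- (`|N| + 1)| by rewrite normrN.
by have [-> _] := sf _ N1; have [-> _] := sf _ N1'; rewrite subrr.
Qed.

End one_dim.

Lemma Rintegral_subset d (T : measurableType d) (R : realType)
    (mu : {measure set T -> \bar R}) (A B : set T) (g : T -> R) :
  measurable A -> measurable B -> A `<=` B -> mu.-integrable B (EFin \o g) ->
  (forall x, B x -> 0 <= g x) ->
  \int[mu]_(x in A) g x <= \int[mu]_(x in B) g x.
Proof.
move=> mA mB AB ig g0; apply: fine_le.
- by apply: integrable_fin_num => //; exact: integrableS ig.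
- exact: integrable_fin_num.
- apply: ge0_subset_integral => //; first by case/integrableP : ig.
Qed.

Section one_dim_inequalities.
Context {R : realType}.
Local Notation mu := (@lebesgue_measure R).
Variables (f f' : R -> R).
Hypothesis cf' : continuous f'.
Hypothesis df : forall t : R, is_derive t (1 : R) f (f' t).

Let cf : continuous f. Proof. exact: (derivative_continuous df). Qed.

(** Integrate [(f^2)' = 2 f f' <= f^2 + f'^2] from outside the support up to [t]. *)
Lemma sqr_le_Rintegral N : (forall t, N < `|t| -> f t = 0 /\ f' t = 0) ->
  forall t, f t ^+ 2 <= \int[mu]_s (f s ^+ 2 + f' s ^+ 2).
Proof.
move=> sf t; have cg : continuous (fun s => f s ^+ 2 + f' s ^+ 2).
  by move=> s; apply: cvgD; exact: continuous_sqr.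
rewrite (@Rintegral_supp _ _ N (`|N| + 1)); last 2 first.
- by move=> s /sf[-> ->]; rewrite expr0n addr0.
- by rewrite (le_trans (ler_norm N))// lerDl.
have N1 : N < `| `|N| + 1|.
  by rewrite (ger0_norm (addr_ge0 _ _))// (le_lt_trans (ler_norm N))// ltrDl.
have [tN|tN] := leP `|t| (`|N| + 1); last first.
  have Nt : N < `|t| by rewrite (lt_trans N1)// ger0_norm// addr_ge0.
  have [-> _] := sf _ Nt.
  by rewrite expr0n Rintegral_ge0// => s _; rewrite addr_ge0// sqr_ge0.
move: tN; rewrite ler_norml => /andP[tN1 tN2].
have [fN _] : f (- (`|N| + 1)) = 0 /\ f' (- (`|N| + 1)) = 0 by apply: sf; rewrite normrN.
have cff' : continuous (fun s => 2 * f s * f' s).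
  by move=> s; apply: cvgM; [apply: cvgM; [exact: cvg_cst|exact: cf]|exact: cf'].
have dff' (s : R) : is_derive s (1 : R) (fun s => f s ^+ 2) (2 * f s * f' s).
  by apply: is_derive_eq; rewrite /GRing.scale/=; ring.
have <- : \int[mu]_(s in `[- (`|N| + 1), t]) (2 * f s * f' s) = f t ^+ 2.
  by rewrite (Rintegral_FTC cff' dff')// fN expr0n subr0.
apply: (@le_trans _ _ (\int[mu]_(s in `[- (`|N| + 1), t]) (f s ^+ 2 + f' s ^+ 2))).
  apply: le_Rintegral => //; [exact: continuous_itv_integrable..|].
  by move=> s _; have := sqr_ge0 (f s - f' s); nra.
apply: Rintegral_subset => //; first exact: subset_itvl.
  exact: continuous_itv_integrable.
by move=> s _; rewrite addr_ge0// sqr_ge0.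
Qed.

(** Cauchy-Schwarz for the integral of [f'] over [[s, t]], obtained by integrating
    [2 c f' - c^2 <= f'^2]. The value [c = (f t - f s) / (2 r)] is the optimal one for an interval
    of the full length [2 r]. *)
Lemma sqr_increment_le (r s t : R) : 0 < r -> s \in `[- r, r] -> t \in `[- r, r] ->
  (f t - f s) ^+ 2 <= 2 * r * \int[mu]_(u in `[- r, r]) (f' u ^+ 2).
Proof.
move=> r0; wlog st : s t / s <= t.
  move=> H sr tr; have [st|/ltW ts] := leP s t; first exact: H.
  by rewrite -opprB sqrrN; exact: H.
rewrite !in_itv/= => /andP[rs sr] /andP[rt tr].
set D := f t - f s; set G := Rintegral _ _ _; pose c := D / (2 * r).
have cg : continuous (fun u => f' u ^+ 2) by exact: continuous_sqr.
have ch : continuous (fun u => 2 * c * f' u - c ^+ 2).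
  move=> u; apply: cvgB; last exact: cvg_cst.
  by apply: cvgM; [exact: cvg_cst|exact: cf'].
have dh (u : R) : is_derive u (1 : R) (fun u => 2 * c * f u - c ^+ 2 * u) (2 * c * f' u - c ^+ 2).
  by apply: is_derive_eq; rewrite ?scaler0 ?addr0 /GRing.scale/= ?mulr1.
have : 2 * c * D - c ^+ 2 * (t - s) <= G.
  have <- : \int[mu]_(u in `[s, t]) (2 * c * f' u - c ^+ 2) =
      2 * c * D - c ^+ 2 * (t - s).
    by rewrite (Rintegral_FTC ch dh)// /D; ring.
  apply: (@le_trans _ _ (\int[mu]_(u in `[s, t]) (f' u ^+ 2))).
    apply: le_Rintegral => //; [exact: continuous_itv_integrable..|].
    by move=> u _; have := sqr_ge0 (f' u - c); nra.
  apply: Rintegral_subset => //.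
  - by move=> u /=; rewrite !in_itv/= => /andP[? ?]; apply/andP; split; lra.
  - exact: continuous_itv_integrable.
  - by move=> u _; rewrite sqr_ge0.
have DE : D = c * (2 * r) by rewrite /c divfK// mulf_neq0// gt_eqF.
rewrite DE; have := sqr_ge0 c; have := mulr_ge0 (sqr_ge0 c) (_ : 0 <= 2 * r - (t - s)).
move=> /(_ ltac:(lra)); nra.
Qed.

End one_dim_inequalities.

Section mbs_Rintegral.
Context {R : realType} {d : nat}.
Local Notation Ld := (@lebesgue_rV R d).
Implicit Types F G : 'rV[R]_d -> R.

Lemma mbs_RintegralD F G : mbs F -> mbs G ->
  \int[Ld]_x (F x + G x) = \int[Ld]_x F x + \int[Ld]_x G x.
Proof. by move=> bF bG; apply: RintegralD => //; exact: mbs_integrable. Qed.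

Lemma mbs_RintegralB F G : mbs F -> mbs G ->
  \int[Ld]_x (F x - G x) = \int[Ld]_x F x - \int[Ld]_x G x.
Proof. by move=> bF bG; apply: RintegralB => //; exact: mbs_integrable. Qed.

Lemma mbs_RintegralZl F c : mbs F -> \int[Ld]_x (c * F x) = c * \int[Ld]_x F x.
Proof. by move=> bF; apply: RintegralZl => //; exact: mbs_integrable. Qed.

Lemma mbs_Rintegral_sum (I : Type) (s : seq I) (F : I -> 'rV[R]_d -> R) :
  (forall i, mbs (F i)) ->
  \int[Ld]_x (\sum_(i <- s) F i x) = \sum_(i <- s) \int[Ld]_x F i x.
Proof.
move=> bF; elim: s => [|i s IH].
  by under eq_Rintegral do rewrite big_nil; rewrite big_nil Rintegral_cst// mul0r.
under eq_Rintegral do rewrite big_cons.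
by rewrite big_cons -IH mbs_RintegralD//; exact: bdd_supp_sum.
Qed.

Lemma mbs_le_Rintegral F G : mbs F -> mbs G -> (forall x, F x <= G x) ->
  \int[Ld]_x F x <= \int[Ld]_x G x.
Proof. by move=> bF bG FG; apply: le_Rintegral => //; exact: mbs_integrable. Qed.

End mbs_Rintegral.

Section mbs1_Rintegral.
Context {R : realType}.
Local Notation mu := (@lebesgue_measure R).
Implicit Types F G : measurableTypeR R -> R.

Lemma mbs1_RintegralD F G : mbs1 F -> mbs1 G ->
  \int[mu]_x (F x + G x) = \int[mu]_x F x + \int[mu]_x G x.
Proof. by move=> bF bG; apply: RintegralD => //; exact: mbs1_integrable. Qed.

Lemma mbs1_RintegralZl F c : mbs1 F -> \int[mu]_x (c * F x) = c * \int[mu]_x F x.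
Proof. by move=> bF; apply: RintegralZl => //; exact: mbs1_integrable. Qed.

Lemma mbs1_RintegralZr F c : mbs1 F -> \int[mu]_x (F x * c) = \int[mu]_x F x * c.
Proof. by move=> bF; apply: RintegralZr => //; exact: mbs1_integrable. Qed.

Lemma mbs1_Rintegral_sum (I : Type) (s : seq I) (F : I -> R -> R) :
  (forall i, mbs1 (F i)) ->
  \int[mu]_x (\sum_(i <- s) F i x) = \sum_(i <- s) \int[mu]_x F i x.
Proof.
move=> bF; elim: s => [|i s IH].
  by under eq_Rintegral do rewrite big_nil; rewrite big_nil Rintegral_cst// mul0r.
under eq_Rintegral do rewrite big_cons.
by rewrite big_cons -IH mbs1_RintegralD//; exact: bdd_supp_sum.
Qed.

Lemma mbs1_le_Rintegral F G : mbs1 F -> mbs1 G -> (forall x, F x <= G x) ->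
  \int[mu]_x F x <= \int[mu]_x G x.
Proof. by move=> bF bG FG; apply: le_Rintegral => //; exact: mbs1_integrable. Qed.

End mbs1_Rintegral.

(** * The Euclidean inequality and the Poincare inequality on a cube *)

Section slicing_inductions.
Context {R : realType}.
Local Notation mu := (@lebesgue_measure R).
Local Notation L d := (@lebesgue_rV R d).

Lemma Rintegral_rV0 (F : 'rV[R]_0 -> R) : \int[L 0]_x F x = F 0.
Proof.
have mF : measurable_fun [set: 'rV[R]_0] (EFin \o F).
  have -> : EFin \o F = cst (F 0)%:E by apply/funext => x /=; rewrite (thinmx0 x).
  exact: measurable_cst.
rewrite /Rintegral (@eq_measure_integral _ _ _ _ (\d_(0 : 'rV[R]_0))).
  by rewrite integral_dirac// diracT mul1e.
by move=> A mA _.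
Qed.

(** The source of every integration by parts below. The first coordinate is integrated along lines,
    the others by induction on the slices. *)
Lemma Rintegral_partial0 d (f : 'rV[R]_d -> R) D i : C1c f D ->
  \int[L d]_x D i x = 0.
Proof.
elim: d f D i => [|d IH] f D i; first by case: i.
case: (unliftP ord0 i) => [j ->|->] fD.
  rewrite Rintegral_rV_cons_l; last exact: C1c_mbsD fD.
  under eq_Rintegral => t _ do rewrite (IH _ _ j (C1c_slice_l t fD)).
  by rewrite Rintegral_cst// mul0r.
rewrite Rintegral_rV_cons_r; last exact: C1c_mbsD fD.
have [cf [N [sf sD]]] := fD.
under eq_Rintegral => x _.
  have [_ cD df] := C1f_slice_r x cf.
  rewrite (Rintegral_derivative0 cD df (N := N)); first over.
  by move=> t Nt; rewrite (supp_in_slice_r _ sf)// (supp_in_slice_r _ (sD _)).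
by rewrite Rintegral_cst// mul0r.
Qed.

Lemma ln_le_subr1 (x : R) : 0 < x -> ln x <= x - 1.
Proof.
move=> x0; have -> : ln x = ln (1 + (x - 1)) by congr ln; ring.
by apply: le_ln1Dx; lra.
Qed.

Lemma ln_ge_1subV (x : R) : 0 < x -> 1 - x^-1 <= ln x.
Proof.
move=> x0; have := ln_le_subr1 (_ : 0 < x^-1); rewrite invr_gt0 => /(_ x0).
by rewrite lnV ?posrE//; move: (x^-1) => z; lra.
Qed.

Lemma bdd_supp_xlnx dd (T : measurableType dd) (nrm : T -> R) (F : T -> R) :
  (forall x, 0 <= F x) ->
  bdd_supp nrm F -> bdd_supp nrm (fun x => F x * ln (F x)).
Proof.
move=> F0 [mF [K FK]]; split.
  apply: measurable_funM => //.
  by apply: (measurableT_comp (@measurable_ln R)).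
(* Where [F > 0], the two bounds on [ln] give [F - 1 <= F ln F <= F (F - 1)]. *)
exists (Num.max K (K ^+ 2 + 1)) => x; have [Fx sF] := FK x; split; last first.
  by rewrite gt_max => /andP[/sF -> _]; rewrite mul0r.
rewrite le_max; apply/orP; right; have [->|Fn0] := eqVneq (F x) 0.
  by rewrite mul0r normr0 addr_ge0// sqr_ge0.
have Fp : 0 < F x by rewrite lt_neqAle eq_sym Fn0 F0.
move: Fx; rewrite ger0_norm// => Fx.
have h1 := ln_le_subr1 Fp; have h2 := ln_ge_1subV Fp.
have h3 : F x * (F x)^-1 = 1 by rewrite divff// gt_eqF.
move: h2 h3; move: (F x)^-1 => z h2 h3.
rewrite ler_norml; nra.
Qed.

(** Since [ln (1 + B / A) <= B / A]. The energy [B] comes out of the logarithm with coefficient 1,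
    so the constant of [euclidean_lsi] does not grow with the dimension. *)
Lemma xlnx_add_le (A B : R) : 0 <= A -> 0 <= B -> A * ln (A + B) <= A * ln A + B.
Proof.
rewrite le_eqVlt => /predU1P[<-|A0] B0; first by rewrite !mul0r add0r.
have -> : A + B = A * (1 + B / A) by rewrite mulrDr mulr1 mulrC divfK// gt_eqF.
have BA : 0 <= B / A by rewrite divr_ge0// ltW.
rewrite lnM ?posrE//; last by lra.
have h : ln (1 + B / A) <= B / A by apply: le_ln1Dx; lra.
rewrite mulrDr lerD2l (le_trans (ler_wpM2l (ltW A0) h))//.
by rewrite mulrC divfK// gt_eqF.
Qed.

(* The slices [M t = \int g(t, x)^2 dx] are bounded by the total mass of
   [g^2 + |D_0 g|^2], which turns [\int M ln M] into [A ln (A + B)]. *)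
Lemma euclidean_lsi d (g : 'rV[R]_d -> R) D : C1c g D ->
  \int[L d]_x (g x ^+ 2 * ln (g x ^+ 2)) <=
    \sum_i \int[L d]_x (D i x ^+ 2) +
    (\int[L d]_x (g x ^+ 2)) * ln (\int[L d]_x (g x ^+ 2)).
Proof.
elim: d g D => [|d IH] g D gD.
  by rewrite big_ord0 add0r !Rintegral_rV0.
have bg2 : mbs (fun x => g x ^+ 2) by apply: bdd_suppX; exact: C1c_mbs gD.
have bD2 i : mbs (fun x => D i x ^+ 2) by apply: bdd_suppX; exact: C1c_mbsD gD.
have bgl : mbs (fun x => g x ^+ 2 * ln (g x ^+ 2)).
  by apply: bdd_supp_xlnx => // x; exact: sqr_ge0.
pose M t := \int[L d]_x (g (rV_cons (t, x)) ^+ 2).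
set A := \int[L d.+1]_x (g x ^+ 2); pose B := \int[L d.+1]_x (D ord0 x ^+ 2).
have bM : mbs1 M by exact: (mbs1_integral_slice bg2).
have M0 t : 0 <= M t by apply: Rintegral_ge0 => x _; exact: sqr_ge0.
have AM : A = \int[mu]_t M t by exact: Rintegral_rV_cons_l.
have A0 : 0 <= A by apply: Rintegral_ge0 => x _; exact: sqr_ge0.
have B0 : 0 <= B by apply: Rintegral_ge0 => x _; exact: sqr_ge0.
(* [sqr_le_Rintegral] on each line parallel to the first axis, integrated over the remaining
   coordinates. *)
have MAB t : M t <= A + B.
  have bgD : mbs (fun x => g x ^+ 2 + D ord0 x ^+ 2).
    exact: (bdd_suppD bg2 (bD2 ord0)).
  have -> : A + B = \int[L d.+1]_x (g x ^+ 2 + D ord0 x ^+ 2).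
    by rewrite mbs_RintegralD//; exact: bD2.
  rewrite Rintegral_rV_cons_r//.
  apply: mbs_le_Rintegral; first exact: (mbs_slice_l bg2).
    exact: (mbs_integral_slice bgD).
  move=> x; have [N [sf sD]] := gD.2.
  have [_ cD df] := C1f_slice_r x gD.1.
  apply: (sqr_le_Rintegral cD df (N := N)) => s Ns.
  by rewrite (supp_in_slice_r _ sf)// (supp_in_slice_r _ (sD _)).
pose S t := \sum_i \int[L d]_x (D (lift ord0 i) (rV_cons (t, x)) ^+ 2).
have bS : mbs1 S by apply: bdd_supp_sum => i; exact: (mbs1_integral_slice (bD2 _)).
have bMl : mbs1 (fun t => M t * ln (A + B)).
  by apply: bdd_suppMr => //; exact: loc_bounded_cst.
rewrite Rintegral_rV_cons_l//.
apply: (@le_trans _ _ (\int[mu]_t (S t + M t * ln (A + B)))).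
  apply: mbs1_le_Rintegral; first exact: (mbs1_integral_slice bgl).
    exact: bdd_suppD.
  move=> t; apply: (le_trans (IH _ _ (C1c_slice_l t gD))).
  rewrite lerD2l; change (M t * ln (M t) <= M t * ln (A + B)).
  have [->|Mn] := eqVneq (M t) 0; first by rewrite !mul0r.
  have Mt : 0 < M t by rewrite lt_neqAle eq_sym Mn M0.
  by rewrite ler_wpM2l ?M0// ler_ln ?posrE//; exact: lt_le_trans (MAB t).
rewrite mbs1_RintegralD// mbs1_RintegralZr// -AM.
rewrite big_ord_recl -/B.
have -> : \int[mu]_t S t =
    \sum_(i < d) \int[L d.+1]_x (D (lift ord0 i) x ^+ 2).
  rewrite mbs1_Rintegral_sum; last by move=> i; exact: (mbs1_integral_slice (bD2 _)).
  by apply: eq_bigr => i _; rewrite (Rintegral_rV_cons_l (bD2 _)).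
have := xlnx_add_le A0 B0; move: (\sum_(i < d) _) => s; lra.
Qed.

End slicing_inductions.

Section cauchy_schwarz.
Context {R : realType}.

(** The left-hand side is largest at [c = I / W]. *)
Lemma discriminant_le (I W G : R) : 0 <= W ->
  (forall c, 2 * c * I - c ^+ 2 * W <= G) -> I ^+ 2 <= W * G.
Proof.
rewrite le_eqVlt => /predU1P[<- H|W0 H].
  rewrite mul0r; have [->|I0] := eqVneq I 0; first by rewrite expr0n.
  (* With [W = 0] and [I] nonzero the left-hand side is unbounded in [c]; this value makes it
     [G + 1]. *)
  have := H ((G + 1) / (2 * I)); rewrite mulr0 subr0.
  have -> : 2 * ((G + 1) / (2 * I)) * I = G + 1 by field.
  lra.
have := H (I / W); have -> : 2 * (I / W) * I - (I / W) ^+ 2 * W = I ^+ 2 / W.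
  by field; rewrite gt_eqF.
by rewrite ler_pdivrMr// mulrC.
Qed.

Lemma Rintegral_cauchy_schwarz dd (T : measurableType dd)
    (m : {measure set T -> \bar R}) (w F : T -> R) : (forall x, 0 <= w x) ->
  m.-integrable setT (EFin \o w) -> m.-integrable setT (EFin \o (fun x => w x * F x)) ->
  m.-integrable setT (EFin \o (fun x => w x * F x ^+ 2)) ->
  (\int[m]_x (w x * F x)) ^+ 2 <= \int[m]_x w x * \int[m]_x (w x * F x ^+ 2).
Proof.
move=> w0 iw iF iF2; apply: discriminant_le; first by apply: Rintegral_ge0.
move=> c; rewrite -!RintegralZl//.
have iZ (G : T -> R) r : m.-integrable setT (EFin \o G) ->
    m.-integrable setT (EFin \o (fun x => r * G x)).
  by move=> iG; have := integrableZl measurableT r iG; apply: eq_integrable.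
rewrite -RintegralB//; [|exact: iZ..].
apply: le_Rintegral => //.
  have := integrableB measurableT (iZ _ (2 * c) iF) (iZ _ (c ^+ 2) iw).
  by apply: eq_integrable.
move=> x _; have := sqr_ge0 (F x - c); have := w0 x; nra.
Qed.

End cauchy_schwarz.

(** * The Poincare inequality on a cube *)

Section cube_poincare.
Context {R : realType}.
Local Notation mu := (@lebesgue_measure R).
Local Notation L d := (@lebesgue_rV R d).
Variable r : R.
Hypothesis r0 : 0 < r.

Definition cube d : 'rV[R]_d -> R := \1_[set x : 'rV[R]_d | `|x| <= r].
Let seg : measurableTypeR R -> R := \1_`[- r, r]%classic.

Lemma cube_ge0 d (x : 'rV[R]_d) : 0 <= cube x.
Proof. by rewrite /cube indicE. Qed.

Lemma mbs_cube d : mbs (@cube d).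
Proof.
split.
  apply: measurable_indic.
  rewrite [X in measurable X](_ : _ = (fun x : 'rV[R]_d => `|x|) @^-1` `]-oo, r]%classic).
    rewrite -[X in measurable X]setTI.
    exact: (measurable_norm_rV measurableT (measurable_itv _)).
  by apply/seteqP; split => x /=; rewrite in_itv/=.
exists (Num.max 1 r) => x; rewrite /cube indicE; split.
  by rewrite le_max; case: (_ \in _); rewrite ?normr0 ?normr1 ?lexx ?ler01.
rewrite gt_max => /andP[_ rx]; rewrite memNset//=.
by apply/negP; rewrite -ltNge.
Qed.

Let bseg : mbs1 seg.
Proof.
split; first by apply: measurable_indic; exact: measurable_itv.
exists (Num.max 1 r) => x; rewrite /seg indicE; split.
  by rewrite le_max; case: (_ \in _); rewrite ?normr0 ?normr1 ?lexx ?ler01.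
rewrite gt_max => /andP[_ rx]; rewrite memNset//=.
by apply/negP; rewrite in_itv/= -ler_norml -ltNge.
Qed.

Let cube_cons d t (x : 'rV[R]_d) : cube (rV_cons (t, x)) = seg t * cube x.
Proof.
rewrite /cube /seg !indicE -natrM mulnb; congr (_ (nat_of_bool _)).
apply/idP/andP; rewrite !inE/= in_itv/= -ler_norml (rV_cons_norm_leP _ _ (ltW r0))//.
  by move=> /andP[].
by move=> [-> ->].
Qed.

Let segE t : seg t = (t \in `[- r, r])%:R.
Proof. by rewrite /seg indicE mem_setE. Qed.

Let int_seg : \int[mu]_t seg t = 2 * r.
Proof.
pose J : set (measurableTypeR R) := `[- r, r]%classic.
have mJ : measurable J by exact: measurable_itv.
have muJ : lebesgue_measure J = (2 * r)%:E.
  have rr : - r < r by move: r0; lra.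
  rewrite /J lebesgue_measure_itv/= lte_fin rr.
  by rewrite -EFinB; congr (_%:E); ring.
by rewrite /Rintegral /seg -/J integral_indic// setIT [X in fine X]muJ.
Qed.

Let slice_cube d (F : 'rV[R]_d -> R) t : mlb F ->
  \int[L d]_x (F x * cube (rV_cons (t, x))) = seg t * \int[L d]_x (F x * cube x).
Proof.
move=> lF; rewrite -mbs_RintegralZl; last exact: bdd_suppMl (mbs_cube _).
by apply: eq_Rintegral => x _; rewrite cube_cons mulrCA.
Qed.

(** The squared integral of [h] stands on the right instead of a centring of [h] on the left, so the
    induction hypothesis applies to each slice as it is. It leaves the slice integrals [H t], a
    function of one variable, whose square integral [J] is bounded by its oscillation and its own
    integral [I]. *)
Lemma cube_poincare d : exists2 C : R, 0 <= C & forall (h : 'rV[R]_d -> R) D,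
  C1f h D ->
  \int[L d]_x (h x ^+ 2 * cube x) <=
  C * (\sum_i \int[L d]_x (D i x ^+ 2 * cube x) + (\int[L d]_x (h x * cube x)) ^+ 2).
Proof.
elim: d => [|d [C C0 IH]].
  exists 1 => // h D _; rewrite big_ord0 !Rintegral_rV0 add0r mul1r.
  have -> : cube (0 : 'rV[R]_0) = 1 by rewrite /cube indicE mem_set//= normr0 ltW.
  by rewrite !mulr1.
pose V := \int[L d]_x cube x; have V0 : 0 <= V by apply: Rintegral_ge0 => x _; exact: cube_ge0.
(* The slices cost [C * (s + J)], where [s] is the energy in the other coordinates and
   [J <= 4 r^2 V G + I^2 / r]. *)
exists (C * (1 + r ^- 1 + 4 * r ^+ 2 * V)).
  by rewrite mulr_ge0// !addr_ge0 ?invr_ge0 ?mulr_ge0 ?sqr_ge0// ltW.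
move=> h D hD.
have bF (F : 'rV[R]_d.+1 -> R) : mlb F -> mbs (fun x => F x * cube x).
  by move=> bF; exact: bdd_suppMl (mbs_cube _).
have bh2 : mbs (fun x => h x ^+ 2 * cube x).
  by apply: bF; apply: loc_boundedX; exact: C1f_mlb hD.
have bh : mbs (fun x => h x * cube x) by apply: bF; exact: C1f_mlb hD.
have bD2 i : mbs (fun x => D i x ^+ 2 * cube x).
  by apply: bF; apply: loc_boundedX; exact: C1f_mlbD hD.
pose H t := \int[L d]_x (h (rV_cons (t, x)) * cube x).
pose G := \int[L d.+1]_x (D ord0 x ^+ 2 * cube x).
pose I := \int[L d.+1]_x (h x * cube x).
have G0 : 0 <= G by apply: Rintegral_ge0 => x _; rewrite mulr_ge0 ?sqr_ge0 ?cube_ge0.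
have I_H : I = \int[mu]_t (seg t * H t).
  rewrite /I Rintegral_rV_cons_l//; apply: eq_Rintegral => t _.
  by rewrite (slice_cube t (C1f_mlb (C1f_slice_l t hD))).
have bH : mbs1 (fun t => seg t * H t).
  rewrite (_ : (fun t => _) = fun t => \int[L d]_x (h (rV_cons (t, x)) * cube (rV_cons (t, x)))).
    exact: (mbs1_integral_slice bh).
  by apply/funext => t; rewrite (slice_cube t (C1f_mlb (C1f_slice_l t hD))).
have segH2 t : seg t * H t ^+ 2 = (seg t * H t) ^+ 2.
  by rewrite exprMn; congr (_ * _); rewrite segE; case: (_ \in _); rewrite ?expr0n ?expr1n.
have bH2 : mbs1 (fun t => seg t * H t ^+ 2).
  under eq_fun do rewrite segH2; exact: bdd_suppX.
(* Cauchy-Schwarz on the cube for [h(t, x) - h(s, x)], then [sqr_increment_le] on each line. *)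
have incr t s : t \in `[- r, r] -> s \in `[- r, r] ->
    (H t - H s) ^+ 2 <= V * (2 * r * G).
  move=> tr sr; pose F x := h (rV_cons (t, x)) - h (rV_cons (s, x)).
  have lF : mlb F.
    apply: loc_boundedB; first exact: (C1f_mlb (C1f_slice_l t hD)).
    exact: (C1f_mlb (C1f_slice_l s hD)).
  have bcF : mbs (fun x => cube x * F x) by exact: bdd_suppMr (mbs_cube _).
  have bcF2 : mbs (fun x => cube x * F x ^+ 2).
    by apply: bdd_suppMr (mbs_cube _); exact: loc_boundedX.
  have -> : H t - H s = \int[L d]_x (cube x * F x).
    rewrite -mbs_RintegralB; first by apply: eq_Rintegral => x _; rewrite /F; ring.
      by apply: bdd_suppMl (mbs_cube _); exact: (C1f_mlb (C1f_slice_l t hD)).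
    by apply: bdd_suppMl (mbs_cube _); exact: (C1f_mlb (C1f_slice_l s hD)).
  apply: le_trans (Rintegral_cauchy_schwarz (@cube_ge0 d) _ _ _) _.
  - exact/mbs_integrable/mbs_cube.
  - exact: mbs_integrable.
  - exact: mbs_integrable.
  rewrite ler_wpM2l// /G Rintegral_rV_cons_r// -mbs_RintegralZl;
    last exact: (mbs_integral_slice (bD2 ord0)).
  apply: mbs_le_Rintegral => //.
    by apply: bdd_suppZ; exact: (mbs_integral_slice (bD2 ord0)).
  move=> x; have [ch cD dh] := C1f_slice_r x hD.
  have [cx|cx] : cube x = 0 \/ cube x = 1.
      by rewrite /cube indicE; case: (_ \in _); [right|left].
    rewrite cx mul0r mulr_ge0//; first by rewrite mulr_ge0// ltW.
    by apply: Rintegral_ge0 => u _; rewrite mulr_ge0 ?sqr_ge0 ?cube_ge0.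
  rewrite cx mul1r; apply: le_trans (sqr_increment_le cD dh r0 sr tr) _.
  rewrite Rintegral_mkcond le_eqVlt; apply/orP; left; apply/eqP; congr (_ * _).
  apply: eq_Rintegral => u _; rewrite cube_cons cx mulr1 patchE /seg indicE.
  by case: (_ \in _); rewrite ?mulr0 ?mulr1.
pose J := \int[mu]_t (seg t * H t ^+ 2).
have zr : 0 \in `[- r, r] by rewrite in_itv/=; apply/andP; split; move: r0; lra.
(* [H] is compared with its value at the centre: integrating [H t ^ 2 <= c - H 0 ^ 2 + 2 H 0 H t]
   leaves [2 H 0 I - 2 r H 0 ^ 2], which is at most [I^2 / r] for every value of [H 0]. *)
have JI : J <= 2 * r * (V * (2 * r * G)) + I ^+ 2 * r^-1.
  apply: (@le_trans _ _ (2 * r * (V * (2 * r * G)) + 2 * H 0 * I - 2 * r * H 0 ^+ 2)).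
    set c := V * _; apply: (@le_trans _ _
      (\int[mu]_t ((c - H 0 ^+ 2) * seg t + 2 * H 0 * (seg t * H t)))).
      apply: mbs1_le_Rintegral => //.
        exact: (bdd_suppD (bdd_suppZ _ bseg) (bdd_suppZ _ bH)).
      move=> t; rewrite segE; case: (boolP (t \in _)) => [tr|_].
        by have := incr _ _ zr tr; rewrite -/c/= !mul1r mulr1; lra.
      by rewrite !mul0r !mulr0 addr0.
    rewrite mbs1_RintegralD; [|exact: bdd_suppZ..].
    rewrite !mbs1_RintegralZl// -I_H int_seg le_eqVlt; apply/orP; left; apply/eqP.
    by ring.
  have -> : I = r * (I * r^-1) by rewrite mulrCA divff ?mulr1// gt_eqF.
  rewrite exprMn; set i := I * r^-1.
  have -> : r ^+ 2 * i ^+ 2 * r^-1 = r * i ^+ 2 by field; rewrite gt_eqF.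
  have := mulr_ge0 (ltW r0) (sqr_ge0 (H 0 - i / 2)).
  have := mulr_ge0 (ltW r0) (sqr_ge0 i); lra.
pose S t := \sum_i \int[L d]_x (D (lift ord0 i) (rV_cons (t, x)) ^+ 2 * cube x).
have segS t : seg t * S t = \sum_(i < d)
    \int[L d]_x (D (lift ord0 i) (rV_cons (t, x)) ^+ 2 * cube (rV_cons (t, x))).
  rewrite /S big_distrr; apply: eq_bigr => i _ /=; rewrite slice_cube//.
  by apply: loc_boundedX; exact: (C1f_mlbD _ (C1f_slice_l t hD)).
have bS : mbs1 (fun t => seg t * S t).
  under eq_fun do rewrite segS.
  by apply: bdd_supp_sum => i; exact: (mbs1_integral_slice (bD2 _)).
have intS : \int[mu]_t (seg t * S t) =
    \sum_(i < d) \int[L d.+1]_x (D (lift ord0 i) x ^+ 2 * cube x).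
  under eq_Rintegral do rewrite segS.
  rewrite mbs1_Rintegral_sum; last by move=> i; exact: (mbs1_integral_slice (bD2 _)).
  by apply: eq_bigr => i _; rewrite (Rintegral_rV_cons_l (bD2 _)).
rewrite Rintegral_rV_cons_l//.
apply: (@le_trans _ _ (\int[mu]_t (C * (seg t * S t) + C * (seg t * H t ^+ 2)))).
  apply: mbs1_le_Rintegral; first exact: (mbs1_integral_slice bh2).
    exact: (bdd_suppD (bdd_suppZ _ bS) (bdd_suppZ _ bH2)).
  move=> t; rewrite slice_cube; last by apply: loc_boundedX; exact: (C1f_mlb (C1f_slice_l t hD)).
  rewrite -mulrDr -mulrDr mulrCA ler_wpM2l//.
  exact: (IH _ _ (C1f_slice_l t hD)).
rewrite mbs1_RintegralD; [|exact: bdd_suppZ..].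
rewrite !mbs1_RintegralZl// intS -mulrDr -mulrA ler_wpM2l// big_ord_recl -/G -/I -/J.
set s := \sum_(i < d) _.
have s0 : 0 <= s.
  apply: sumr_ge0 => i _; apply: Rintegral_ge0 => x _.
  by rewrite mulr_ge0 ?sqr_ge0 ?cube_ge0.
have I0 := sqr_ge0 I; have V1 : 0 <= 4 * r ^+ 2 * V.
  by apply: mulr_ge0 => //; apply: mulr_ge0; [exact: ler0n|exact: sqr_ge0].
have ri : 0 <= r^-1 by rewrite invr_ge0 ltW.
have {}JI : J <= 4 * r ^+ 2 * V * G + I ^+ 2 * r^-1.
  by apply: le_trans JI _; rewrite le_eqVlt; apply/orP; left; apply/eqP; ring.
move: V1 JI; set v := 4 * r ^+ 2 * V; set i2 := I ^+ 2 in I0 *; move: (r^-1) ri => y y0 v0 JI.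
have := mulr_ge0 y0 s0; have := mulr_ge0 y0 G0; have := mulr_ge0 v0 s0.
have := mulr_ge0 v0 I0; nra.
Qed.

End cube_poincare.

(** * The defective log-Sobolev inequality *)

Section C1f_closure.
Context {R : realType} {d : nat}.
Implicit Types (f g : 'rV[R]_d -> R) (D E : 'I_d -> 'rV[R]_d -> R).

Lemma C1f_cst (c : R) : C1f (cst c : 'rV[R]_d -> R) (fun _ _ => 0).
Proof. by split=> [|i|i x]; [exact: cst_continuous|exact: cst_continuous|exact: is_derive_cst]. Qed.

Lemma C1fD f g D E : C1f f D -> C1f g E ->
  C1f (fun x => f x + g x) (fun i x => D i x + E i x).
Proof.
move=> [cf cD df] [cg cE dg]; split=> [|i|i x].
- exact: continuous_add.
- exact: continuous_add.
- exact: is_deriveD (df i x) (dg i x).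
Qed.

Lemma C1fM f g D E : C1f f D -> C1f g E ->
  C1f (fun x => f x * g x) (fun i x => D i x * g x + f x * E i x).
Proof.
move=> [cf cD df] [cg cE dg]; split=> [|i|i x].
- exact: continuous_mul.
- by apply: continuous_add; exact: continuous_mul.
- apply: (@is_derive_eq _ _ _ _ _ _ _ _ (is_deriveM (df i x) (dg i x))).
  by rewrite /GRing.scale/= addrC mulrC.
Qed.

Lemma C1f_comp f D (h h' : R -> R) : continuous h' ->
  (forall y : R, is_derive y (1 : R) h (h' y)) ->
  C1f f D -> C1f (fun x => h (f x)) (fun i x => h' (f x) * D i x).
Proof.
move=> ch' dh [cf cD df]; split=> [|i|i x].
- exact: continuous_compr cf (derivative_continuous dh).
- apply: continuous_mul; last exact: cD.
  exact: continuous_compr cf ch'.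
- exact: (is_derive_compl (dh (f x)) (df i x)).
Qed.

Lemma C1f_coord j : C1f (fun x : 'rV[R]_d => x ord0 j) (fun i _ => (i == j)%:R).
Proof.
split=> [|i|i x].
- exact: coord_continuous.
- exact: cst_continuous.
- apply/is_derive_lineP.
  have -> : (fun h : R => (h *: delta_mx ord0 i + x) ord0 j) =
      fun h => h * (i == j)%:R + x ord0 j.
    by apply/funext => h; rewrite !mxE eqxx/= eq_sym.
  by apply: is_derive_eq; rewrite /GRing.scale/=; ring.
Qed.

Lemma C1f_eq f g D E : f =1 g -> (forall i, D i =1 E i) -> C1f f D -> C1f g E.
Proof.
move=> fg DE; have -> : g = f by apply/funext => x; rewrite fg.
have -> // : E = D by apply/funext => i; apply/funext => x; rewrite DE.
Qed.

Lemma C1cM f g D E : C1c f D -> C1f g E ->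
  C1c (fun x => f x * g x) (fun i x => D i x * g x + f x * E i x).
Proof.
move=> [cf [N [sf sD]]] cg; split; first exact: C1fM.
exists N; split=> [x xN|i x xN]; first by rewrite sf// mul0r.
by rewrite sf// sD// !mul0r addr0.
Qed.

Lemma C1c_comp f D (h h' : R -> R) : continuous h' ->
  (forall y : R, is_derive y (1 : R) h (h' y)) -> h 0 = 0 ->
  C1c f D -> C1c (fun x => h (f x)) (fun i x => h' (f x) * D i x).
Proof.
move=> ch' dh h0 [cf [N [sf sD]]]; split; first exact: C1f_comp.
exists N; split=> [x xN|i x xN]; first by rewrite sf.
by rewrite sD// mulr0.
Qed.

End C1f_closure.

Section weighted.
Context {R : realType} {d : nat}.
Local Notation Ld := (@lebesgue_rV R d).
Variables (U : 'rV[R]_d -> R) (V : 'I_d -> 'rV[R]_d -> R).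
Hypothesis UV : C1f U V.
Local Notation p := (fun x => expR (- U x)).
Implicit Types (f : 'rV[R]_d -> R) (D : 'I_d -> 'rV[R]_d -> R).

Definition sqn (x : 'rV[R]_d) : R := \sum_i x ord0 i ^+ 2.

Lemma sqn_ge0 x : 0 <= sqn x.
Proof. by apply: sumr_ge0 => i _; exact: sqr_ge0. Qed.

Lemma mlb_sqn : mlb sqn.
Proof.
apply: loc_bounded_sum => i; apply: loc_boundedX.
exact: (C1f_mlb (C1f_coord i)).
Qed.

Lemma C1f_exp (c : R) :
  C1f (fun x => expR (c * U x)) (fun i x => c * expR (c * U x) * V i x).
Proof.
have de (y : R) : is_derive y (1 : R) (fun y => expR (c * y)) (c * expR (c * y)).
  by apply: is_derive_eq; rewrite /GRing.scale/= mulr1 mulrC.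
apply: (C1f_comp _ de UV); apply: continuous_mul; first exact: cst_continuous.
apply: continuous_compr; last exact: continuous_expR.
by apply: continuous_mul; [exact: cst_continuous|move=> x; exact: cvg_id].
Qed.

Lemma C1f_density : C1f p (fun i x => - p x * V i x).
Proof. by apply: C1f_eq (C1f_exp (-1)) => [x|i x]; rewrite /= !mulN1r. Qed.

Lemma mlb_density : mlb p.
Proof. exact: (C1f_mlb C1f_density). Qed.

Lemma mbsw f : mbs f -> mbs (fun x => f x * p x).
Proof. by move=> bf; exact: bdd_suppMr mlb_density bf. Qed.

Definition energy D := \sum_i \int[Ld]_x (D i x ^+ 2 * p x).

Lemma energy_ge0 D : 0 <= energy D.
Proof.
apply: sumr_ge0 => i _; apply: Rintegral_ge0 => x _.
by rewrite mulr_ge0 ?sqr_ge0 ?expR_ge0.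
Qed.

Section lyapunov.
Variables a b : R.
Hypothesis a0 : 0 < a.
Hypothesis diss : forall x, a * sqn x - b <= \sum_i x ord0 i * V i x.

(* From [\int div (x f^2 exp (- U)) = 0]. *)
Lemma lyapunov_le f D : C1c f D ->
  \int[Ld]_x (sqn x * f x ^+ 2 * p x) <=
  2 / a * (d%:R + b) * \int[Ld]_x (f x ^+ 2 * p x) + 4 / a ^+ 2 * energy D.
Proof.
move=> fD; have bf := C1c_mbs fD; have bD i := C1c_mbsD i fD.
have bA : mbs (fun x => f x ^+ 2 * p x) by apply: mbsw; exact: bdd_suppX.
have bE i : mbs (fun x => D i x ^+ 2 * p x).
  by apply: mbsw; apply: bdd_suppX; exact: bD.
have bSE : mbs (fun x => \sum_i D i x ^+ 2 * p x) by exact: bdd_supp_sum.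
have bX : mbs (fun x => sqn x * f x ^+ 2 * p x).
  by apply: mbsw; apply: bdd_suppMl mlb_sqn _; exact: bdd_suppX.
have fDi i := C1cM (C1cM (C1cM fD fD.1) C1f_density) (C1f_coord i).
set A := \int[Ld]_x (f x ^+ 2 * p x); set X := \int[Ld]_x _.
(* Dissipation contributes [- a X], and half of it absorbs the cross term. Multiplying by [2 / a]
   gives the claim. *)
have : 0 <= (d%:R + b) * A + 2 / a * energy D - a / 2 * X.
  pose G i x := ((D i x * f x + f x * D i x) * p x + f x * f x * (- p x * V i x)) *
    x ord0 i + f x * f x * p x * (i == i)%:R.
  have bG i : mbs (G i) := C1c_mbsD i (fDi i).
  have : \int[Ld]_x (\sum_i G i x) = 0.
    rewrite mbs_Rintegral_sum//; apply: big1 => i _.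
    exact: (Rintegral_partial0 i (fDi i)).
  move=> <-.
  rewrite /energy -mbs_Rintegral_sum// -!mbs_RintegralZl//.
  rewrite -mbs_RintegralD; [|exact: bdd_suppZ..].
  rewrite -mbs_RintegralB; [|by apply: bdd_suppD; exact: bdd_suppZ|exact: bdd_suppZ].
  apply: mbs_le_Rintegral; first exact: bdd_supp_sum.
    by apply: bdd_suppB; [apply: bdd_suppD; exact: bdd_suppZ|exact: bdd_suppZ].
  move=> x; have px : 0 <= p x by exact: expR_ge0.
  (* The divergence of [x f^2 exp (- U)]. *)
  have -> : \sum_i G i x = (d%:R * f x ^+ 2 + \sum_i 2 * f x * D i x * x ord0 i
       - f x ^+ 2 * \sum_i x ord0 i * V i x) * p x.
    rewrite !mulr_sumr mulr_natl -[in X in _ *+ X](card_ord d) -sumr_const.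
    rewrite -big_split -sumrB mulr_suml/=.
    by apply: eq_bigr => i _; rewrite /G eqxx /=; ring.
  rewrite -mulr_suml !mulrA -!mulrDl -mulrBl ler_wpM2r//.
  (* Young's inequality, weighted so that [|x|^2 f^2] gets the coefficient [a / 2]. *)
  have h1 : \sum_i 2 * f x * D i x * x ord0 i <=
      a / 2 * (sqn x * f x ^+ 2) + 2 / a * \sum_i D i x ^+ 2.
    rewrite /sqn mulr_suml !mulr_sumr -big_split/=; apply: ler_sum => i _.
    rewrite -subr_ge0.
    have -> : a / 2 * (x ord0 i ^+ 2 * f x ^+ 2) + 2 / a * D i x ^+ 2 -
        2 * f x * D i x * x ord0 i = (2 * a)^-1 * (a * f x * x ord0 i - 2 * D i x) ^+ 2.
      by field; rewrite gt_eqF.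
    by apply: mulr_ge0; [rewrite invr_ge0 mulr_ge0// ltW|exact: sqr_ge0].
  have h2 := ler_wpM2l (sqr_ge0 (f x)) (diss x).
  move: h1 h2; move: (\sum_i 2 * _ * _ * _) (\sum_i x ord0 i * V i x) (\sum_i _ ^+ 2) => s1 s2 s3.
  move: (2 / a) => z; nra.
have -> : 4 / a ^+ 2 = 2 / a * (2 / a) by field; rewrite gt_eqF.
have a2 : 0 <= 2 / a by rewrite divr_ge0// ltW.
move=> h; have := mulr_ge0 a2 h.
have -> : 2 / a * ((d%:R + b) * A + 2 / a * energy D - a / 2 * X) =
   2 / a * (d%:R + b) * A + 2 / a * (2 / a) * energy D - X by field; rewrite gt_eqF.
by rewrite subr_ge0.
Qed.

End lyapunov.

Section defective.
Variables a b K : R.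
Hypothesis a0 : 0 < a.
Hypothesis diss : forall x, a * sqn x - b <= \sum_i x ord0 i * V i x.
Hypothesis K0 : 0 <= K.
Hypothesis U_le : forall x, U x <= K * (1 + sqn x).
Hypothesis V_le : forall x, \sum_i V i x ^+ 2 <= K * (1 + sqn x).

Lemma defective_lsi f D : C1c f D ->
  \int[Ld]_x (f x ^+ 2 * ln (f x ^+ 2) * p x) <=
  (2 + 3 / 2 * K * (4 / a ^+ 2)) * energy D +
  3 / 2 * K * (1 + 2 / a * (d%:R + b)) * \int[Ld]_x (f x ^+ 2 * p x) +
  \int[Ld]_x (f x ^+ 2 * p x) * ln (\int[Ld]_x (f x ^+ 2 * p x)).
Proof.
move=> fD; have bf := C1c_mbs fD; have bD i := C1c_mbsD i fD.
have bA : mbs (fun x => f x ^+ 2 * p x) by apply: mbsw; exact: bdd_suppX.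
have bX : mbs (fun x => sqn x * f x ^+ 2 * p x).
  by apply: mbsw; apply: bdd_suppMl mlb_sqn _; exact: bdd_suppX.
have bE i : mbs (fun x => D i x ^+ 2 * p x).
  by apply: mbsw; apply: bdd_suppX; exact: bD.
have bVf i : mbs (fun x => V i x ^+ 2 * f x ^+ 2 * p x).
  apply: mbsw; apply: bdd_suppMl; last exact: bdd_suppX.
  by apply: loc_boundedX; exact: (C1f_mlbD _ UV).
have lU : mlb U := C1f_mlb UV.
have bU : mbs (fun x => U x * f x ^+ 2 * p x).
  by apply: mbsw; apply: bdd_suppMl lU _; exact: bdd_suppX.
have gD := C1cM fD (C1f_exp (- 2^-1)).
pose q x := expR (- 2^-1 * U x).
have q2 x : q x ^+ 2 = p x by rewrite -expRM_natl; congr expR; field.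
have := euclidean_lsi gD; have := lyapunov_le a0 diss fD.
rewrite [X in _ -> _ <= _ + X * ln X -> _](_ : _ = \int[Ld]_x (f x ^+ 2 * p x)); last first.
  by apply: eq_Rintegral => x _; rewrite exprMn q2.
set A := \int[Ld]_x (f x ^+ 2 * p x); set X := \int[Ld]_x (sqn x * _ * _) => hX.
set g2 := (X in X <= _); set sD := (X in _ <= X + _) => hg.
have bg := bdd_supp_xlnx (fun x => sqr_ge0 _) (bdd_suppX 1 (C1c_mbs gD)).
(* For [g = f exp (- U / 2)] one has [ln (g^2) = ln (f^2) - U] where [f] is nonzero. *)
have -> : \int[Ld]_x (f x ^+ 2 * ln (f x ^+ 2) * p x) =
    g2 + \int[Ld]_x (U x * f x ^+ 2 * p x).
  rewrite /g2 -mbs_RintegralD//; apply: eq_Rintegral => x _.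
  rewrite exprMn q2; have [->|fx] := eqVneq (f x) 0.
    by rewrite expr0n/= !(mul0r, mulr0) addr0.
  rewrite /= (@lnM _ (f x ^+ 2) (expR (- U x))) ?posrE ?expR_gt0// ?exprn_even_gt0// expRK; ring.
(* The partial derivatives of [g] are [(D i - f V i / 2) q]; expand by
   [(u - v)^2 <= 2 u^2 + 2 v^2]. *)
have hD : sD <= 2 * energy D + 2^-1 * \sum_i \int[Ld]_x (V i x ^+ 2 * f x ^+ 2 * p x).
  rewrite /energy !mulr_sumr -big_split/=; apply: ler_sum => i _.
  rewrite -!mbs_RintegralZl// -mbs_RintegralD;
    [|exact: (bdd_suppZ _ (bE i))|exact: (bdd_suppZ _ (bVf i))].
  apply: mbs_le_Rintegral; first by apply: bdd_suppX; exact: (C1c_mbsD i gD).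
    exact: (bdd_suppD (bdd_suppZ _ (bE i)) (bdd_suppZ _ (bVf i))).
  move=> x; rewrite -[expR (- 2^-1 * U x)]/(q x) -q2.
  have := sqr_ge0 ((D i x + f x * (2^-1 * V i x)) * q x); nra.
(* The factor [3 / 2] is [1] from the bound on [U] plus [1 / 2] from the bound on its gradient. *)
have hUV : \int[Ld]_x (U x * f x ^+ 2 * p x) +
    2^-1 * \sum_i \int[Ld]_x (V i x ^+ 2 * f x ^+ 2 * p x) <= 3 / 2 * K * (A + X).
  rewrite -mbs_Rintegral_sum// -mbs_RintegralZl; last exact: bdd_supp_sum.
  rewrite -mbs_RintegralD//; last by apply: bdd_suppZ; exact: bdd_supp_sum.
  rewrite -mbs_RintegralD// -mbs_RintegralZl; last exact: bdd_suppD.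
  apply: mbs_le_Rintegral.
  - by apply: bdd_suppD => //; apply: bdd_suppZ; exact: bdd_supp_sum.
  - by apply: bdd_suppZ; exact: bdd_suppD.
  move=> x; rewrite -!mulr_suml !mulrA.
  have h1 := U_le x; have h2 := V_le x.
  have := mulr_ge0 (sqr_ge0 (f x)) (expR_ge0 (- U x)).
  move: (expR _) (\sum_i _) h2 => y s h2 fy; nra.
have : 3 / 2 * K * X <= 3 / 2 * K * (2 / a * (d%:R + b) * A + 4 / a ^+ 2 * energy D).
  by rewrite ler_wpM2l// mulr_ge0.
lra.
Qed.

End defective.
End weighted.

(** * The Poincare inequality of a dissipative density *)

Section cutoff.
Context {R : realType}.

(** A criterion that treats [sqr_pos] uniformly in [y], including the point 0 where its formula
    changes. *)
Lemma is_derive_quadratic (f : R -> R) (y l : R) :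
  (forall h, `|f (h + y) - f y - h * l| <= h ^+ 2) -> is_derive y (1 : R) f l.
Proof.
move=> H.
have : h^-1 *: ((f \o shift y) (h *: (1 : R)) - f y) @[h --> 0^'] --> l.
  apply/cvgrPdist_le => e e0; near=> h.
  have h0 : h != 0 by near: h; exact: nbhs_dnbhs_neq.
  have he : `|h| <= e.
    by near: h; apply: dnbhs0_le.
  rewrite /= [h *: (1 : R)]mulr1.
  have -> : l - h^-1 *: (f (h + y) - f y) = - (h^-1 * (f (h + y) - f y - h * l)).
    by rewrite /GRing.scale/=; field.
  rewrite normrN normrM (le_trans (ler_wpM2l _ (H h)))//.
  by rewrite -[h ^+ 2]real_normK ?num_real// expr2 mulrA normfV mulVf ?mul1r ?normr_eq0.
move=> cv; split; first by apply/cvg_ex; exists l.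
exact: cvg_lim.
Unshelve. all: by end_near. Qed.

(** A C^1 function that vanishes on a half-line. Since [C1c] asks for one continuous derivative
    only, composing it with [1 - e^2 |x|^2] gives a cutoff. *)
Definition sqr_pos (y : R) : R := Num.max 0 y ^+ 2.

Lemma is_derive_sqr_pos (y : R) : is_derive y (1 : R) sqr_pos (2 * Num.max 0 y).
Proof.
apply: is_derive_quadratic => h; rewrite /sqr_pos ler_norml.
have [y0|y0] := leP 0 y; have [hy0|hy0] := leP 0 (h + y); apply/andP; split; nra.
Qed.

Lemma continuous_maxr0 : continuous (fun y : R => 2 * Num.max 0 y).
Proof.
apply: continuous_mul; first exact: cst_continuous.
by move=> y; apply: continuous_max; [exact: cvg_cst|exact: cvg_id].
Qed.

Variable d : nat.

Definition cutoff (e : R) (x : 'rV[R]_d) : R := sqr_pos (1 - e ^+ 2 * sqn x).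

Definition dcutoff (e : R) (i : 'I_d) (x : 'rV[R]_d) : R :=
  2 * Num.max 0 (1 - e ^+ 2 * sqn x) * (- e ^+ 2 * (2 * x ord0 i)).

Lemma C1f_sum (I : Type) (s : seq I) (f : I -> 'rV[R]_d -> R) D :
  (forall i, C1f (f i) (D i)) ->
  C1f (fun x => \sum_(i <- s) f i x) (fun j x => \sum_(i <- s) D i j x).
Proof.
move=> fD; elim: s => [|i s IH].
  by apply: C1f_eq (C1f_cst 0) => [x|i x]; rewrite big_nil.
by apply: C1f_eq (C1fD (fD i) IH) => [x|j x]; rewrite big_cons.
Qed.

Lemma C1f_sqn : C1f (@sqn R d) (fun i x => 2 * x ord0 i).
Proof.
apply: C1f_eq (C1f_sum (index_enum 'I_d) (fun j => C1fM (C1f_coord j) (C1f_coord j))) => [x|i x]/=.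
  by apply: eq_bigr => j _; rewrite expr2.
rewrite (bigD1 i)//= big1 ?addr0; first by rewrite eqxx mul1r mulr1; ring.
by move=> j ji; rewrite eq_sym (negbTE ji) mul0r mulr0 addr0.
Qed.

Lemma sqn_gt (x : 'rV[R]_d) N : 0 <= N -> N < `|x| -> N ^+ 2 < sqn x.
Proof.
move=> N0 xN; have [i xi] : exists i, N < `|x ord0 i|.
  apply/not_existsP => H; move: xN; rewrite ltNge => /negP; apply.
  by apply/rV_norm_leP => // i; rewrite leNgt; apply/negP => /H.
rewrite /sqn (bigD1 i)//=; apply: (@lt_le_trans _ _ (x ord0 i ^+ 2)).
  by rewrite -[x ord0 i ^+ 2]real_normK ?num_real// ltr_pXn2r// nnegrE.
by rewrite lerDl sumr_ge0// => j _; exact: sqr_ge0.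
Qed.

Lemma C1c_cutoff e : 0 < e -> C1c (cutoff e) (dcutoff e).
Proof.
move=> e0; split.
  have := C1fD (C1f_cst 1) (C1fM (C1f_cst (- e ^+ 2)) C1f_sqn).
  move=> /(C1f_comp continuous_maxr0 is_derive_sqr_pos); apply: C1f_eq => [x|i x].
    by rewrite /cutoff /=; congr sqr_pos; ring.
  by rewrite /dcutoff /=; congr (2 * Num.max 0 _ * _); ring.
exists e^-1; have E (x : 'rV[R]_d) : e^-1 < `|x| -> Num.max 0 (1 - e ^+ 2 * sqn x) = 0.
  have ei : 0 < e^-1 by rewrite invr_gt0.
  move=> xe; have h := ltW (sqn_gt (ltW ei) xe); apply/max_idPl; rewrite subr_le0.
  by rewrite -ler_pdivrMl ?exprn_gt0// mulr1 -exprVn.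
split=> [x xe|i x xe]; first by rewrite /cutoff /sqr_pos E// expr0n.
by rewrite /dcutoff E// mulr0 mul0r.
Qed.

Lemma cutoff_ge0 e x : 0 <= cutoff e x.
Proof. exact: sqr_ge0. Qed.

Lemma max_cutoff_le1 e (x : 'rV[R]_d) : Num.max 0 (1 - e ^+ 2 * sqn x) <= 1.
Proof. by rewrite ge_max ler01/= gerBl mulr_ge0 ?sqr_ge0 ?sqn_ge0. Qed.

Lemma cutoff_le1 e x : cutoff e x <= 1.
Proof. by rewrite expr_le1 ?max_cutoff_le1// le_max lexx. Qed.

(** The sum is [16 M^2 e^2 (e^2 |x|^2)], and [e^2 |x|^2 <= 1] wherever [M] is nonzero. The bound is
    uniform in [e], so it survives the limit [e -> 0]. *)
Lemma dcutoff_le e x : 0 < e <= 1 -> \sum_i dcutoff e i x ^+ 2 <= 16.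
Proof.
move=> /andP[e0 e1]; rewrite /dcutoff; set M := Num.max _ _.
have -> : \sum_(i < d) (2 * M * (- e ^+ 2 * (2 * x ord0 i))) ^+ 2 =
    16 * (M ^+ 2 * (e ^+ 2 * (e ^+ 2 * sqn x))).
  by rewrite /sqn !mulr_sumr; apply: eq_bigr => i _; ring.
have M1 : M <= 1 by exact: max_cutoff_le1.
have M0 : 0 <= M by rewrite le_max lexx.
have e2 : e ^+ 2 <= 1 by rewrite expr_le1// ltW.
have s0 : 0 <= e ^+ 2 * sqn x by rewrite mulr_ge0 ?sqr_ge0 ?sqn_ge0.
rewrite -[leRHS]mulr1 ler_wpM2l//.
have [ME|ME] : M = 0 \/ e ^+ 2 * sqn x <= 1.
    by rewrite /M; case: (leP 0 (1 - e ^+ 2 * sqn x)) => h; [right; rewrite -subr_ge0|left].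
  by rewrite ME expr0n mul0r.
have h1 : e ^+ 2 * (e ^+ 2 * sqn x) <= 1 by rewrite mulr_ile1 ?sqr_ge0.
have h2 : 0 <= e ^+ 2 * (e ^+ 2 * sqn x) by apply: mulr_ge0 => //; exact: sqr_ge0.
have h3 : M ^+ 2 <= 1 by rewrite expr_le1.
by rewrite mulr_ile1 ?sqr_ge0.
Qed.

Lemma cutoff_nd (x : 'rV[R]_d) e e' : 0 <= e -> e <= e' -> cutoff e' x <= cutoff e x.
Proof.
move=> e0 ee; have m0 (y : R) : 0 <= Num.max 0 y by rewrite le_max lexx.
rewrite /cutoff /sqr_pos ler_sqr ?nnegrE//.
rewrite ge_max m0 le_max; apply/orP; right.
by rewrite lerD2l lerN2 ler_wpM2r ?sqn_ge0// ler_sqr ?nnegrE// (le_trans e0).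
Qed.

Lemma cvg_cutoff (x : 'rV[R]_d) : cutoff (harmonic n) x @[n --> \oo] --> (1 : R).
Proof.
have -> : 1 = sqr_pos (1 - 0 * 0 * sqn x) :> R.
  by rewrite /sqr_pos !mul0r subr0 max_r ?ler01// expr1n.
apply: continuous_cvg; first exact: (derivative_continuous is_derive_sqr_pos).
apply: cvgB; first exact: cvg_cst.
apply: cvgM; last exact: cvg_cst.
by under eq_fun do rewrite expr2; apply: cvgM; exact: cvg_harmonic.
Qed.

(** The cutoffs increase to 1 along [e = 1 / (n + 1)], so monotone convergence applies and
    integrability of [F] can be a conclusion. *)
Lemma integral_cutoff_le (F : 'rV[R]_d -> R) (B : \bar R) :
  measurable_fun setT F -> (forall x, 0 <= F x) ->
  (forall e, 0 < e <= 1 ->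
    (\int[@lebesgue_rV R d]_x (cutoff e x ^+ 2 * F x)%:E <= B)%E) ->
  (\int[@lebesgue_rV R d]_x (F x)%:E <= B)%E.
Proof.
move=> mF F0 H.
have e01 n : 0 < (harmonic n : R) <= 1.
  by rewrite /harmonic invr_gt0 ltr0n/= invf_le1 ?ltr0n// ler1n.
have nd m n x : (m <= n)%N ->
    ((cutoff (harmonic m) x ^+ 2 * F x)%:E <= (cutoff (harmonic n) x ^+ 2 * F x)%:E)%E.
  move=> mn; rewrite lee_fin ler_wpM2r// ler_sqr ?nnegrE ?cutoff_ge0//.
  apply: cutoff_nd; first by rewrite /harmonic invr_ge0.
  by rewrite /harmonic lef_pV2 ?posrE// ler_nat.
have mg n : measurable_fun setT (fun x : 'rV[R]_d => (cutoff (harmonic n) x ^+ 2 * F x)%:E).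
  apply/measurable_EFinP; apply: measurable_funM => //; apply: measurable_funX.
  by have /andP[/C1c_cutoff/C1c_mbs[]] := e01 n.
have -> : (\int[@lebesgue_rV R d]_x (F x)%:E =
    \int[@lebesgue_rV R d]_x limn (fun n => (cutoff (harmonic n) x ^+ 2 * F x)%:E))%E.
  apply: eq_integral => x _; apply/esym/cvg_lim => //.
  apply: cvg_EFin; first exact: nearW.
  rewrite -[in X in _ --> X](mul1r (F x)); apply: cvgM; last exact: cvg_cst.
  by rewrite -(mulr1 1); under eq_fun do rewrite expr2; apply: cvgM; exact: cvg_cutoff.
rewrite monotone_convergence//.
- apply: lime_le; last by apply: nearW => n; exact: H.
  apply: ereal_nondecreasing_is_cvgn => m n mn; apply: ge0_le_integral => //.
  + by move=> x _; rewrite lee_fin mulr_ge0 ?sqr_ge0.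
  + by move=> x _; exact: nd.
- by move=> n x _; rewrite lee_fin mulr_ge0 ?sqr_ge0.
- by move=> x _ m n mn; exact: nd.
Qed.

End cutoff.

Lemma Rintegral_cube_gt0 (R : realType) d (r : R) : 0 < r ->
  0 < \int[@lebesgue_rV R d]_x cube r x.
Proof.
move=> r0; have mE : measurable [set x : 'rV[R]_d | `|x| <= r].
  rewrite [X in measurable X](_ : _ = (fun x : 'rV[R]_d => `|x|) @^-1` `]-oo, r]%classic).
    rewrite -[X in measurable X]setTI.
    exact: (measurable_norm_rV measurableT (measurable_itv _)).
  by apply/seteqP; split => x /=; rewrite in_itv/=.
rewrite /Rintegral /cube integral_indic// setIT.
rewrite [X in fine X](lebesgue_rV_ballE d (ltW r0))/= prodr_const exprn_gt0//; lra.
Qed.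

Section poincare.
Context {R : realType} {d : nat}.
Local Notation Ld := (@lebesgue_rV R d).
Variables (U : 'rV[R]_d -> R) (V : 'I_d -> 'rV[R]_d -> R).
Hypothesis UV : C1f U V.
Local Notation p := (fun x => expR (- U x)).
Hypothesis ip : Ld.-integrable setT (EFin \o p).
Variables a b : R.
Hypothesis a0 : 0 < a.
Hypothesis b0 : 0 <= b.
Hypothesis diss : forall x, a * sqn x - b <= \sum_i x ord0 i * V i x.
Implicit Types (f : 'rV[R]_d -> R) (D : 'I_d -> 'rV[R]_d -> R).

Lemma mbs_integralE (F : 'rV[R]_d -> R) : mbs F ->
  (\int[Ld]_x (F x)%:E = (\int[Ld]_x F x)%:E)%E.
Proof.
by move=> bF; rewrite fineK//; apply: integrable_fin_num => //; exact: mbs_integrable.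
Qed.

Lemma integrable_sub_sqr f m : mbs f ->
  Ld.-integrable setT (EFin \o (fun x => (f x - m) ^+ 2 * p x)).
Proof.
move=> bf.
have bf2 : mbs (fun x => (f x ^+ 2 - 2 * m * f x) * p x).
  apply: (mbsw UV); apply: bdd_suppB; first exact: bdd_suppX.
  exact: bdd_suppZ.
have := integrableD measurableT (mbs_integrable bf2) (integrableZl measurableT (m ^+ 2) ip).
apply: eq_integrable => // x _; rewrite /= -EFinM -EFinD; congr (_%:E).
by ring.
Qed.

(** [lyapunov_le] for the cutoff itself, whose weighted mass is at most 1 and whose energy is at
    most 16. *)
Lemma second_moment_le : \int[Ld]_x p x = 1 ->
  (\int[Ld]_x (sqn x * p x)%:E <= (2 / a * (d%:R + b) + 4 / a ^+ 2 * 16)%:E)%E.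
Proof.
move=> p1; apply: integral_cutoff_le.
- exact: (measurable_funM (@mlb_sqn R d).1 (mlb_density UV).1).
- by move=> x; rewrite mulr_ge0 ?sqn_ge0 ?expR_ge0.
move=> e e01; have ce := C1c_cutoff d (proj1 (andP e01)).
have bc := C1c_mbs ce; have bX : mbs (fun x => sqn x * cutoff e x ^+ 2 * p x).
  by apply: (mbsw UV); apply: bdd_suppMl (@mlb_sqn R d) _; exact: bdd_suppX.
under eq_integral => x _ do rewrite mulrA [cutoff _ _ ^+ 2 * _]mulrC.
rewrite mbs_integralE// lee_fin; apply: le_trans (lyapunov_le UV a0 diss ce) _.
have h1 : \int[Ld]_x (cutoff e x ^+ 2 * p x) <= 1.
  rewrite -[leRHS]p1; apply: le_Rintegral => //.
    exact: (mbs_integrable (mbsw UV (bdd_suppX 1 bc))).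
  by move=> x _; rewrite ler_piMl ?expR_ge0// expr_le1 ?cutoff_ge0// cutoff_le1.
have h2 : energy U (dcutoff e) <= 16.
  have bE i : mbs (fun x => dcutoff e i x ^+ 2 * p x).
    by apply: (mbsw UV); apply: bdd_suppX; exact: C1c_mbsD ce.
  rewrite /energy -mbs_Rintegral_sum//.
  apply: (@le_trans _ _ (\int[Ld]_x (16 * p x))); last by rewrite RintegralZl// p1 mulr1.
  apply: le_Rintegral => //.
  - by apply: mbs_integrable; exact: bdd_supp_sum.
  - by have := integrableZl measurableT 16 ip; exact: eq_integrable.
  - by move=> x _; rewrite -mulr_suml ler_wpM2r ?expR_ge0//; exact: dcutoff_le.
have k1 : 0 <= 2 / a * (d%:R + b) by rewrite mulr_ge0 ?addr_ge0 ?divr_ge0 ?(ltW a0).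
have k2 : 0 <= 4 / a ^+ 2 by rewrite divr_ge0 ?sqr_ge0.
have := ler_wpM2l k1 h1; have := ler_wpM2l k2 h2; lra.
Qed.

Variable r : R.
Hypothesis r1 : 1 <= r.
Hypothesis r_large : 2 * (2 / a * (d%:R + b) + 4 / a ^+ 2 * 32) <= r.

(** Outside the cube [|x|^2 > r^2 >= r] in the Euclidean norm, so [1 <= cube + |x|^2 / r]
    everywhere. [lyapunov_le] for [cutoff * (f - m)] bounds the second term by [r^-1] times
    [(k1 + 32 k2) H + 2 k2 energy], and [r_large] makes the [H] part at most [H / 2]. It can be
    absorbed because [H] is finite. *)
Lemma exterior_le f D m : C1c f D ->
  \int[Ld]_x ((f x - m) ^+ 2 * p x) <=
  2 * \int[Ld]_x ((f x - m) ^+ 2 * p x * cube r x) + 16 / a ^+ 2 * energy U D.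
Proof.
move=> fD; pose h x := f x - m.
have rl := r_large.
set k1 := 2 / a * (d%:R + b) in rl *; set k2 := 4 / a ^+ 2 in rl *.
have k10 : 0 <= k1 by rewrite mulr_ge0 ?addr_ge0 ?divr_ge0 ?(ltW a0).
have k20 : 0 <= k2 by rewrite divr_ge0 ?sqr_ge0.
have hD : C1f h D.
  apply: C1f_eq (C1fD fD.1 (C1f_cst (- m))) => [//|i x] /=; exact: addr0.
have ih2 : Ld.-integrable setT (EFin \o (fun x => h x ^+ 2 * p x)).
  exact: integrable_sub_sqr m (C1c_mbs fD).
have r0 : 0 < r by exact: lt_le_trans r1.
pose Hq := \int[Ld]_x (h x ^+ 2 * p x * cube r x); pose H := \int[Ld]_x (h x ^+ 2 * p x).
have bq : mbs (fun x => h x ^+ 2 * p x * cube r x).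
  apply: bdd_suppMl (mbs_cube r d); apply: loc_boundedM; last exact: mlb_density UV.
  by apply: loc_boundedX; exact: C1f_mlb hD.
have H0 : 0 <= H by apply: Rintegral_ge0 => x _; rewrite mulr_ge0 ?sqr_ge0 ?expR_ge0.
have E0 := energy_ge0 U D.
suff : H <= Hq + r^-1 * ((k1 + k2 * 32) * H + 2 * k2 * energy U D).
  have ri : r * r^-1 = 1 by rewrite divff// gt_eqF.
  have ri0 : 0 <= r^-1 by rewrite invr_ge0 ltW.
  have ri1 : r^-1 <= 1 by rewrite invf_le1.
  have h1 : r^-1 * ((k1 + k2 * 32) * H) <= H / 2.
    have := ler_wpM2r H0 (ler_wpM2l ri0 rl); rewrite [r^-1 * r]mulrC ri; lra.
  have h2 : r^-1 * (2 * k2 * energy U D) <= 2 * k2 * energy U D.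
    by apply: ler_piMl => //; apply: mulr_ge0 => //; apply: mulr_ge0.
  have -> : 16 / a ^+ 2 = 4 * k2 by rewrite /k2; ring.
  move=> hh; change (H <= 2 * Hq + 4 * k2 * energy U D); move: hh h1 h2; lra.
rewrite -lee_fin {1}/H fineK; last exact: integrable_fin_num.
apply: integral_cutoff_le.
- apply: measurable_funM; last exact: (mlb_density UV).1.
  by apply: measurable_funX; exact: (C1f_mlb hD).1.
- by move=> x; rewrite mulr_ge0 ?sqr_ge0 ?expR_ge0.
move=> e e01; have ce := C1c_cutoff d (proj1 (andP e01)).
have kD := C1cM ce hD.
have bk : mbs (fun x => cutoff e x ^+ 2 * (h x ^+ 2 * p x)).
  under eq_fun do rewrite mulrA -exprMn.
  by apply: (mbsw UV); exact/bdd_suppX/(C1c_mbs kD).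
have bX : mbs (fun x => sqn x * (cutoff e x * h x) ^+ 2 * p x).
  by apply: (mbsw UV); apply: bdd_suppMl (@mlb_sqn R d) _; exact/bdd_suppX/(C1c_mbs kD).
rewrite mbs_integralE// lee_fin.
apply: (@le_trans _ _ (Hq + r^-1 * \int[Ld]_x (sqn x * (cutoff e x * h x) ^+ 2 * p x))).
  rewrite -mbs_RintegralZl// -mbs_RintegralD//; last exact: bdd_suppZ.
  apply: mbs_le_Rintegral => //; first by apply: bdd_suppD => //; exact: bdd_suppZ.
  move=> x; have hp : 0 <= h x ^+ 2 * p x by rewrite mulr_ge0 ?sqr_ge0 ?expR_ge0.
  have -> : h x ^+ 2 * p x * cube r x + r^-1 * (sqn x * (cutoff e x * h x) ^+ 2 * p x) =
    (cube r x + r^-1 * sqn x * cutoff e x ^+ 2) * (h x ^+ 2 * p x) by rewrite /=; ring.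
  rewrite ler_wpM2r// /cube indicE; case: (boolP (x \in _)) => [_|].
    rewrite -[leLHS]addr0 lerD//; first by rewrite expr_le1 ?cutoff_ge0 ?cutoff_le1.
    by apply: mulr_ge0 (mulr_ge0 _ (sqn_ge0 x)) (sqr_ge0 _); rewrite invr_ge0 ltW.
  rewrite notin_setE/= => /negP; rewrite -ltNge => rx.
  rewrite add0r ler_peMl ?sqr_ge0// mulrC ler_pdivlMr// mul1r.
  by rewrite (le_trans _ (ltW (sqn_gt (ltW r0) rx)))// expr2 ler_peMl// ltW.
rewrite lerD2l ler_wpM2l ?invr_ge0 ?(ltW r0)//.
apply: le_trans (lyapunov_le UV a0 diss kD) _; rewrite -/k1 -/k2.
have h1 : \int[Ld]_x ((cutoff e x * h x) ^+ 2 * p x) <= H.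
  apply: le_Rintegral => //.
    by apply: mbs_integrable; apply: (mbsw UV); exact/bdd_suppX/(C1c_mbs kD).
  move=> x _; rewrite ler_wpM2r ?expR_ge0// exprMn ler_piMl ?sqr_ge0//.
  by rewrite expr_le1 ?cutoff_ge0 ?cutoff_le1.
(* [(u + v)^2 <= 2 u^2 + 2 v^2], and [32] is twice the bound of [dcutoff_le]. *)
have h2 : energy U (fun i x => dcutoff e i x * h x + cutoff e x * D i x) <=
    32 * H + 2 * energy U D.
  have bE i : mbs (fun x => D i x ^+ 2 * p x).
    by apply: (mbsw UV); apply: bdd_suppX; exact: C1c_mbsD fD.
  have bG i : mbs (fun x => (dcutoff e i x * h x + cutoff e x * D i x) ^+ 2 * p x).
    by apply: (mbsw UV); apply: bdd_suppX; exact: (C1c_mbsD i kD).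
  rewrite /energy -!mbs_Rintegral_sum// -RintegralZl// -mbs_RintegralZl; last exact: bdd_supp_sum.
  have i1 : Ld.-integrable setT (EFin \o (fun x => 32 * (h x ^+ 2 * p x))).
    by have := integrableZl measurableT 32 ih2; exact: eq_integrable.
  have b2 : mbs (fun x => 2 * \sum_i D i x ^+ 2 * p x).
    by apply: bdd_suppZ; exact: bdd_supp_sum.
  rewrite -RintegralD//; last exact: mbs_integrable.
  apply: le_Rintegral => //.
  - by apply: mbs_integrable; exact: bdd_supp_sum.
  - have := integrableD measurableT i1 (mbs_integrable b2); exact: eq_integrable.
  move=> x _; rewrite -!mulr_suml !mulrA -mulrDl ler_wpM2r ?expR_ge0//.
  have c1 : cutoff e x ^+ 2 <= 1 by rewrite expr_le1 ?cutoff_ge0 ?cutoff_le1.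
  apply: (@le_trans _ _ (2 * (\sum_i dcutoff e i x ^+ 2) * h x ^+ 2 + 2 * \sum_i D i x ^+ 2)).
    rewrite -mulrA mulr_suml !mulr_sumr -big_split/=; apply: ler_sum => i _.
    have := ler_wpM2r (sqr_ge0 (D i x)) c1.
    have := sqr_ge0 (dcutoff e i x * h x - cutoff e x * D i x); nra.
  have := ler_wpM2r (sqr_ge0 (h x)) (dcutoff_le x e01); lra.
have := ler_wpM2l k10 h1; have := ler_wpM2l k20 h2; lra.
Qed.

Variables (M c C : R).
Hypothesis UM : forall x, `|x| <= r -> `|U x - c| <= M.
Hypothesis C0 : 0 <= C.
Hypothesis cubeC : forall (h : 'rV[R]_d -> R) D, C1f h D ->
  \int[Ld]_x (h x ^+ 2 * cube r x) <=
  C * (\sum_i \int[Ld]_x (D i x ^+ 2 * cube r x) + (\int[Ld]_x (h x * cube r x)) ^+ 2).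

(** [m] is the Lebesgue mean of [f] over the cube, so the squared integral in [cubeC] vanishes. On
    the cube the density lies within a factor [exp M] of [exp (- c)]; passing to Lebesgue measure
    and back costs [exp (2 M)], whatever [c] is. *)
Lemma poincare f D : C1c f D -> exists m,
  \int[Ld]_x ((f x - m) ^+ 2 * p x) <= (2 * (expR (2 * M) * C) + 16 / a ^+ 2) * energy U D.
Proof.
move=> fD; pose W := \int[Ld]_x cube r x.
have r0 : 0 < r by exact: lt_le_trans r1.
have W0 : W != 0 by rewrite gt_eqF// (Rintegral_cube_gt0 d r0).
pose m := (\int[Ld]_x (f x * cube r x)) / W.
exists m; apply: le_trans (exterior_le m fD) _; rewrite [leRHS]mulrDl lerD2r.
rewrite -[leRHS]mulrA ler_wpM2l//; pose h x := f x - m.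
have hD : C1f h D.
  apply: C1f_eq (C1fD fD.1 (C1f_cst (- m))) => [//|i x] /=; exact: addr0.
have bc (F : 'rV[R]_d -> R) : mlb F -> mbs (fun x => F x * cube r x).
  by move=> lF; apply: bdd_suppMl lF (mbs_cube r d).
have lh : mlb h by exact: C1f_mlb hD.
have h0 : \int[Ld]_x (h x * cube r x) = 0.
  under eq_Rintegral do rewrite /h mulrBl.
  rewrite mbs_RintegralB; [|exact: bc (C1f_mlb fD.1)|exact: bdd_suppZ (mbs_cube r d)].
  by rewrite mbs_RintegralZl ?mulfVK ?subrr//; exact: mbs_cube.
have pc x : cube r x != 0 -> expR (- M) <= p x * expR c <= expR M.
  rewrite /cube indicE pnatr_eq0 eqb0 negbK inE/= => /UM.
  by rewrite -expRD !ler_expR ler_norml => /andP[? ?]; apply/andP; split; lra.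
apply: (@le_trans _ _ (expR (M - c) * \int[Ld]_x (h x ^+ 2 * cube r x))).
  rewrite -mbs_RintegralZl; last by apply: bc; exact: loc_boundedX.
  apply: mbs_le_Rintegral.
  - by apply: bc; apply: loc_boundedM; [exact: loc_boundedX|exact: mlb_density UV].
  - by apply: bdd_suppZ; apply: bc; exact: loc_boundedX.
  move=> x; have [->|/pc/andP[_ cM]] := eqVneq (cube r x) 0; first by rewrite !mulr0.
  rewrite mulrA [expR _ * _]mulrC ler_wpM2r ?cube_ge0// ler_wpM2l ?sqr_ge0//.
  by rewrite expRD [expR (- c)]expRN ler_pdivlMr ?expR_gt0.
have -> : expR (2 * M) * C * energy U D = expR (M - c) * (C * (expR (M + c) * energy U D)).
  have -> : expR (2 * M) = expR (M - c) * expR (M + c) by rewrite -expRD; congr expR; ring.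
  by ring.
rewrite ler_wpM2l ?expR_ge0//; apply: le_trans (cubeC hD) _.
rewrite h0 expr0n addr0 ler_wpM2l// /energy mulr_sumr; apply: ler_sum => i _.
have lD : mlb (fun x => D i x ^+ 2) by apply: loc_boundedX; exact: C1f_mlbD hD.
have bE : mbs (fun x => D i x ^+ 2 * p x).
  by apply: (mbsw UV); apply: bdd_suppX; exact: C1c_mbsD fD.
rewrite -mbs_RintegralZl//; apply: mbs_le_Rintegral; [exact: bc|exact: bdd_suppZ|].
move=> x; have [->|nz] := eqVneq (cube r x) 0.
  by rewrite mulr0; exact: mulr_ge0 (expR_ge0 _) (mulr_ge0 (sqr_ge0 _) (expR_ge0 _)).
have /andP[cM _] := pc _ nz.
have -> : cube r x = 1.
  by move: nz; rewrite /cube indicE; case: (_ \in _); rewrite ?eqxx.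
rewrite mulr1 mulrCA ler_peMr ?sqr_ge0//.
by rewrite expRD -mulrA [expR c * _]mulrC -(expRxMexpNx_1 M) ler_wpM2l ?expR_ge0.
Qed.

End poincare.

(** * Removing the defect *)

Section rothaus.
Context {R : realType}.

(* Here [s = f / m] and [k = s (s - 1)^2 / (s^2 + 1)]. *)
Lemma xlnx_sqr_le_truncation (s k : R) : k * (s ^+ 2 + 1) = s * (s - 1) ^+ 2 ->
  s ^+ 2 * ln (s ^+ 2) - s ^+ 2 + 1 <= 80 * (s - 1) ^+ 2 + 25 / 4 * (k ^+ 2 * ln (k ^+ 2)).
Proof.
move=> kE; have s1 : 0 < s ^+ 2 + 1 by have := sqr_ge0 s; lra.
(* Near [s = 1] the left-hand side is at most [16 (s - 1)^2], and [k^2 ln (k^2)] is at least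
   [- (s - 1)^2]. *)
have [hs|hs] := leP `|s - 1| 2.
  have {}hs := hs; rewrite ler_norml in hs; move/andP: hs => [hs1 hs2].
  have h1 : s ^+ 2 * ln (s ^+ 2) - s ^+ 2 + 1 <= 16 * (s - 1) ^+ 2.
    apply: (@le_trans _ _ ((s ^+ 2 - 1) ^+ 2)).
      have [->|s0] := eqVneq s 0; first by rewrite expr0n/= mul0r; lra.
      have sp : 0 < s ^+ 2 by rewrite exprn_even_gt0.
      have := ler_wpM2l (ltW sp) (ln_le_subr1 sp); lra.
    have -> : (s ^+ 2 - 1) ^+ 2 = (s + 1) ^+ 2 * (s - 1) ^+ 2 by ring.
    rewrite ler_wpM2r ?sqr_ge0//; nra.
  have h2 : - (s - 1) ^+ 2 <= k ^+ 2 * ln (k ^+ 2).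
    have [->|k0] := eqVneq k 0; first by rewrite expr0n/= mul0r oppr_le0 sqr_ge0.
    have kp : 0 < `|k| by rewrite normr_gt0.
    have kk : 2 * `|k| <= (s - 1) ^+ 2.
      rewrite -(ler_pM2r s1) -mulrA -[X in 2 * (_ * X)](gtr0_norm s1) -normrM kE normrM.
      rewrite [`|(s - 1) ^+ 2|]ger0_norm ?sqr_ge0// mulrA mulrC ler_wpM2l ?sqr_ge0//.
      by rewrite -[s ^+ 2]real_normK ?num_real//; have := sqr_ge0 (`|s| - 1); lra.
    have -> : k ^+ 2 = `|k| ^+ 2 by rewrite real_normK ?num_real.
    rewrite lnXn// mulr2n.
    have := ler_wpM2l (sqr_ge0 `|k|) (ln_ge_1subV kp).
    have -> : `|k| ^+ 2 * (1 - `|k|^-1) = `|k| ^+ 2 - `|k| by field; rewrite gt_eqF.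
    have := sqr_ge0 `|k|; lra.
  have := sqr_ge0 (s - 1); lra.
(* Far from 1 the squares are comparable: [(s - 1)^2 / (s^2 + 1)] is at least 1 for [s < -1], and at
   least its value [2 / 5] at [s = 3] for [s > 3]. The constant [25 / 4] is the inverse square of
   [2 / 5]. *)
have hk : [/\ 1 <= k ^+ 2, s ^+ 2 <= 25 / 4 * k ^+ 2 & 1 <= s ^+ 2].
  have k2E : k ^+ 2 * (s ^+ 2 + 1) ^+ 2 = s ^+ 2 * ((s - 1) ^+ 2) ^+ 2.
    by rewrite -!exprMn kE.
  have [h|h] : s < - 1 \/ 3 < s.
      by move: hs; rewrite lter_normr => /orP[h|h]; [right|left]; lra.
    have sq1 : 1 <= s ^+ 2 by nra.
    have q : (s ^+ 2 + 1) ^+ 2 <= ((s - 1) ^+ 2) ^+ 2.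
      by rewrite ler_sqr ?nnegrE ?sqr_ge0 ?(ltW s1)//; nra.
    have k2 : s ^+ 2 <= k ^+ 2.
      rewrite -(@ler_pM2r _ ((s ^+ 2 + 1) ^+ 2)) ?exprn_gt0// k2E.
      by rewrite ler_wpM2l ?sqr_ge0.
    by split; lra.
  have sq1 : 9 <= s ^+ 2 by nra.
  have q : (2 / 5 * (s ^+ 2 + 1)) ^+ 2 <= ((s - 1) ^+ 2) ^+ 2.
    rewrite ler_sqr ?nnegrE ?sqr_ge0 ?mulr_ge0 ?(ltW s1)//; nra.
  have k2 : 4 / 25 * s ^+ 2 <= k ^+ 2.
    rewrite -(@ler_pM2r _ ((s ^+ 2 + 1) ^+ 2)) ?exprn_gt0// k2E.
    have := ler_wpM2l (sqr_ge0 s) q; rewrite exprMn; lra.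
  by split; lra.
case: hk => k1 sk sq1.
have kp : 0 < k ^+ 2 by lra.
have sp : 0 < s ^+ 2 by lra.
have hkq : k ^+ 2 <= 9 / 4 * (s - 1) ^+ 2.
  rewrite -(@ler_pM2r _ ((s ^+ 2 + 1) ^+ 2)) ?exprn_gt0//.
  have -> : k ^+ 2 * (s ^+ 2 + 1) ^+ 2 = (s * (s - 1)) ^+ 2 * (s - 1) ^+ 2.
    have -> : (s * (s - 1)) ^+ 2 * (s - 1) ^+ 2 = (s * (s - 1) ^+ 2) ^+ 2 by ring.
    by rewrite -kE exprMn.
  have -> : 9 / 4 * (s - 1) ^+ 2 * (s ^+ 2 + 1) ^+ 2 =
     (3 / 2 * (s ^+ 2 + 1)) ^+ 2 * (s - 1) ^+ 2 by field.
  rewrite ler_wpM2r ?sqr_ge0// -[leLHS]real_normK ?num_real// ler_sqr ?nnegrE ?mulr_ge0 ?(ltW s1)//.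
  by rewrite ler_norml; apply/andP; split; have := sqr_ge0 (s - 1); have := sqr_ge0 (s + 1); lra.
have l0 : 0 <= ln (25 / 4 * k ^+ 2) by apply: ln_ge0; lra.
have l1 : ln (s ^+ 2) <= ln (25 / 4 * k ^+ 2) by rewrite ler_ln ?posrE//; lra.
(* By [ln x <= x - 1]. The term this adds is [25/4 * 21/4 * k^2], at most
   [25/4 * 21/4 * 9/4 * (s - 1)^2], which [80] rounds up. *)
have l2 : ln (25 / 4 * k ^+ 2) <= 21 / 4 + ln (k ^+ 2).
  rewrite lnM ?posrE// lerD2r (le_trans (ln_le_subr1 _))//; lra.
have h1 := ler_wpM2l (ltW sp) l1; have h2 := ler_wpM2r l0 sk.
have h3 := ler_wpM2l (_ : 0 <= 25 / 4 * k ^+ 2) l2.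
have {}h3 := h3 ltac:(lra).
lra.
Qed.

End rothaus.

Section tightening.
Context {R : realType} {d : nat}.
Local Notation Ld := (@lebesgue_rV R d).
Variables (U : 'rV[R]_d -> R) (V : 'I_d -> 'rV[R]_d -> R).
Hypothesis UV : C1f U V.
Local Notation p := (fun x => expR (- U x)).
Hypothesis ip : Ld.-integrable setT (EFin \o p).
Hypothesis p1 : \int[Ld]_x p x = 1.
Variables c1 c2 cP : R.
Hypotheses (c10 : 0 <= c1) (c20 : 0 <= c2) (cP0 : 0 <= cP).
Hypothesis defective : forall (f : 'rV[R]_d -> R) D, C1c f D ->
  \int[Ld]_x (f x ^+ 2 * ln (f x ^+ 2) * p x) <=
  c1 * energy U D + c2 * \int[Ld]_x (f x ^+ 2 * p x) +
  \int[Ld]_x (f x ^+ 2 * p x) * ln (\int[Ld]_x (f x ^+ 2 * p x)).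
Hypothesis poinc : forall (f : 'rV[R]_d -> R) D, C1c f D -> exists m,
  \int[Ld]_x ((f x - m) ^+ 2 * p x) <= cP * energy U D.

(* [truncation m y = y (y - m)^2 / (y^2 + m^2)], written so that its derivative is
   easy to read off. *)
Definition truncation (m y : R) := y - 2 * m + 2 * m ^+ 3 * (y ^+ 2 + m ^+ 2)^-1.
Definition dtruncation (m y : R) := 1 - 4 * m ^+ 3 * y * ((y ^+ 2 + m ^+ 2) ^+ 2)^-1.

Let den_gt0 m y : m != 0 -> 0 < y ^+ 2 + m ^+ 2 :> R.
Proof. by move=> m0; rewrite ltr_wpDl ?sqr_ge0// exprn_even_gt0. Qed.

Lemma truncation0 m : m != 0 -> truncation m 0 = 0.
Proof. by move=> m0; rewrite /truncation expr0n add0r /=; field. Qed.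

Lemma is_derive_truncation m (y : R) : m != 0 ->
  is_derive y (1 : R) (truncation m) (dtruncation m y).
Proof.
move=> m0; have dn := den_gt0 y m0.
have d1 : is_derive y (1 : R) (fun y => y ^+ 2 + m ^+ 2) (2 * y).
  by apply: is_derive_eq; rewrite /GRing.scale/=; ring.
have d2 := @is_deriveV _ (fun y => y ^+ 2 + m ^+ 2) y _ 1 (lt0r_neq0 dn) d1.
rewrite /truncation; apply: is_derive_eq; rewrite /dtruncation /GRing.scale/=.
by field; rewrite gt_eqF.
Qed.

Lemma continuous_dtruncation m : m != 0 -> continuous (dtruncation m).
Proof.
move=> m0 y; apply: cvgB; first exact: cvg_cst.
apply: cvgM; first by apply: cvgM; [exact: cvg_cst|exact: cvg_id].
apply: cvgV; first by rewrite expf_neq0// gt_eqF// den_gt0.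
have cd : continuous (fun y : R => y ^+ 2 + m ^+ 2).
  apply: continuous_add; last exact: cst_continuous.
  by apply: continuous_sqr => z; exact: cvg_id.
exact: (continuous_sqr cd).
Qed.

(** Since [4 |m|^3 |y| <= 2 (y^2 + m^2)^2], the derivative lies between -1 and 3. *)
Lemma dtruncation_le m y : m != 0 -> dtruncation m y ^+ 2 <= 9.
Proof.
move=> m0; have dn := den_gt0 y m0; rewrite /dtruncation.
set z := 4 * m ^+ 3 * y * _.
have : `|z| <= 2.
  rewrite /z normrM normfV [`|(y ^+ 2 + _) ^+ 2|]ger0_norm ?sqr_ge0//.
  rewrite ler_pdivrMr ?exprn_gt0// ler_norml.
  have h1 := sqr_ge0 (y ^+ 2 + m ^+ 2 - 0).
  have h2 : 0 <= m ^+ 2 * (m - y) ^+ 2 by rewrite mulr_ge0 ?sqr_ge0.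
  have h3 : 0 <= m ^+ 2 * (m + y) ^+ 2 by rewrite mulr_ge0 ?sqr_ge0.
  have h4 : 0 <= y ^+ 2 * m ^+ 2 by rewrite mulr_ge0 ?sqr_ge0.
  have h5 : 0 <= (y ^+ 2) ^+ 2 by rewrite sqr_ge0.
  by apply/andP; split; lra.
rewrite ler_norml => /andP[? ?]; nra.
Qed.

Lemma truncation_sqr_le m y : m != 0 -> truncation m y ^+ 2 <= 9 / 4 * (y - m) ^+ 2.
Proof.
move=> m0; have dn := den_gt0 y m0.
have -> : truncation m y = (y - m) * (y * (y - m)) / (y ^+ 2 + m ^+ 2).
  by rewrite /truncation; field; rewrite gt_eqF.
rewrite -mulrA exprMn mulrC ler_wpM2r ?sqr_ge0//.
have -> : 9 / 4 = (3 / 2) ^+ 2 :> R by field.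
rewrite -[leLHS]real_normK ?num_real// ler_sqr ?nnegrE//.
rewrite normrM normfV [`|y ^+ 2 + _|]gtr0_norm// ler_pdivrMr// ler_norml.
have := sqr_ge0 y; have := sqr_ge0 m; have := sqr_ge0 (y - m); have := sqr_ge0 (y + m).
by move=> ? ? ? ?; apply/andP; split; lra.
Qed.

(** The inequality for [s = y / m], multiplied by [m^2]; the scaling creates the terms with
    [ln (m^2)]. The left-hand side is the Bregman divergence of [u ln u] between [y^2] and [m^2]. *)
Lemma entropy_pointwise_le m y : m != 0 ->
  y ^+ 2 * ln (y ^+ 2) - y ^+ 2 * ln (m ^+ 2) - y ^+ 2 + m ^+ 2 <=
  80 * (y - m) ^+ 2 + 25 / 4 * (truncation m y ^+ 2 * ln (truncation m y ^+ 2) -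
    truncation m y ^+ 2 * ln (m ^+ 2)).
Proof.
move=> m0; have m2 : 0 < m ^+ 2 by rewrite exprn_even_gt0.
pose s := y / m; pose k := truncation m y / m.
have yE : y = s * m by rewrite /s divfK.
have tE : truncation m y = k * m by rewrite /k divfK.
have xlnxE (t : R) : (t * m) ^+ 2 * ln ((t * m) ^+ 2) - (t * m) ^+ 2 * ln (m ^+ 2) =
    m ^+ 2 * (t ^+ 2 * ln (t ^+ 2)).
  have [->|t0] := eqVneq t 0; first by rewrite mul0r expr0n/= !(mul0r, mulr0) subrr.
  rewrite exprMn (@lnM _ (t ^+ 2) (m ^+ 2)) ?posrE ?exprn_even_gt0//; ring.
have kE : k * (s ^+ 2 + 1) = s * (s - 1) ^+ 2.
  by rewrite /k /s /truncation; field; rewrite m0 gt_eqF// den_gt0.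
have := ler_wpM2l (ltW m2) (xlnx_sqr_le_truncation kE).
rewrite tE xlnxE yE xlnxE; lra.
Qed.

Lemma lsi_weighted f D : C1c f D ->
  \int[Ld]_x (f x ^+ 2 * ln (f x ^+ 2) * p x) -
    \int[Ld]_x (f x ^+ 2 * p x) * ln (\int[Ld]_x (f x ^+ 2 * p x)) <=
  (60 * c1 + cP * (80 + 25 * c2)) * energy U D.
Proof.
move=> fD; have [m mP] := poinc fD; have E0 := energy_ge0 U D.
have bf := C1c_mbs fD; have bf2 := bdd_suppX 1 bf.
have ih2 := integrable_sub_sqr UV ip m bf.
have im2 : Ld.-integrable setT (EFin \o (fun x => m ^+ 2 * p x)).
  by have := integrableZl measurableT (m ^+ 2) ip; exact: eq_integrable.
have := defective fD.
set L := \int[Ld]_x (_ * ln _ * _); set A := \int[Ld]_x (f x ^+ 2 * p x) => def.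
set H := \int[Ld]_x _ in mP.
have H0 : 0 <= H by apply: Rintegral_ge0 => x _; rewrite mulr_ge0 ?sqr_ge0 ?expR_ge0.
have A0 : 0 <= A by apply: Rintegral_ge0 => x _; rewrite mulr_ge0 ?sqr_ge0 ?expR_ge0.
have e1 : 0 <= c1 * energy U D by rewrite mulr_ge0.
have e2 : 0 <= cP * energy U D by rewrite mulr_ge0.
have e3 : 0 <= c2 * (cP * energy U D) by rewrite mulr_ge0.
(* If [m] is this small, the whole mass [A] is at most [13/2 H], and the defect is bounded by the
   variance without truncating. Otherwise [m] is nonzero and the truncated function has mass
   [Ak <= 9/4 H < m^2]. *)
have [mH|mH] := leP (m ^+ 2) (9 / 4 * H).
  have AH : A <= 2 * H + 2 * m ^+ 2.
    have i2 : Ld.-integrable setT (EFin \o (fun x => 2 * ((f x - m) ^+ 2 * p x))).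
      by have := integrableZl measurableT 2 ih2; exact: eq_integrable.
    have i3 : Ld.-integrable setT (EFin \o (fun x => 2 * (m ^+ 2 * p x))).
      by have := integrableZl measurableT 2 im2; exact: eq_integrable.
    have -> : m ^+ 2 = \int[Ld]_x (m ^+ 2 * p x) by rewrite RintegralZl// p1 mulr1.
    rewrite -!RintegralZl// -RintegralD//; apply: le_Rintegral => //.
    - by apply: mbs_integrable; exact: (mbsw UV).
    - by have := integrableD measurableT i2 i3; exact: eq_integrable.
    move=> x _; rewrite !mulrA -mulrDl ler_wpM2r ?expR_ge0//.
    have := sqr_ge0 (f x - 2 * m); lra.
  have := ler_wpM2l c20 (_ : A <= 13 / 2 * (cP * energy U D)).
  move=> /(_ ltac:(lra)); lra.
have m0 : m != 0.
  by apply/eqP => mz; move: mH; rewrite mz expr0n/=; lra.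
have kD := C1c_comp (continuous_dtruncation m0) (fun y => is_derive_truncation y m0)
  (truncation0 m0) fD.
have bk := C1c_mbs kD; have bk2 := bdd_suppX 1 bk.
have := defective kD; set Lk := \int[Ld]_x (_ * ln _ * _).
set Ek := energy _ _; set Ak := \int[Ld]_x _ => defk.
have EkE : Ek <= 9 * energy U D.
  rewrite /Ek /energy mulr_sumr; apply: ler_sum => i _.
  have bE : mbs (fun x => D i x ^+ 2 * p x).
    by apply: (mbsw UV); apply: bdd_suppX; exact: C1c_mbsD fD.
  rewrite -mbs_RintegralZl//; apply: mbs_le_Rintegral.
  - by apply: (mbsw UV); apply: bdd_suppX; exact: (C1c_mbsD i kD).
  - exact: bdd_suppZ.
  move=> x; rewrite mulrA ler_wpM2r ?expR_ge0// exprMn ler_wpM2r ?sqr_ge0//.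
  exact: dtruncation_le.
have AkH : Ak <= 9 / 4 * H.
  rewrite -RintegralZl//; apply: le_Rintegral => //.
  - by apply: mbs_integrable; exact: (mbsw UV).
  - by have := integrableZl measurableT (9 / 4) ih2; exact: eq_integrable.
  move=> x _; rewrite mulrA ler_wpM2r ?expR_ge0//; exact: truncation_sqr_le.
have Ak0 : 0 <= Ak by apply: Rintegral_ge0 => x _; rewrite mulr_ge0 ?sqr_ge0 ?expR_ge0.
have m2 : 0 < m ^+ 2 by rewrite exprn_even_gt0.
(* The threshold on [m^2] is chosen to give this term a sign. *)
have Akl : Ak * ln Ak - Ak * ln (m ^+ 2) <= 0.
  rewrite subr_le0; have [->|An] := eqVneq Ak 0; first by rewrite !mul0r.
  have Ap : 0 < Ak by rewrite lt_neqAle eq_sym An.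
  by rewrite ler_wpM2l// ler_ln ?posrE//; lra.
(* This replaces the entropy relative to the mass [A] by the integrated Bregman divergence from
   [m^2]. *)
have Al : A - m ^+ 2 <= A * ln A - A * ln (m ^+ 2).
  have [->|An] := eqVneq A 0; first by rewrite !mul0r; lra.
  have Ap : 0 < A by rewrite lt_neqAle eq_sym An.
  have q0 : 0 < A / m ^+ 2 by rewrite divr_gt0.
  have := ler_wpM2l A0 (ln_ge_1subV q0).
  rewrite ln_div ?posrE// invf_div mulrBr mulr1 mulrCA divff ?gt_eqF// mulr1 mulrBr; lra.
have main : L - A * ln (m ^+ 2) - A + m ^+ 2 <=
    80 * H + 25 / 4 * (Lk - Ak * ln (m ^+ 2)).
  have bfl : mbs (fun x => f x ^+ 2 * ln (f x ^+ 2)).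
    by apply: bdd_supp_xlnx => // x; exact: sqr_ge0.
  have bkl : mbs (fun x => truncation m (f x) ^+ 2 * ln (truncation m (f x) ^+ 2)).
    by apply: bdd_supp_xlnx => // x; exact: sqr_ge0.
  have b1 : mbs (fun x => (f x ^+ 2 * ln (f x ^+ 2) - ln (m ^+ 2) * f x ^+ 2 - f x ^+ 2) * p x).
    apply: (mbsw UV); apply: bdd_suppB => //; apply: bdd_suppB => //; exact: bdd_suppZ.
  have b2 : mbs (fun x => (truncation m (f x) ^+ 2 * ln (truncation m (f x) ^+ 2) -
       ln (m ^+ 2) * truncation m (f x) ^+ 2) * p x).
    by apply: (mbsw UV); apply: bdd_suppB => //; exact: bdd_suppZ.
  have -> : L - A * ln (m ^+ 2) - A + m ^+ 2 =
      \int[Ld]_x ((f x ^+ 2 * ln (f x ^+ 2) - ln (m ^+ 2) * f x ^+ 2 - f x ^+ 2) * p x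
        + m ^+ 2 * p x).
    rewrite RintegralD//; last exact: mbs_integrable.
    rewrite RintegralZl// p1 mulr1; congr (_ + _).
    have bL : mbs (fun x => f x ^+ 2 * ln (f x ^+ 2) * p x) by exact: (mbsw UV).
    have bA : mbs (fun x => f x ^+ 2 * p x) by exact: (mbsw UV).
    have bZ : mbs (fun x => ln (m ^+ 2) * (f x ^+ 2 * p x)) by exact: bdd_suppZ.
    have bB := bdd_suppB bL bZ.
    rewrite [A * _]mulrC -mbs_RintegralZl// -mbs_RintegralB// -mbs_RintegralB//.
    by apply: eq_Rintegral => x _; ring.
  have -> : Lk - Ak * ln (m ^+ 2) = \int[Ld]_x ((truncation m (f x) ^+ 2 *
      ln (truncation m (f x) ^+ 2) - ln (m ^+ 2) * truncation m (f x) ^+ 2) * p x).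
    have bL : mbs (fun x => truncation m (f x) ^+ 2 * ln (truncation m (f x) ^+ 2) * p x).
      exact: (mbsw UV).
    have bA : mbs (fun x => truncation m (f x) ^+ 2 * p x) by exact: (mbsw UV).
    have bZ : mbs (fun x => ln (m ^+ 2) * (truncation m (f x) ^+ 2 * p x)).
      exact: bdd_suppZ.
    rewrite [Ak * _]mulrC -mbs_RintegralZl// -mbs_RintegralB//.
    by apply: eq_Rintegral => x _; ring.
  have i1 : Ld.-integrable setT (EFin \o (fun x => 80 * ((f x - m) ^+ 2 * p x))).
    by have := integrableZl measurableT 80 ih2; exact: eq_integrable.
  have b3 := bdd_suppZ (25 / 4) b2.
  rewrite -RintegralZl// -mbs_RintegralZl// -RintegralD//; last exact: mbs_integrable.
  apply: le_Rintegral => //.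
  - have := integrableD measurableT (mbs_integrable b1) im2; exact: eq_integrable.
  - have := integrableD measurableT i1 (mbs_integrable b3); exact: eq_integrable.
  move=> x _; rewrite !mulrA -!mulrDl ler_wpM2r ?expR_ge0//.
  have := entropy_pointwise_le (f x) m0; lra.
(* The coefficients [60] and [25] round up [25/4 * 9] and [25/4 * 9/4]. *)
have := ler_wpM2l c10 EkE; have := ler_wpM2l c20 (_ : Ak <= 9 / 4 * (cP * energy U D)).
move=> /(_ ltac:(lra)); lra.
Qed.

End tightening.

(** * Lipschitz gradients and densities *)

Section gradients.
Context {R : realType} {d : nat}.
Implicit Types (U : 'rV[R]_d -> R) (x y : 'rV[R]_d).

Lemma dotpp x : dotp x x = sqn x.
Proof. by rewrite /dotp /sqn; apply: eq_bigr => i _; rewrite expr2. Qed.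

Lemma enorm_sqr x : enorm x ^+ 2 = sqn x.
Proof. by rewrite /enorm dotpp sqr_sqrtr// sqn_ge0. Qed.

Lemma enorm_ge0 x : 0 <= enorm x.
Proof. exact: sqrtr_ge0. Qed.

Lemma coord_le_enorm x i : `|x ord0 i| <= enorm x.
Proof.
rewrite -sqrtr_sqr ler_wsqrtr// dotpp /sqn (bigD1 i)//= lerDl.
by apply: sumr_ge0 => j _; exact: sqr_ge0.
Qed.

Lemma enorm_le_norm x : enorm x <= Num.sqrt d%:R * `|x|.
Proof.
have -> : Num.sqrt d%:R * `|x| = Num.sqrt (d%:R * `|x| ^+ 2).
  by rewrite sqrtrM// sqrtr_sqr ger0_norm.
rewrite ler_wsqrtr// dotpp /sqn mulr_natl -[in X in _ *+ X](card_ord d) -sumr_const.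
apply: ler_sum => i _; rewrite -[leLHS]real_normK ?num_real// ler_sqr ?nnegrE//.
exact: rV_coord_le_norm.
Qed.

Lemma lipschitz_C1f U (L : R) : (forall x, differentiable U x) ->
  lipschitz_with (grad U) L -> C1f U (fun i x => grad U x ord0 i).
Proof.
move=> dU [L0 LU]; split.
- by move=> x; exact: differentiable_continuous.
- move=> i x; have s0 : 0 <= L * Num.sqrt d%:R by rewrite mulr_ge0 ?sqrtr_ge0.
  apply: (proj2 (@cvgrPdist_le _ _ _ (nbhs x) (nbhs_filter x) _ _)) => e e0.
  apply/nbhs_ballP; exists (e / (L * Num.sqrt d%:R + 1)).
    by rewrite /= divr_gt0// ltr_wpDl.
  move=> y; rewrite -ball_normE /= => /ltW xy.
  have -> : grad U x ord0 i - grad U y ord0 i = (grad U x - grad U y) ord0 i by rewrite !mxE.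
  rewrite (le_trans (coord_le_enorm _ i))// (le_trans (LU x y))//.
  rewrite (le_trans (ler_wpM2l L0 (enorm_le_norm _)))// mulrA.
  rewrite (le_trans (ler_wpM2l s0 xy))// mulrA ler_pdivrMr ?ltr_wpDl//.
  by rewrite mulrC ler_wpM2l ?(ltW e0)// lerDl.
- move=> i x; rewrite mxE; apply/derivableP; exact: diff_derivable.
Qed.

Lemma sqn_add_le x y : sqn x <= 2 * sqn (x - y) + 2 * sqn y.
Proof.
rewrite /sqn !mulr_sumr -big_split/=; apply: ler_sum => i _; rewrite !mxE.
have := sqr_ge0 (x ord0 i - 2 * y ord0 i); nra.
Qed.

Lemma lipschitz_grad_growth U (L : R) x : lipschitz_with (grad U) L ->
  sqn (grad U x) <= 2 * L ^+ 2 * sqn x + 2 * sqn (grad U 0).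
Proof.
move=> [L0 LU]; apply: le_trans (sqn_add_le _ (grad U 0)) _; rewrite lerD2r -mulrA ler_wpM2l//.
rewrite -!enorm_sqr -exprMn ler_sqr ?nnegrE ?mulr_ge0 ?enorm_ge0//.
by have := LU x 0; rewrite subr0.
Qed.

Lemma derive_dotp U x v : differentiable U x -> 'D_v U x = dotp v (grad U x).
Proof.
move=> dU; rewrite deriveE// {1}(row_sum_delta v) linear_sum /dotp; apply: eq_bigr => i _.
by rewrite linearZ mxE /partial deriveE.
Qed.

(** The mean value theorem on the segment from 0 to [x], Young's inequality and the linear growth of
    the gradient. *)
Lemma potential_growth U (L : R) x : (forall x, differentiable U x) ->
  lipschitz_with (grad U) L ->
  `|U x| <= (`|U 0| + sqn (grad U 0) + L ^+ 2 + 1) * (1 + sqn x).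
Proof.
move=> dU LU; pose phi (t : R) := U (t *: x).
have dphi t : is_derive t (1 : R) phi (dotp x (grad U (t *: x))).
  apply/is_derive_lineP; rewrite -derive_dotp//.
  have /derivableP/is_derive_lineP : derivable U (t *: x) x by exact: diff_derivable.
  have -> // : (fun h : R => phi (h *: (1 : R) + t)) = (fun h => U (h *: x + t *: x)).
  by apply/funext => h; rewrite /phi [h *: (1 : R)]mulr1 scalerDl.
have [c] := @MVT_segment R phi _ 0 1 ler01 (fun t _ => dphi t)
  (continuous_subspaceT (derivative_continuous dphi)).
rewrite in_itv/= => /andP[c0 c1]; rewrite /phi scale1r scale0r subr0 mulr1 => UE.
have g := lipschitz_grad_growth (c *: x) LU.
have cx : sqn (c *: x) <= sqn x.
  rewrite /sqn; apply: ler_sum => i _; rewrite mxE exprMn ler_piMl ?sqr_ge0//.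
  by rewrite expr_le1.
have dl : `|dotp x (grad U (c *: x))| <= 2^-1 * (sqn x + sqn (grad U (c *: x))).
  rewrite (le_trans (ler_norm_sum _ _ _))// /sqn -big_split mulr_sumr/=.
  apply: ler_sum => i _; rewrite ler_norml.
  have := sqr_ge0 (x ord0 i - grad U (c *: x) ord0 i).
  have := sqr_ge0 (x ord0 i + grad U (c *: x) ord0 i).
  by move=> ? ?; apply/andP; split; lra.
have -> : U x = U 0 + dotp x (grad U (c *: x)) by rewrite -UE; ring.
rewrite (le_trans (ler_normD _ _))//.
have s0 := sqn_ge0 x; have s1 := sqn_ge0 (grad U 0); have u0 := normr_ge0 (U 0).
have l0 := sqr_ge0 L; have := ler_wpM2l l0 cx; move: (sqn (c *: x)) g cx dl => s2 g cx dl h.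
have := mulr_ge0 u0 s0; have := mulr_ge0 s1 s0; have := mulr_ge0 l0 s0; nra.
Qed.

End gradients.

(** * Probability measures with a given density *)

Section density_probability.
Context {R : realType} {d : nat}.
Local Notation Ld := (@lebesgue_rV R d).
Variable p : 'rV[R]_d -> R.
Hypothesis p_density : pos_density p.

Let mp : measurable_fun setT p. Proof. by case: p_density. Qed.
Let p0 x : 0 <= p x. Proof. by case: p_density => _ /(_ x)/ltW. Qed.

Let ip : Ld.-integrable setT (EFin \o p).
Proof.
apply/integrableP; split; first exact/measurable_EFinP.
under eq_integral => x _ do rewrite /= ger0_norm//.
by case: p_density => _ _ ->; rewrite ltry.
Qed.

Definition density_prob (A : set 'rV[R]_d) : \bar R := (\int[Ld]_(x in A) (p x)%:E)%E.

Let P0 : density_prob set0 = 0%E.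
Proof. by rewrite /density_prob integral_set0. Qed.

Let P_ge0 A : (0 <= density_prob A)%E.
Proof. by apply: integral_ge0 => x _; rewrite lee_fin. Qed.

Let P_sigma_additive : semi_sigma_additive density_prob.
Proof.
move=> /= A mA tA mUA; rewrite /density_prob/= integral_bigcup//=; last first.
  by apply: (integrableS _ _ (subsetT _)) => //; exact: ip.
apply: is_cvg_ereal_nneg_natsum_cond => n _ _.
by apply: integral_ge0 => /= x ?; rewrite lee_fin.
Qed.

HB.instance Definition _ := isMeasure.Build _ _ _ density_prob P0 P_ge0 P_sigma_additive.

Let P_setT : density_prob setT = 1%E.
Proof. by case: p_density. Qed.

HB.instance Definition _ := @Measure_isProbability.Build _ _ R density_prob P_setT.

Lemma exists_probability_density : exists nu : probability 'rV[R]_d R, has_density nu p.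
Proof. by exists density_prob. Qed.

Variable nu : probability 'rV[R]_d R.
Hypothesis nu_p : has_density nu p.

Let dom : nu `<< Ld.
Proof.
apply/null_content_dominatesP => A mA LA0; rewrite nu_p//.
apply: null_set_integral => //.
  exact/measurable_EFinP/measurable_funTS.
Qed.

(** [nu] is known only through its values on sets. Uniqueness identifies its Radon-Nikodym
    derivative with [p] almost everywhere, and the change of variables for that derivative then
    applies. *)
Lemma ge0_integral_density (G : 'rV[R]_d -> \bar R) :
  measurable_fun setT G -> (forall x, 0 <= G x)%E ->
  (\int[nu]_x G x = \int[Ld]_x (G x * (p x)%:E))%E.
Proof.
move=> mG G0; rewrite -(Radon_Nikodym_SigmaFinite.change_of_variables dom G0 measurableT mG).
have ae : ae_eq Ld setT (Radon_Nikodym_SigmaFinite.f nu Ld) (EFin \o p).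
  apply: integral_ae_eq => //.
  - exact: Radon_Nikodym_SigmaFinite.f_integrable.
  - exact/measurable_EFinP.
  - by move=> E _ mE; rewrite -(Radon_Nikodym_SigmaFinite.f_integral dom mE); exact: nu_p.
have mf := measurable_int _ (Radon_Nikodym_SigmaFinite.f_integrable dom).
apply: ae_eq_integral => //.
- exact: emeasurable_funM.
- by apply: emeasurable_funM => //; exact/measurable_EFinP.
- by apply: filterS ae => x /= H _; rewrite H.
Qed.

Lemma integral_density (F : 'rV[R]_d -> R) : measurable_fun setT F ->
  (\int[nu]_x (F x)%:E = \int[Ld]_x (F x * p x)%:E)%E.
Proof.
move=> mF; have mE : measurable_fun setT (EFin \o F) by exact/measurable_EFinP.
rewrite integralE [RHS]integralE.
rewrite !ge0_integral_density//; last 2 first.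
- exact: measurable_funeneg.
- exact: measurable_funepos.
congr (_ - _)%E; apply: eq_integral => x _; rewrite ?funeposE ?funenegE.
  by rewrite -!EFin_max -EFinM maxr_pMl// mul0r.
by rewrite -!EFinN -!EFin_max -EFinM maxr_pMl// mul0r mulNr.
Qed.

End density_probability.

(** * From weighted inequalities to the log-Sobolev inequality of a measure *)

Section test_functions.
Context {R : realType} {d : nat}.

Lemma Cc_infty_C1c (f : 'rV[R]_d -> R) : Cc_infty f -> C1c f (fun i => partial i f).
Proof.
move=> [Cf cf]; split.
  split; first exact: (Cf 0%N).
  - by move=> i; have [_ /(_ i)] := Cf 1%N.
  - move=> i x; apply/derivableP; apply: diff_derivable.
    by have [+ _] := Cf 1%N; exact.
have [M [_ HM]] := compact_bounded cf; exists (M + 1).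
have out (x : 'rV[R]_d) : M + 1 < `|x| -> ~ closure [set x | f x != 0] x.
  move=> xM clx; have : `|x| <= M + 1 by apply: (HM (M + 1)) => //; rewrite ltrDl.
  by rewrite leNgt xM.
have f0 x : ~ closure [set x | f x != 0] x -> f x = 0.
  by move=> nx; apply/eqP/negPn/negP => fx; apply: nx; exact: subset_closure.
split=> [x /out/f0//|i x /out nx]; rewrite /partial.
have : \forall y \near x, f y = cst 0 y.
  have oC : open (~` closure [set x | f x != 0]) by apply: closed_openC; exact: closed_closure.
  have := open_nbhs_nbhs (conj oC nx); apply: (@filterS _ _ (nbhs_filter x)) => y /= ny.
  exact: f0.
move=> nf; rewrite (near_eq_derive _ nf) ?derive_cst//.
Qed.

Variables (U : 'rV[R]_d -> R) (V : 'I_d -> 'rV[R]_d -> R).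
Hypothesis UV : C1f U V.
Local Notation p := (fun x => expR (- U x)).
Hypothesis pp : pos_density p.
Variable nu : probability 'rV[R]_d R.
Hypothesis nu_p : has_density nu p.

Lemma lsi_with_density (C : R) : 0 < C ->
  (forall (f : 'rV[R]_d -> R) D, C1c f D ->
  \int[@lebesgue_rV R d]_x (f x ^+ 2 * ln (f x ^+ 2) * p x) -
    \int[@lebesgue_rV R d]_x (f x ^+ 2 * p x) * ln (\int[@lebesgue_rV R d]_x (f x ^+ 2 * p x)) <=
  C * energy U D) -> lsi_with nu C.
Proof.
move=> C0 H; split => // f /Cc_infty_C1c fD; have := H _ _ fD.
have bf := C1c_mbs fD; have bf2 := bdd_suppX 1 bf; have bp := mbsw UV bf2.
have -> : \int[nu]_y (f y ^+ 2) = \int[@lebesgue_rV R d]_x (f x ^+ 2 * p x).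
  by rewrite /Rintegral (integral_density pp nu_p)//; case: bf2.
set A := \int[_]_x (f x ^+ 2 * p x) => HA.
have bfl : mbs (fun x => f x ^+ 2 * ln (f x ^+ 2)).
  by apply: bdd_supp_xlnx => // x; exact: sqr_ge0.
have -> : (\int[nu]_x (enorm (grad f x) ^+ 2)%:E = (energy U (fun i => partial i f))%:E)%E.
  have bE i : mbs (fun x => partial i f x ^+ 2 * p x).
    by apply: (mbsw UV); apply: bdd_suppX; exact: (C1c_mbsD i fD).
  have bS : mbs (fun x => \sum_i partial i f x ^+ 2).
    by apply: bdd_supp_sum => i; apply: bdd_suppX; exact: (C1c_mbsD i fD).
  under eq_integral => x _.
    rewrite enorm_sqr /sqn (_ : \sum_i _ = \sum_i partial i f x ^+ 2); last first.
      by apply: eq_bigr => i _; rewrite mxE.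
    over.
  rewrite (integral_density pp nu_p); last by case: bS.
  rewrite mbs_integralE; last exact: (mbsw UV).
  rewrite /energy -mbs_Rintegral_sum//; congr (_%:E); apply: eq_Rintegral => x _.
  by rewrite mulr_suml.
(* For [A = 0] the defaults [0^-1 = 0] and [ln 0 = 0] make the integrand vanish. *)
rewrite -EFinM; have [A0|A0] := eqVneq A 0.
  under eq_integral => x _ do rewrite A0 invr0 mulr0 ln0// mulr0.
  by rewrite integral0 lee_fin mulr_ge0 ?energy_ge0// ltW.
have A_gt0 : 0 < A.
  rewrite lt_neqAle eq_sym A0 /A; apply: Rintegral_ge0 => x _.
  by rewrite mulr_ge0 ?sqr_ge0 ?expR_ge0.
have E x : f x ^+ 2 * ln (f x ^+ 2 / A) = f x ^+ 2 * ln (f x ^+ 2) - ln A * f x ^+ 2.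
  have [->|fx] := eqVneq (f x) 0; first by rewrite expr0n/= !mul0r mulr0 subrr.
  rewrite ln_div ?posrE// ?exprn_even_gt0//; ring.
under eq_integral => x _ do rewrite E.
have bB : mbs (fun x => f x ^+ 2 * ln (f x ^+ 2) - ln A * f x ^+ 2).
  by apply: bdd_suppB => //; exact: bdd_suppZ.
rewrite (integral_density pp nu_p); last by case: bB.
rewrite mbs_integralE; last exact: (mbsw UV).
rewrite lee_fin; apply: le_trans HA.
have b1 := mbsw UV bfl; have b2 := bdd_suppZ (ln A) bp.
rewrite [A * _]mulrC -mbs_RintegralZl// -mbs_RintegralB// le_eqVlt; apply/orP; left; apply/eqP.
by apply: eq_Rintegral => x _; ring.
Qed.

End test_functions.

(** The order of the quantifiers is the point. The cube size [r] is fixed by [a], [b] and [d],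
    before the oscillation bound [M] on that cube; [C] is fixed before the potential and the
    measure, hence serves a whole path. The free shift [c] absorbs the normalisation. *)
Lemma lsi_uniform (R : realType) (d : nat) (a b K : R) : 0 < a -> 0 <= b -> 0 <= K ->
  exists r : R, forall M, exists2 C : R, 0 < C &
    forall U V c (nu : probability 'rV[R]_d R),
    C1f U V -> (forall x, a * sqn x - b <= \sum_i x ord0 i * V i x) ->
    (forall x, U x <= K * (1 + sqn x)) ->
    (forall x, \sum_i V i x ^+ 2 <= K * (1 + sqn x)) ->
    (forall x, `|x| <= r -> `|U x - c| <= M) ->
    pos_density (fun x => expR (- U x)) -> has_density nu (fun x => expR (- U x)) ->
    lsi_with nu C.
Proof.
move=> a0 b0 K0; set k1 := 2 / a * (d%:R + b); set k2 := 4 / a ^+ 2.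
have k10 : 0 <= k1 by rewrite mulr_ge0 ?addr_ge0 ?divr_ge0 ?(ltW a0).
have k20 : 0 <= k2 by rewrite divr_ge0 ?sqr_ge0.
pose r := 1 + 2 * (k1 + k2 * 32); have r1 : 1 <= r by rewrite /r; lra.
have r0 : 0 < r by exact: lt_le_trans r1.
have rl : 2 * (k1 + k2 * 32) <= r by rewrite /r; lra.
exists r => M; have [CQ CQ0 cubeC] := cube_poincare r0 d.
pose c1 := 2 + 3 / 2 * K * k2; pose c2 := 3 / 2 * K * (1 + k1).
pose cP := 2 * (expR (2 * M) * CQ) + 16 / a ^+ 2.
have c10 : 0 <= c1 by rewrite addr_ge0// mulr_ge0// mulr_ge0.
have c20 : 0 <= c2 by rewrite mulr_ge0 ?addr_ge0// mulr_ge0.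
have cP0 : 0 <= cP.
  by rewrite addr_ge0 ?divr_ge0 ?sqr_ge0// mulr_ge0// mulr_ge0 ?expR_ge0.
have C0 : 0 <= 60 * c1 + cP * (80 + 25 * c2).
  by rewrite addr_ge0// mulr_ge0// addr_ge0// mulr_ge0.
exists (60 * c1 + cP * (80 + 25 * c2) + 1); first by rewrite ltr_wpDl.
move=> U V c nu UV diss UK VK UM pp nup.
have ip : (@lebesgue_rV R d).-integrable setT (EFin \o (fun x => expR (- U x))).
  apply/integrableP; split; first by apply/measurable_EFinP; case: pp.
  under eq_integral => x _ do rewrite /= ger0_norm ?expR_ge0//.
  by case: pp => _ _ ->; rewrite ltry.
have p1 : \int[@lebesgue_rV R d]_x expR (- U x) = 1.
  by rewrite /Rintegral; case: pp => _ _ ->.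
apply: (lsi_with_density UV pp nup); first by rewrite ltr_wpDl.
move=> f D fD; apply: (@le_trans _ _ ((60 * c1 + cP * (80 + 25 * c2)) * energy U D)).
  apply: (lsi_weighted UV ip p1 c10 c20 cP0) fD => {}f {}D fD.
    exact: (defective_lsi UV a0 diss K0 UK VK).
  exact: (poincare UV ip a0 b0 diss r1 rl UM CQ0 cubeC).
by rewrite ler_wpM2r ?energy_ge0// lerDl.
Qed.

(** * The geometric path *)

Section geometric_path_facts.
Context {R : realType} {d : nat}.
Local Notation Ld := (@lebesgue_rV R d).
Variables p0 p1 : 'rV[R]_d -> R.
Hypothesis p0_density : pos_density p0.
Hypothesis p1_density : pos_density p1.
Local Notation U0 := (potential p0).
Local Notation U1 := (potential p1).
Variables V0 V1 : 'I_d -> 'rV[R]_d -> R.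
Hypothesis UV0 : C1f U0 V0.
Hypothesis UV1 : C1f U1 V1.
Variables a b K : R.
Hypothesis a0 : 0 < a.
Hypothesis b0 : 0 <= b.
Hypothesis diss0 : forall x, a * sqn x - b <= \sum_i x ord0 i * V0 i x.
Hypothesis diss1 : forall x, a * sqn x - b <= \sum_i x ord0 i * V1 i x.
Hypothesis K0 : 0 <= K.
Hypothesis U0_le : forall x, `|U0 x| <= K * (1 + sqn x).
Hypothesis U1_le : forall x, `|U1 x| <= K * (1 + sqn x).

Lemma exp_potential (p : 'rV[R]_d -> R) x : pos_density p -> expR (- potential p x) = p x.
Proof. by case=> _ pp _; rewrite /potential opprK lnK// posrE. Qed.

Definition Upath t x := t * U1 x + (1 - t) * U0 x.
Definition wpath t x := expR (- Upath t x).
Definition Zpath t := \int[Ld]_x wpath t x.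

Lemma geometric_pathE t x : geometric_path p0 p1 t x = wpath t x / Zpath t.
Proof.
have E y : p1 y `^ t * p0 y `^ (1 - t) = wpath t y.
  have [_ P0 _] := p0_density; have [_ P1 _] := p1_density.
  rewrite /powR !gt_eqF// -expRD /wpath /Upath /potential; congr expR; ring.
rewrite /geometric_path E; congr (_ / _).
by apply: eq_Rintegral => y _; rewrite E.
Qed.

Lemma wpath_ge0 t x : 0 <= wpath t x. Proof. exact: expR_ge0. Qed.

(** The weighted arithmetic-geometric mean inequality: the tangent of [expR] at [- Upath t x] lies
    below [expR] at [- U0 x] and [- U1 x], and its linear terms cancel in the mixture. *)
Lemma wpath_le t x : 0 <= t <= 1 -> wpath t x <= t * p1 x + (1 - t) * p0 x.
Proof.
move=> /andP[t0 t1]; rewrite -(exp_potential x p0_density) -(exp_potential x p1_density).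
set y := - Upath t x.
have E u : expR y * (1 + (u - y)) <= expR u.
  have -> : expR u = expR y * expR (u - y) by rewrite -expRD; congr expR; ring.
  by rewrite ler_wpM2l ?expR_ge0// expR_ge1Dx.
have h0 := ler_wpM2l (_ : 0 <= 1 - t) (E (- U0 x)).
have h1 := ler_wpM2l t0 (E (- U1 x)).
have {}h0 := h0 ltac:(lra).
have -> : wpath t x = t * (expR y * (1 + (- U1 x - y))) + (1 - t) * (expR y * (1 + (- U0 x - y))).
  by rewrite /wpath -/y {3 5}/y /Upath; ring.
lra.
Qed.

Let integrable_density p : pos_density p -> Ld.-integrable setT (EFin \o p).
Proof.
move=> [mp pp ip]; apply/integrableP; split; first exact/measurable_EFinP.
under eq_integral => x _ do rewrite /= gtr0_norm//.
by rewrite ip ltry.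
Qed.

Let Rintegral_density p : pos_density p -> \int[Ld]_x p x = 1.
Proof. by move=> [_ _ ip]; rewrite /Rintegral ip. Qed.

Lemma C1f_Upath t : C1f (Upath t) (fun i x => t * V1 i x + (1 - t) * V0 i x).
Proof.
apply: C1f_eq (C1fD (C1fM (C1f_cst t) UV1) (C1fM (C1f_cst (1 - t)) UV0)) => [x|i x] //=.
by rewrite !mul0r !add0r.
Qed.

Lemma measurable_wpath t : measurable_fun setT (wpath t).
Proof. by case: (mlb_density (C1f_Upath t)). Qed.

Let le_integrableR (F G : 'rV[R]_d -> R) : measurable_fun setT F ->
  (forall x, `|F x| <= G x) -> Ld.-integrable setT (EFin \o G) ->
  Ld.-integrable setT (EFin \o F).
Proof.
move=> mF FG iG; apply: le_integrable iG => //; first exact/measurable_EFinP.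
by move=> x _ /=; rewrite lee_fin (le_trans (FG x))// ler_norm.
Qed.

Let integrableDR (F G : 'rV[R]_d -> R) : Ld.-integrable setT (EFin \o F) ->
  Ld.-integrable setT (EFin \o G) -> Ld.-integrable setT (EFin \o (fun x => F x + G x)).
Proof. by move=> iF iG; have := integrableD measurableT iF iG; exact: eq_integrable. Qed.

Let integrableZR (F : 'rV[R]_d -> R) (c : R) : Ld.-integrable setT (EFin \o F) ->
  Ld.-integrable setT (EFin \o (fun x => c * F x)).
Proof. by move=> iF; have := integrableZl measurableT c iF; exact: eq_integrable. Qed.

Lemma integrable_wpath t : 0 <= t <= 1 -> Ld.-integrable setT (EFin \o wpath t).
Proof.
move=> t01; apply: (@le_integrableR _ (fun x => t * p1 x + (1 - t) * p0 x)).
- exact: measurable_wpath.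
- by move=> x; rewrite ger0_norm ?wpath_ge0// wpath_le.
- by apply: integrableDR; apply: integrableZR; exact: integrable_density.
Qed.

(** Makes [ln (Zpath t)] nonpositive, so an upper bound on [Upath t] remains valid for the
    normalised potential. *)
Lemma Zpath_le1 t : 0 <= t <= 1 -> Zpath t <= 1.
Proof.
move=> t01; have -> : 1 = \int[Ld]_x (t * p1 x + (1 - t) * p0 x) :> R.
  rewrite RintegralD//; try (by apply: integrableZR; exact: integrable_density).
  rewrite !RintegralZl//; try exact: integrable_density.
  by rewrite !Rintegral_density//; ring.
apply: le_Rintegral => //; first exact: integrable_wpath.
  by apply: integrableDR; apply: integrableZR; exact: integrable_density.
by move=> x _; exact: wpath_le.
Qed.

Lemma abs_Upath_le t x M : 0 <= t <= 1 -> `|U0 x| <= M -> `|U1 x| <= M -> `|Upath t x| <= M.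
Proof.
move=> /andP[t0 t1]; rewrite !ler_norml /Upath => /andP[h1 h2] /andP[h3 h4].
by apply/andP; split; nra.
Qed.

Lemma potential_bounded : exists M, forall t x, 0 <= t <= 1 -> `|x| <= 1 -> `|Upath t x| <= M.
Proof.
have [_ /(_ 1)[M0 UM0]] := C1f_mlb UV0; have [_ /(_ 1)[M1 UM1]] := C1f_mlb UV1.
exists (Num.max M0 M1) => t x t01 x1.
by apply: abs_Upath_le => //; rewrite le_max (UM0, UM1) ?orbT.
Qed.

Lemma Zpath_gt0 t : 0 <= t <= 1 -> 0 < Zpath t.
Proof.
move=> t01; have [M UM] := potential_bounded.
have c0 := Rintegral_cube_gt0 d (@ltr01 R).
apply: (@lt_le_trans _ _ (expR (- M) * \int[Ld]_x cube 1 x)).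
  by rewrite mulr_gt0 ?expR_gt0.
rewrite -mbs_RintegralZl; last exact: mbs_cube.
apply: le_Rintegral => //.
- by apply: mbs_integrable; exact/bdd_suppZ/mbs_cube.
- exact: integrable_wpath.
move=> x _; rewrite /cube indicE; case: (boolP (x \in _)) => [|_]; last by rewrite mulr0 wpath_ge0.
rewrite inE/= mulr1 => x1; rewrite ler_expR lerN2.
by rewrite (le_trans (ler_norm _))// UM.
Qed.

Lemma potential_pathE t x : 0 <= t <= 1 ->
  potential (geometric_path p0 p1 t) x = Upath t x + ln (Zpath t).
Proof.
move=> t01; rewrite /potential geometric_pathE ln_div ?posrE ?expR_gt0 ?Zpath_gt0//.
by rewrite expRK; ring.
Qed.

Lemma path_pos_density t : 0 <= t <= 1 -> pos_density (geometric_path p0 p1 t).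
Proof.
move=> t01; have Z0 := Zpath_gt0 t01; split.
- rewrite (_ : geometric_path p0 p1 t = fun x => wpath t x * (Zpath t)^-1).
    by apply: measurable_funM => //; exact: measurable_wpath.
  by apply/funext => x; rewrite geometric_pathE.
- by move=> x; rewrite geometric_pathE divr_gt0 ?expR_gt0.
under eq_integral => x _ do rewrite geometric_pathE mulrC.
have iw := integrable_wpath t01; have iZ := integrableZR (Zpath t)^-1 iw.
rewrite -[LHS]fineK; last exact: integrable_fin_num.
by congr (_%:E); rewrite -/(Rintegral _ _ _) RintegralZl// mulVf// gt_eqF.
Qed.

Lemma geometric_path_exp t x : 0 <= t <= 1 ->
  geometric_path p0 p1 t x = expR (- (Upath t x + ln (Zpath t))).
Proof.
move=> t01; rewrite -potential_pathE//; apply/esym/exp_potential.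
exact: path_pos_density.
Qed.

Lemma C1f_potential_path t :
  C1f (fun x => Upath t x + ln (Zpath t)) (fun i x => t * V1 i x + (1 - t) * V0 i x).
Proof.
apply: C1f_eq (C1fD (C1f_Upath t) (C1f_cst (ln (Zpath t)))) => [x|i x] //=.
exact: addr0.
Qed.

Lemma path_dissipative t x : 0 <= t <= 1 ->
  a * sqn x - b <= \sum_i x ord0 i * (t * V1 i x + (1 - t) * V0 i x).
Proof.
move=> /andP[t0 t1]; have -> : \sum_i x ord0 i * (t * V1 i x + (1 - t) * V0 i x) =
   t * (\sum_i x ord0 i * V1 i x) + (1 - t) * (\sum_i x ord0 i * V0 i x).
  by rewrite !mulr_sumr -big_split/=; apply: eq_bigr => i _; ring.
have := ler_wpM2l t0 (diss1 x); have := ler_wpM2l (_ : 0 <= 1 - t) (diss0 x).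
by move=> /(_ ltac:(lra)); lra.
Qed.

Lemma path_second_moment t : 0 <= t <= 1 ->
  (\int[Ld]_x (sqn x * geometric_path p0 p1 t x)%:E <=
    (2 / a * (d%:R + b) + 4 / a ^+ 2 * 16)%:E)%E.
Proof.
move=> t01; have pd := path_pos_density t01.
have E : geometric_path p0 p1 t = fun x => expR (- (Upath t x + ln (Zpath t))).
  by apply/funext => x; exact: geometric_path_exp.
rewrite E in pd *; apply: (second_moment_le (C1f_potential_path t)) => //.
- exact: integrable_density.
- by move=> x; exact: path_dissipative.
- exact: Rintegral_density.
Qed.

Let integrable_sqn t : 0 <= t <= 1 ->
  Ld.-integrable setT (EFin \o (fun x => (1 + sqn x) * geometric_path p0 p1 t x)).
Proof.
move=> t01; have pd := path_pos_density t01; have ip := integrable_density pd.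
have pos x : 0 <= geometric_path p0 p1 t x by case: pd => _ /(_ x)/ltW.
have i2 : Ld.-integrable setT (EFin \o (fun x => sqn x * geometric_path p0 p1 t x)).
  apply/integrableP; split.
    apply/measurable_EFinP; apply: measurable_funM; last by case: pd.
    exact: (@mlb_sqn R d).1.
  have E x : `|sqn x * geometric_path p0 p1 t x| = sqn x * geometric_path p0 p1 t x.
    by rewrite ger0_norm// mulr_ge0 ?sqn_ge0.
  under eq_integral => x _ do rewrite /= E.
  by rewrite (le_lt_trans (path_second_moment t01))// ltry.
have := integrableDR ip i2; apply: eq_integrable => // x _ /=.
by rewrite mulrDl mul1r.
Qed.

Lemma geometric_path0 : geometric_path p0 p1 0 = p0.
Proof.
have w0 x : wpath 0 x = p0 x by rewrite /wpath /Upath mul0r add0r subr0 mul1r exp_potential.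
apply/funext => x; rewrite geometric_pathE w0 /Zpath.
by under eq_Rintegral do rewrite w0; rewrite Rintegral_density// divr1.
Qed.

Lemma geometric_path1 : geometric_path p0 p1 1 = p1.
Proof.
have w1 x : wpath 1 x = p1 x by rewrite /wpath /Upath mul1r subrr mul0r addr0 exp_potential.
apply/funext => x; rewrite geometric_pathE w1 /Zpath.
by under eq_Rintegral do rewrite w1; rewrite Rintegral_density// divr1.
Qed.

(* The difference quotient of [wpath] between [t] and [s], continuously extended
   to [s = t]. *)
Definition wslope t s x :=
  if s == t then (U0 x - U1 x) * wpath t x else (wpath s x - wpath t x) / (s - t).

(** Dominates all slopes at once: [|U0 - U1| <= 2 K (1 + |x|^2)], and every [wpath t] is at most
    [p0 + p1]. Its integral is finite because [p0] and [p1], as end points of the path, have finite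
    second moments. *)
Let dom x := 2 * K * ((1 + sqn x) * p0 x + (1 + sqn x) * p1 x).

Let integrable_dom : Ld.-integrable setT (EFin \o dom).
Proof.
have z01 : (0 <= (0 : R)) && ((0 : R) <= 1) by rewrite lexx ler01.
have o01 : (0 <= (1 : R)) && ((1 : R) <= 1) by rewrite lexx ler01.
apply: integrableZR; apply: integrableDR.
  by have := integrable_sqn z01; rewrite geometric_path0; exact.
by have := integrable_sqn o01; rewrite geometric_path1; exact.
Qed.

Let wpath_le_sum t x : 0 <= t <= 1 -> wpath t x <= p0 x + p1 x.
Proof.
move=> t01; apply: le_trans (wpath_le x t01) _; case/andP: t01 => t0 t1.
have [_ /(_ x) P0 _] := p0_density; have [_ /(_ x) P1 _] := p1_density; nra.
Qed.

Let abs_potentialB_le x : `|U0 x - U1 x| <= 2 * K * (1 + sqn x).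
Proof.
rewrite (le_trans (ler_normB _ _))//; have := U0_le x; have := U1_le x; lra.
Qed.

Lemma wpath_slope t s x : wpath s x = wpath t x + wslope t s x * (s - t).
Proof.
rewrite /wslope; case: eqVneq => [->|st]; first by rewrite subrr mulr0 addr0.
by rewrite divfK ?subr_eq0//; ring.
Qed.

Lemma expR_increment_le (u v c : R) : expR u <= c -> expR v <= c ->
  `|expR u - expR v| <= `|u - v| * c.
Proof.
wlog uv : u v / v <= u.
  move=> H uc vc; have [/ltW uv|vu] := ltP u v; last exact: H.
  by rewrite distrC [X in _ <= X * _]distrC; exact: H.
move=> uc vc; rewrite ger0_norm ?subr_ge0 ?ler_expR// ger0_norm ?subr_ge0//.
have := ler_wpM2l (expR_ge0 u) (expR_ge1Dx (v - u)); rewrite -expRD [u + _]addrC subrK => h.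
have : (u - v) * expR u <= (u - v) * c by rewrite ler_wpM2l// subr_ge0.
lra.
Qed.

Let wslope_le t s x : 0 <= t <= 1 -> 0 <= s <= 1 -> `|wslope t s x| <= dom x.
Proof.
move=> t01 s01; have q := abs_potentialB_le x.
have P := wpath_le_sum x t01; have P' := wpath_le_sum x s01.
have -> : dom x = 2 * K * (1 + sqn x) * (p0 x + p1 x) by rewrite /dom; ring.
rewrite /wslope; case: eqVneq => [_|st].
  by rewrite normrM (ger0_norm (wpath_ge0 _ _)) ler_pM ?wpath_ge0.
rewrite normrM normfV ler_pdivrMr ?normr_gt0 ?subr_eq0//.
apply: le_trans (expR_increment_le P' P) _.
have -> : - Upath s x - - Upath t x = (U0 x - U1 x) * (s - t) by rewrite /Upath; ring.
rewrite normrM [leRHS]mulrAC ler_wpM2r//; last by rewrite ler_wpM2r.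
exact: le_trans (wpath_ge0 t x) P.
Qed.

(** [wslope t] is the Caratheodory slope of [s |-> wpath s x] at [t]. In this form the derivative of
    [Zpath] reduces to continuity of an integral with a parameter. *)
Lemma continuous_wslope t x : {for t, continuous (fun s => wslope t s x)}.
Proof.
have dw : is_derive t (1 : R) (fun s => wpath s x) ((U0 x - U1 x) * wpath t x).
  rewrite /wpath /Upath.
  have d1 : is_derive t (1 : R) (fun s => - (s * U1 x + (1 - s) * U0 x)) (U0 x - U1 x).
    by apply: is_derive_eq; rewrite /GRing.scale/=; ring.
  rewrite mulrC; exact: (@is_derive1_comp _ expR
    (fun s => - (s * U1 x + (1 - s) * U0 x)) t _ _ (is_derive_expR _) d1).
have [g [gE cg gt]] := proj1 (is_derive1_caratheodory _ _ _) dw.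
have -> // : (fun s => wslope t s x) = g.
apply/funext => s; rewrite /wslope; case: eqVneq => [->//|st].
by rewrite gE mulfK// subr_eq0.
Qed.

Definition Zslope t s := \int[Ld]_x wslope t s x.

Lemma measurable_wslope t s : measurable_fun setT (wslope t s).
Proof.
rewrite /wslope; case: eqVneq => _; apply: measurable_funM => //.
- by apply: measurable_funB; [case: (C1f_mlb UV0)|case: (C1f_mlb UV1)].
- exact: measurable_wpath.
- by apply: measurable_funB; exact: measurable_wpath.
Qed.

Let integrable_wslope t s : 0 <= t <= 1 -> 0 <= s <= 1 ->
  Ld.-integrable setT (EFin \o wslope t s).
Proof.
move=> t01 s01; apply: (@le_integrableR _ dom) => //; first exact: measurable_wslope.
by move=> x; exact: wslope_le.
Qed.

Lemma Zpath_slope t s : 0 <= t <= 1 -> 0 <= s <= 1 ->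
  Zpath s = Zpath t + Zslope t s * (s - t).
Proof.
move=> t01 s01; rewrite /Zslope mulrC -RintegralZl//; last exact: integrable_wslope.
rewrite -RintegralD//; last exact/integrableZR/integrable_wslope.
  by apply: eq_Rintegral => x _; rewrite [LHS](wpath_slope t) mulrC.
exact: integrable_wpath.
Qed.

(* Dominated convergence only holds inside [[0, 1]]. *)
Definition clamp t s : R := if 0 <= s <= 1 then s else t.

Lemma clamp01 t s : 0 <= t <= 1 -> 0 <= clamp t s <= 1.
Proof. by rewrite /clamp; case: ifP. Qed.

Lemma continuous_Zslope t : 0 <= t <= 1 ->
  {for t, continuous (fun s => Zslope t (clamp t s))}.
Proof.
move=> t01; apply/(@cvg_nbhsP _ R^o) => u ut.
have ct : clamp t t = t by rewrite /clamp t01.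
have cut : clamp t (u n) @[n --> \oo] --> t.
  apply/cvgrPdist_le => e e0; move/cvgrPdist_le : ut => /(_ e e0).
  apply: filterS => n; rewrite /clamp; case: ifP => // _ _.
  by rewrite subrr normr0 ltW.
rewrite ct; apply: fine_cvg; rewrite fineK; last first.
  by apply: integrable_fin_num => //; exact: integrable_wslope.
apply: (@dominated_cvg _ _ _ Ld setT measurableT
    (fun n x => (wslope t (clamp t (u n)) x)%:E) _ (EFin \o dom)) => //=.
- by move=> n; apply/measurable_EFinP; exact: measurable_wslope.
- move=> x _; apply: cvg_EFin; first exact: nearW.
  apply: (@continuous_cvg _ _ _ \oo _ (fun n => clamp t (u n)) (fun s => wslope t s x) t) => //.
  exact: continuous_wslope.
- by move=> n x _; rewrite lee_fin; apply: wslope_le => //; exact: clamp01.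
Qed.

(** Makes limits within [[0, 1]] unique, end points included: there is room to the right of [t] when
    [t <= 1/2] and to the left otherwise. *)
Lemma within01_proper (t : R) : 0 <= t <= 1 -> ProperFilter (within `[0, 1]%classic t^').
Proof.
move=> /andP[t0 t1]; apply: Build_ProperFilter_ex => P.
rewrite /within/= => /nbhs_ballP[e /= e0 H].
pose h := Num.min (e / 2) (1 / 2).
have h0 : 0 < h by rewrite lt_min !divr_gt0.
have he : h < e by rewrite gt_min; apply/orP; left; lra.
have h1 : h <= 1 / 2 by rewrite ge_min lexx orbT.
have [t2|t2] := leP t (1 / 2).
  exists (t + h); apply: H => /=.
  - by rewrite /ball/= opprD addrA subrr sub0r normrN gtr0_norm.
  - by rewrite gt_eqF// ltrDl.
  - by rewrite in_itv/=; apply/andP; split; lra.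
exists (t - h); apply: H => /=.
- by rewrite /ball/= opprB addrC subrK gtr0_norm.
- by rewrite lt_eqF// gtrBl.
- by rewrite in_itv/=; apply/andP; split; lra.
Qed.

Lemma cvg_diff_quotient_potential (t : R) x : 0 <= t <= 1 ->
  diff_quotient (fun s => potential (geometric_path p0 p1 s) x) t s
    @[s --> within `[0, 1]%classic t^'] -->
  U1 x - U0 x + (Zpath t)^-1 * Zslope t t.
Proof.
move=> t01; have Z0 := Zpath_gt0 t01.
have [g [gE cg gt]] := proj1 (is_derive1_caratheodory _ _ _) (is_derive1_ln Z0).
pose k s := Zslope t (clamp t s).
(* [g] is the Caratheodory slope of [ln] at [Zpath t]. [Psi] is continuous at [t] in the full
   topology and equals the difference quotient at the other points of [[0, 1]]. *)
pose Psi s := U1 x - U0 x + g (Zpath t + k s * (s - t)) * k s.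
have kt : k t = Zslope t t by rewrite /k /clamp t01.
have cPsi : Psi s @[s --> t] --> Psi t.
  have ck : k s @[s --> t] --> k t := continuous_Zslope t01.
  apply: cvgD; first exact: cvg_cst.
  apply: cvgM => //; apply: continuous_cvg.
    by rewrite subrr mulr0 addr0.
  apply: cvgD; first exact: cvg_cst.
  by apply: cvgM => //; apply: cvgB; [exact: cvg_id|exact: cvg_cst].
have PsiE : Psi t = U1 x - U0 x + (Zpath t)^-1 * Zslope t t.
  by rewrite /Psi subrr mulr0 addr0 gt kt.
rewrite -PsiE.
have wt : within `[0, 1]%classic t^' --> t.
  exact: cvg_trans (cvg_within _) (cvg_within _).
have wPsi := cvg_trans (cvg_app Psi wt) cPsi.
have FF := within01_proper t01.
apply: cvg_trans wPsi; apply: near_eq_cvg; near=> s.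
have s01 : 0 <= s <= 1.
  have : s \in `[0, 1]%classic by rewrite inE; near: s; exact: near_withinT.
  by rewrite inE/= in_itv.
have st : s != t by near: s; apply: cvg_within; exact: withinT.
rewrite /diff_quotient !potential_pathE// /Psi /k /clamp s01.
have ln_s : ln (Zpath s) - ln (Zpath t) =
    g (Zpath t + Zslope t s * (s - t)) * (Zslope t s * (s - t)).
  by rewrite [in ln (Zpath s)](Zpath_slope t01 s01) gE; congr (_ * _); ring.
have -> : Upath s x + ln (Zpath s) - (Upath t x + ln (Zpath t)) =
  (U1 x - U0 x) * (s - t) + (ln (Zpath s) - ln (Zpath t)) by rewrite /Upath; ring.
by rewrite ln_s mulrA -mulrDl mulfK// subr_eq0.
Unshelve. all: by end_near. Qed.

Lemma Zslope_diag_le t : 0 <= t <= 1 ->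
  `|(Zpath t)^-1 * Zslope t t| <= 2 * K * (1 + (2 / a * (d%:R + b) + 4 / a ^+ 2 * 16)).
Proof.
move=> t01; have pd := path_pos_density t01; have ip := integrable_density pd.
have pos x : 0 <= geometric_path p0 p1 t x by case: pd => _ /(_ x)/ltW.
have i1 := integrable_sqn t01; have sm := path_second_moment t01.
set S := 2 / a * (d%:R + b) + 4 / a ^+ 2 * 16 in sm *.
have E : (Zpath t)^-1 * Zslope t t = \int[Ld]_x ((U0 x - U1 x) * geometric_path p0 p1 t x).
  rewrite -RintegralZl//; last exact: integrable_wslope.
  by apply: eq_Rintegral => x _; rewrite /wslope eqxx geometric_pathE; ring.
have iE : Ld.-integrable setT (EFin \o (fun x => (U0 x - U1 x) * geometric_path p0 p1 t x)).
  apply: (@le_integrableR _ (fun x => 2 * K * ((1 + sqn x) * geometric_path p0 p1 t x))).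
  - apply: measurable_funM; last by case: pd.
    by apply: measurable_funB; [case: (C1f_mlb UV0)|case: (C1f_mlb UV1)].
  - by move=> x; rewrite normrM (ger0_norm (pos x)) mulrA ler_wpM2r.
  - exact: integrableZR.
rewrite E (le_trans (le_normr_Rintegral measurableT iE))//.
apply: (@le_trans _ _ (2 * K * \int[Ld]_x ((1 + sqn x) * geometric_path p0 p1 t x))).
  rewrite -RintegralZl//; apply: le_Rintegral => //.
  - exact: (integrable_norm iE).
  - exact: integrableZR.
  - by move=> x _; rewrite normrM (ger0_norm (pos x)) mulrA ler_wpM2r.
rewrite ler_wpM2l ?mulr_ge0//.
have i2 : Ld.-integrable setT (EFin \o (fun x => sqn x * geometric_path p0 p1 t x)).
  have := integrableDR i1 (integrableZR (-1) ip); apply: eq_integrable => // x _ /=.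
  by congr (_%:E); ring.
under eq_Rintegral do rewrite mulrDl mul1r.
rewrite RintegralD// Rintegral_density// lerD2l -lee_fin /Rintegral fineK//.
exact: integrable_fin_num.
Qed.

End geometric_path_facts.

(** * Bounds on gradients under convex combinations *)

Section path_regularity.
Context {R : realType} {d : nat}.
Implicit Types (U : 'rV[R]_d -> R) (x y : 'rV[R]_d).

Lemma C1f_grad U V x : C1f U V -> grad U x = \row_i V i x.
Proof.
by move=> [_ _ dU]; apply/rowP => i; rewrite !mxE /partial; have [_ ->] := dU i x.
Qed.

Lemma sqn_convex (t : R) x y : 0 <= t <= 1 ->
  sqn (t *: x + (1 - t) *: y) <= t * sqn x + (1 - t) * sqn y.
Proof.
move=> /andP[t0 t1]; rewrite /sqn !mulr_sumr -big_split/=; apply: ler_sum => i _.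
rewrite !mxE; have : 0 <= t * (1 - t) * (x ord0 i - y ord0 i) ^+ 2.
  by rewrite mulr_ge0 ?sqr_ge0// mulr_ge0//; lra.
lra.
Qed.

Lemma differentiable_affine_comb U W (s t c : R) x :
  differentiable U x -> differentiable W x ->
  differentiable (fun y => s * U y + t * W y + c) x.
Proof.
move=> dU dW; have dsU : differentiable (s *: U) x by exact: differentiableZ.
have dtW : differentiable (t *: W) x by exact: differentiableZ.
have dc : differentiable (cst c : 'rV[R]_d -> R) x by exact: differentiable_cst.
exact (differentiableD (differentiableD dsU dtW) dc).
Qed.

Lemma convex_ge (t u v m : R) : 0 <= t <= 1 -> m <= u -> m <= v ->
  m <= t * u + (1 - t) * v.
Proof.
move=> /andP[t0 t1] mu mv; have -> : m = t * m + (1 - t) * m by ring.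
by rewrite lerD// ler_wpM2l// subr_ge0.
Qed.

Lemma convex_le (t u v m : R) : 0 <= t <= 1 -> u <= m -> v <= m ->
  t * u + (1 - t) * v <= m.
Proof.
move=> t01 um vm; rewrite -lerN2 opprD -!mulrN.
by apply: convex_ge; rewrite ?lerN2.
Qed.

Lemma dotp_convex (t : R) x y z :
  dotp x (t *: y + (1 - t) *: z) = t * dotp x y + (1 - t) * dotp x z.
Proof.
by rewrite /dotp !mulr_sumr -big_split/=; apply: eq_bigr => i _; rewrite !mxE; ring.
Qed.

Lemma enorm_le_sqn x (c : R) y : 0 <= c ->
  (enorm x <= c * enorm y) = (sqn x <= c ^+ 2 * sqn y).
Proof. by move=> c0; rewrite -!enorm_sqr -exprMn ler_sqr ?nnegrE ?mulr_ge0 ?enorm_ge0. Qed.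

Lemma lipschitz_sqn U (L M : R) x y : lipschitz_with (grad U) L -> L <= M ->
  sqn (grad U x - grad U y) <= M ^+ 2 * sqn (x - y).
Proof.
move=> [L0 LU] LM; have := LU x y; rewrite enorm_le_sqn// => /le_trans; apply.
by rewrite ler_wpM2r ?sqn_ge0// ler_sqr ?nnegrE// (le_trans L0).
Qed.

Lemma dissipative_sqn U (a b r a' b' : R) x : dissipative_with (grad U) a b r ->
  a' <= a -> b <= b' -> a' * sqn x - b' <= dotp x (grad U x).
Proof.
move=> [a0 b0 r0 /(_ x)] H aa bb; apply: le_trans H.
rewrite enorm_sqr lerB ?ler_wpM2r ?sqn_ge0// (le_trans _ bb)//.
by rewrite ler_piMr ?(ltW b0)// indicE; case: (_ \in _).
Qed.

Lemma dissipative_weaken (v : 'rV[R]_d -> 'rV[R]_d) (a b r a' b' r' : R) x :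
  dissipative_with v a b r -> a' <= a -> b <= b' -> r <= r' ->
  a' * enorm x ^+ 2 - b' * \1_(eball r') x <= dotp x (v x).
Proof.
move=> [_ b0 _ /(_ x) H] aa bb rr; apply: le_trans H.
rewrite lerB ?ler_wpM2r ?sqr_ge0// !indicE; have [xr|_] := boolP (x \in eball r).
  have xr' : x \in eball r' by move: xr; rewrite !inE => /lt_le_trans; exact.
  by rewrite xr' !mulr1.
by rewrite mulr0 mulr_ge0// (le_trans (ltW b0)).
Qed.

End path_regularity.

Theorem proposition4p11 (R : realType) (d : nat) (p0 p1 : 'rV[R]_d -> R)
    (p0_density : pos_density p0) (p1_density : pos_density p1)
    (U0_diff : forall x, differentiable (potential p0) x)
    (U1_diff : forall x, differentiable (potential p1) x)
    (U0_lip : exists L : R, lipschitz_with (grad (potential p0)) L)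
    (U1_lip : exists L : R, lipschitz_with (grad (potential p1)) L)
    (U0_diss : dissipative (grad (potential p0)))
    (U1_diss : dissipative (grad (potential p1))) :
  path_assumption `[0, 1]%classic (geometric_path p0 p1).
Proof.
have [L0 LU0] := U0_lip; have [L1 LU1] := U1_lip.
have [a0 [b0 [r0 D0]]] := U0_diss; have [a1 [b1 [r1 D1]]] := U1_diss.
set U0 := potential p0 in U0_diff LU0 D0 *; set U1 := potential p1 in U1_diff LU1 D1 *.
have UV0 := lipschitz_C1f U0_diff LU0; have UV1 := lipschitz_C1f U1_diff LU1.
pose L := Num.max L0 L1; pose a := Num.min a0 a1; pose b := Num.max b0 b1.
pose r := Num.max r0 r1.
have L0L : L0 <= L by rewrite le_max lexx.
have L1L : L1 <= L by rewrite le_max lexx orbT.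
have Lge0 : 0 <= L by case: LU0 => l0 _; exact: le_trans L0L.
have a_gt0 : 0 < a by rewrite lt_min; case: D0 => -> _ _ _; case: D1 => -> _ _ _.
have b_gt0 : 0 < b by rewrite lt_max; case: D0 => _ -> _ _.
have r_gt0 : 0 < r by rewrite lt_max; case: D0 => _ _ -> _.
have aa0 : a <= a0 by rewrite ge_min lexx.
have aa1 : a <= a1 by rewrite ge_min lexx orbT.
have bb0 : b0 <= b by rewrite le_max lexx.
have bb1 : b1 <= b by rewrite le_max lexx orbT.
have rr0 : r0 <= r by rewrite le_max lexx.
have rr1 : r1 <= r by rewrite le_max lexx orbT.
have diss0 x : a * sqn x - b <= \sum_i x ord0 i * grad U0 x ord0 i.
  exact: dissipative_sqn D0 aa0 bb0.
have diss1 x : a * sqn x - b <= \sum_i x ord0 i * grad U1 x ord0 i.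
  exact: dissipative_sqn D1 aa1 bb1.
(* Large enough for both [potential_growth] and [lipschitz_grad_growth]. *)
pose k (U : 'rV[R]_d -> R) (l : R) := `|U 0| + 2 * sqn (grad U 0) + 2 * l ^+ 2 + 1.
have k_ge0 U l : 0 <= k U l.
  have := normr_ge0 (U 0); have := sqn_ge0 (grad U 0); have := sqr_ge0 l.
  by rewrite /k; lra.
pose K := k U0 L0 + k U1 L1.
have K_ge0 : 0 <= K by rewrite addr_ge0.
have kU U l x : (forall x, differentiable U x) -> lipschitz_with (grad U) l -> k U l <= K ->
    `|U x| <= K * (1 + sqn x) /\ sqn (grad U x) <= K * (1 + sqn x).
  move=> dU lU kK; have s0 := sqn_ge0 x.
  have kK' := ler_wpM2r (_ : 0 <= 1 + sqn x) kK; have {}kK' := kK' ltac:(lra).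
  have g0 := sqn_ge0 (grad U 0); have l0 := sqr_ge0 l; have n0 := normr_ge0 (U 0).
  have gs := mulr_ge0 g0 s0; have ls := mulr_ge0 l0 s0; have ns := mulr_ge0 n0 s0.
  split; apply: le_trans kK'.
    by apply: le_trans (potential_growth x dU lU) _; rewrite /k; lra.
  by apply: le_trans (lipschitz_grad_growth x lU) _; rewrite /k; lra.
have kU0 x := kU U0 L0 x U0_diff LU0 (ltac:(by rewrite lerDl)).
have kU1 x := kU U1 L1 x U1_diff LU1 (ltac:(by rewrite lerDr)).
have U0K x := (kU0 x).1; have U1K x := (kU1 x).1.
have I01 (t : R) : `[0, 1]%classic t -> 0 <= t <= 1 by rewrite /= in_itv.
have UV (t : R) := C1f_potential_path UV0 UV1 t.
have potE (t : R) : 0 <= t <= 1 -> potential (geometric_path p0 p1 t) =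
    fun x => Upath p0 p1 t x + ln (Zpath p0 p1 t).
  by move=> t01; apply/funext => x; exact (potential_pathE p0_density p1_density UV0 UV1 x t01).
have gradE (t : R) x : 0 <= t <= 1 ->
    grad (potential (geometric_path p0 p1 t)) x = t *: grad U1 x + (1 - t) *: grad U0 x.
  by move=> t01; rewrite potE// (C1f_grad x (UV t)); apply/rowP => i; rewrite !mxE.
have pathd (t : R) : 0 <= t <= 1 -> pos_density (geometric_path p0 p1 t).
  by move=> t01; exact (path_pos_density p0_density p1_density UV0 UV1 t01).
have cvgq (t : R) x : 0 <= t <= 1 ->
    diff_quotient (fun s => potential (geometric_path p0 p1 s) x) t
      @ within `[0, 1]%classic t^' -->
    U1 x - U0 x + (Zpath p0 p1 t)^-1 * Zslope p0 p1 t t.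
  move=> t01; exact: (cvg_diff_quotient_potential p0_density p1_density UV0 UV1 a_gt0
    (ltW b_gt0) diss0 diss1 U0K U1K).
split.
- split; first exact: interval_is_interval.
    by rewrite /= in_itv/= lexx ler01.
  by move=> t /I01/andP[t0 _]; rewrite /= in_itv/= t0.
- by move=> t /I01; exact: pathd.
- by move=> t x /I01 t01; apply/cvg_ex; eexists; exact: cvgq t01.
- pose S := 2 / a * (d%:R + b) + 4 / a ^+ 2 * 16.
  have S0 : 0 <= S.
    have ? := ltW a_gt0; have ? := ltW b_gt0.
    by apply: addr_ge0; apply: mulr_ge0; rewrite ?divr_ge0 ?addr_ge0 ?sqr_ge0.
  (* [2 K (1 + |x|^2)] from [U1 - U0] plus [2 K (1 + S)] from the derivative of [ln Z]; the last [1]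
     ensures strict positivity. *)
  exists (2 * K * (2 + S) + 1); first by rewrite ltr_wpDl// !mulr_ge0// addr_ge0.
  move=> x t /I01 t01; have FF := within01_proper t01.
  rewrite /derive_within (cvg_lim _ (cvgq t x t01))//.
  have h1 := Zslope_diag_le p0_density p1_density UV0 UV1 a_gt0 (ltW b_gt0) diss0 diss1
    K_ge0 U0K U1K t01.
  rewrite (le_trans (ler_normD _ _))//.
  have h2 : `|U1 x - U0 x| <= 2 * K * (1 + sqn x).
    rewrite (le_trans (ler_normB _ _))//; have := U0K x; have := U1K x; lra.
  rewrite enorm_sqr; rewrite -/S in h1; have s0 := sqn_ge0 x.
  have := mulr_ge0 (mulr_ge0 K_ge0 S0) s0; have := mulr_ge0 K_ge0 s0; lra.
- exists (fun=> L), (fun=> a), (fun=> b), (fun=> r) => Ip; split.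
  + move=> t /I01 t01; split.
      move=> x; rewrite potE//.
      exact: differentiable_affine_comb.
    split=> // x y; rewrite enorm_le_sqn// !gradE//.
    have -> : t *: grad U1 x + (1 - t) *: grad U0 x - (t *: grad U1 y + (1 - t) *: grad U0 y) =
        t *: (grad U1 x - grad U1 y) + (1 - t) *: (grad U0 x - grad U0 y).
      by rewrite !scalerBr opprD addrACA.
    apply: le_trans (sqn_convex _ _ t01) _.
    exact: convex_le t01 (lipschitz_sqn x y LU1 L1L) (lipschitz_sqn x y LU0 L0L).
  + move=> t [/I01 t01 _]; split => // x; rewrite gradE// dotp_convex.
    exact: convex_ge t01 (dissipative_weaken x D1 aa1 bb1 rr1)
      (dissipative_weaken x D0 aa0 bb0 rr0).
  + split.
    * by apply: (@le_lt_trans _ _ L%:E); rewrite ?ltry//; apply: ge_ereal_sup => _ [t _ <-].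
    * by apply: (@lt_le_trans _ _ a%:E); rewrite ?lte_fin//; apply: le_ereal_inf_tmp => _ [t _ <-].
    * by apply: (@le_lt_trans _ _ b%:E); rewrite ?ltry//; apply: ge_ereal_sup => _ [t _ <-].
    * by apply: (@le_lt_trans _ _ r%:E); rewrite ?ltry//; apply: ge_ereal_sup => _ [t _ <-].
- have [rho Hrho] := @lsi_uniform R d a b K a_gt0 (ltW b_gt0) K_ge0.
  have [M UM] : exists M, forall t x, 0 <= t <= 1 -> `|x| <= rho -> `|Upath p0 p1 t x| <= M.
    have [_ /(_ rho)[M0 UM0]] := C1f_mlb UV0; have [_ /(_ rho)[M1 UM1]] := C1f_mlb UV1.
    exists (Num.max M0 M1) => t x t01 x1.
    by apply: abs_Upath_le => //; rewrite le_max (UM0, UM1) ?orbT.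
  have [C C0 HC] := Hrho M.
  (* The family is indexed by all reals, so a probability is also chosen outside [[0, 1]], where
     nothing is asked of it. *)
  have piE (t : R) : exists nu : probability 'rV[R]_d R,
      0 <= t <= 1 -> has_density nu (geometric_path p0 p1 t).
    have [t01|_] := boolP (0 <= t <= 1).
      by have [nu nup] := exists_probability_density (pathd t t01); exists nu.
    by have [nu _] := exists_probability_density p0_density; exists nu.
  have [pi piP] := choice piE.
  have lsiC t : 0 <= t <= 1 -> lsi_with (pi t) C.
    move=> t01; have E : geometric_path p0 p1 t =
        fun x => expR (- (Upath p0 p1 t x + ln (Zpath p0 p1 t))).
      by apply/funext => x; exact (geometric_path_exp p0_density p1_density UV0 UV1 x t01).
    have pd := pathd t t01; have hd := piP t t01; rewrite E in pd hd.
    (* With this shift the oscillation hypothesis concerns [Upath] alone, which [M] bounds for all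
       [t]. *)
    apply: (HC _ _ (ln (Zpath p0 p1 t)) _ (UV t)) => //.
    + by move=> x; exact (path_dissipative diss0 diss1 x t01).
    + move=> x; rewrite -[leRHS]addr0 lerD//.
        by rewrite (le_trans (ler_norm _))// abs_Upath_le.
      by apply: ln_le0; exact (Zpath_le1 p0_density p1_density UV0 UV1 t01).
    + move=> x; have -> : \sum_i (t * grad U1 x ord0 i + (1 - t) * grad U0 x ord0 i) ^+ 2 =
          sqn (t *: grad U1 x + (1 - t) *: grad U0 x).
        by apply: eq_bigr => i _; rewrite !mxE.
      apply: le_trans (sqn_convex _ _ t01) _.
      exact: convex_le t01 (kU1 x).2 (kU0 x).2.
    + by move=> x xr; rewrite addrK; exact: UM.
  exists pi; split.
  + by move=> t /I01; exact: piP.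
  + by move=> t /I01 t01; exists C; exact: lsiC.
  + apply: (@le_lt_trans _ _ C%:E); last exact: ltry.
    apply: ge_ereal_sup => _ [t /I01 t01 <-]; apply: ereal_inf_lbound.
    by exists C => //; exact: lsiC.
Qed.
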